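(* Let $p\in\mathbb Z_+$, $n\in\mathbb N$, $0\ne\kappa\in\mathbb C$, let $\tilde M_1,\dots,\tilde M_\ell\in\tilde{\mathcal O}$, and let $\tilde\mu\in\tilde{\mathcal P}^+$ be such that $\bar\mu\in\bar{\mathcal P}^+_{(p,n)}$. Let $\bar M_i=\overline{\mathfrak{tr}}_{(p,n)}(\bar T(\tilde M_i))$, regarded through $\iota$ as a $\bar{\mathcal G}_{(p,n)}\oplus\mathbb CK$-module (an object of $\mathring{\bar{\mathcal O}}_{(p,n)}$), and for $r\in\mathbb Z_+$, $k\in\mathbb N$ let $N_i=\mathfrak{tr}_{(r,k)}(T(\tilde M_i))$, regarded through $\iota$ as a $\mathcal G_{(r,k)}\oplus\mathbb CK$-module (the corresponding object of $\mathring{\mathcal O}_{(r,k)}$). Then for all sufficiently large $r$ and $k$ there is a linear isomorphism from the space of singular solutions of weight $\bar\mu$ of the (super) KZ equations over $\bar{\mathcal G}_{(p,n)}$ on $\bar M_1\otimes\cdots\otimes\bar M_\ell$ to the space of singular solutions of the corresponding weight $\mu$ of the KZ equations over the Lie algebra $\mathcal G_{(r,k)}\cong\mathfrak{gl}(r+k)$ on $N_1\otimes\cdots\otimes N_\ell$.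
   Context: Everything is over $\mathbb C$; $\mathbb Z_+=\{0,1,\dots\}$, $\mathbb N=\{1,2,\dots\}$, $\langle x\rangle=\max\{x,0\}$; $\mu'$ is the conjugate of a partition $\mu$. Fix $q,m\in\mathbb Z_+$ (suppressed in the notation of barred objects) and an integer $\ell\ge2$. Algebras. Let $\tilde I=\frac12\mathbb Z\setminus\{0\}$ and, for $p\in\mathbb Z_+\cup\{\infty\}$, $n\in\mathbb N\cup\{\infty\}$, $I_{(p,n)}=\{i\in\frac12+\mathbb Z:-p<i<n\}$, $\bar I_{(p,n)}=\{i\in\mathbb Z\setminus\{0\}:-p\le i\le m\}\cup\{i\in\frac12+\mathbb Z:-q<i<n\}$. $\tilde I,I_{(p,n)}$ have the usual order; $\bar I_{(p,n)}$ is ordered: negative integers, then negative half-odd-integers, then positive integers, then positive half-odd-integers, each group increasing. The subscript $(\infty,\infty)$ is dropped. $E_{i,j}$ ($i,j\in\tilde I$) are matrix units on the superspace with basis $v_i$, even iff $i\in\mathbb Z$; $E_i=E_{i,i}$; $\mathrm{Str}(E_{i,j})=(-1)^{2i}\delta_{i,j}$. $\tilde{\mathcal G},\mathcal G_{(p,n)},\bar{\mathcal G}_{(p,n)}$ are the Lie superalgebras spanned by the $E_{i,j}$ with indices in $\tilde I,I_{(p,n)},\bar I_{(p,n)}$. With $J=-\sum_{r<0}E_r$, $\tilde{\mathfrak g}=\tilde{\mathcal G}\oplus\mathbb CK$ has $K$ even and central and bracket $[A,B]+\mathrm{Str}([J,A]B)K$; $\mathfrak g_{(p,n)}=\mathcal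 G_{(p,n)}\oplus\mathbb CK$ and $\bar{\mathfrak g}_{(p,n)}=\bar{\mathcal G}_{(p,n)}\oplus\mathbb CK$ as subalgebras of $\tilde{\mathfrak g}$. The map $\iota(A)=A+\mathrm{Str}(JA)K$, $\iota(K)=K$, is an isomorphism from the direct sum Lie superalgebra $\mathcal G_{(p,n)}\oplus\mathbb CK$ to $\mathfrak g_{(p,n)}$ (similarly $\bar{\mathcal G}_{(p,n)}\oplus\mathbb CK\to\bar{\mathfrak g}_{(p,n)}$). For $\mathfrak a\in\{\tilde{\mathfrak g},\mathfrak g_{(p,n)},\bar{\mathfrak g}_{(p,n)}\}$: the Cartan subalgebra is spanned by $K$ and the $E_i$; weights are finite combinations of the dual basis $\Lambda_0,\epsilon_i$; the Borel subalgebra is spanned by the Cartan subalgebra and the $E_{i,j}$ with $i<j$ in the given order; the Levi subalgebra $\mathfrak l_{\mathfrak a}$ is spanned by the Cartan subalgebra and the $E_{i,j}$ with $i,j$ of the same sign. Weights. For a partition $\nu$ and $i\in\mathbb N$ let $\theta(\nu)_{i-1/2}=\langle\nu'_i-i+1\rangle$, $\theta(\nu)_i=\langle\nu_i-i\rangle$. For partitions $\lambda^\pm$ and $d\in\mathbb C$ put $$\tilde\lambda=-\sum_{r\in\frac12\mathbb N}\theta(\lambda^-)_r\epsilon_{-r}+\sum_{i\in\frac12\mathbb N}\theta(\lambda^+)_i\epsilon_i+d\Lambda_0,\qquad \lambda=-\sum_{r\in\mathbb N}(\lambda^-)'_r\epsilon_{-r+\frac12}+\sum_{i\in\mathbb N}(\lambda^+)'_i\epsilon_{i-\frac12}+d\Lambda_0,$$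 $$\bar\lambda=-\sum_{r\in\mathbb N}\langle\lambda^-_r-q\rangle\epsilon_{-r}-\sum_{s=1}^q(\lambda^-)'_s\epsilon_{-s+\frac12}+\sum_{i=1}^m\lambda^+_i\epsilon_i+\sum_{j\in\mathbb N}\langle(\lambda^+)'_j-m\rangle\epsilon_{j-\frac12}+d\Lambda_0.$$ $\tilde{\mathcal P}^+,\mathcal P^+,\bar{\mathcal P}^+$ are the sets of all $\tilde\lambda,\lambda,\bar\lambda$; $\tilde\lambda\leftrightarrow\lambda\leftrightarrow\bar\lambda$ are bijections (this is the correspondence of weights). $\mathcal P^+_{(p,n)}$ consists of the $\lambda$ with $(\lambda^+)'_{n+1}=(\lambda^-)'_{p+1}=0$, $\bar{\mathcal P}^+_{(p,n)}$ of the $\bar\lambda$ with $(\lambda^+)'_{n+1}\le m$, $\lambda^-_{p+1}\le q$ (no condition for infinite $n$, resp. $p$). Categories. $\tilde{\mathcal O}$ (resp. $\mathcal O_{(p,n)}$, $\bar{\mathcal O}_{(p,n)}$) consists of the $\mathfrak a$-modules $M$ ($\mathfrak a=\tilde{\mathfrak g},\mathfrak g_{(p,n)},\bar{\mathfrak g}_{(p,n)}$) that are semisimple over the Cartan subalgebra with finite-dimensional weight spaces, such that (i) over $\mathfrak l_{\mathfrak a}$, $M$ is a direct sum of irreducible highest weight modules with highest weights in $\tilde{\mathcal P}^+$ (resp. $\mathcal P^+_{(p,n)}$, $\bar{\mathcal P}^+_{(p,n)}$); (ii) there are finitely many $\lambda^1,\dots,\lambda^h$ in that set such that for each weight $\gamma$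 of $M$ some $\lambda^i-\gamma$ is a $\mathbb Z_+$-combination of simple roots. Modules are $\mathbb Z_2$-graded by the parity of $\sum_{i\in\frac12+\mathbb Z}\gamma(E_i)$. $\mathring{\mathcal O}_{(p,n)}$, $\mathring{\bar{\mathcal O}}_{(p,n)}$ are the categories of $\mathcal G_{(p,n)}\oplus\mathbb CK$-, resp. $\bar{\mathcal G}_{(p,n)}\oplus\mathbb CK$-modules obtained by pulling back the modules in $\mathcal O_{(p,n)}$, $\bar{\mathcal O}_{(p,n)}$ via $\iota$. Functors. For $M\in\tilde{\mathcal O}$, $T(M)$ (resp. $\bar T(M)$) is the sum of the weight spaces of $M$ whose weights are supported on $\Lambda_0$ and $\epsilon_i$, $i\in I$ (resp. $i\in\bar I$); it lies in $\mathcal O$ (resp. $\bar{\mathcal O}$). For $M\in\mathcal O$ (resp. $\bar{\mathcal O}$), $\mathfrak{tr}_{(r,k)}(M)$ (resp. $\overline{\mathfrak{tr}}_{(p,n)}(M)$) is the sum of the weight spaces whose weights are supported on $\Lambda_0$ and $\epsilon_i$, $i\in I_{(r,k)}$ (resp. $i\in\bar I_{(p,n)}$); it lies in $\mathcal O_{(r,k)}$ (resp. $\bar{\mathcal O}_{(p,n)}$). KZ equations. $U$ is a nonempty open subset of $\{z\in\mathbb C^\ell:z_i\ne z_j\ (i\ne j)\}$ on which a branch of $\log(z_i-z_j)$ is fixed for all $i<j$. For finite $p,n$, the Hamiltonians are $\bar H^i=\sum_{j\ne i}\frac{1}{z_i-z_j}\sum_{a,b\in\bar I_{(p,n)}}(-1)^{2b}E^{(i)}_{a,b}E^{(j)}_{b,a}$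 for $\bar{\mathcal G}_{(p,n)}$, and $H^i$ for $\mathcal G_{(r,k)}$ given by the same formula with $I_{(r,k)}$; here $E_{a,b}\in\mathcal G$ (not $\mathfrak g$) acts on the $i$-th tensor factor. The (super) KZ equations for a (complex) differentiable function $\psi$ on $U$ with values in a fixed weight space of the tensor product are $\kappa\,\partial\psi/\partial z_i=\bar H^i\psi$ (resp. $H^i\psi$), $i=1,\dots,\ell$. A solution is singular if $E_{a,b}\psi=0$ for all $a<b$ in the given order. ''Weight $\bar\mu$ (resp. $\mu$)'' refers to the weight space of that weight for the $\bar{\mathfrak g}_{(p,n)}$- (resp. $\mathfrak g_{(r,k)}$-) action, equivalently the weight obtained from it via $\iota$ for $\bar{\mathcal G}_{(p,n)}\oplus\mathbb CK$ (resp. $\mathcal G_{(r,k)}\oplus\mathbb CK$). *)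

(* Defs.v *)
From HB Require Import structures.
From mathcomp Require Import all_boot all_order all_algebra.
From mathcomp Require Import all_classical all_reals all_analysis.
From mathcomp Require Import generic_quotient complex.

Set Implicit Arguments.
Unset Strict Implicit.
Unset Printing Implicit Defensive.

Import Order.TTheory GRing.Theory Num.Theory.
Import numFieldNormedType.Exports.

Local Open Scope classical_set_scope.
Local Open Scope quotient_scope.
Local Open Scope ring_scope.

Section Submodules.
Variables (F : fieldType) (V : lmodType F).

Record submod := Submod {
  sm_set :> V -> Prop;
  sm_zero : sm_set 0;
  sm_lin : forall (a : F) u v, sm_set u -> sm_set v -> sm_set (a *: u + v) }.

Variable W : submod.

Definition sm_pred : {pred V} := [pred v | `[< W v >]].

Lemma sm_predP v : reflect (W v) (v \in sm_pred).
Proof. exact: asboolP. Qed.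

Lemma sm_closed : submod_closed sm_pred.
Proof.
split; first by apply/sm_predP; exact: sm_zero.
move=> a u v /sm_predP Wu /sm_predP Wv; apply/sm_predP; exact: sm_lin.
Qed.

HB.instance Definition _ := GRing.isSubmodClosed.Build F V sm_pred sm_closed.

Definition sub_of := {v : V | v \in sm_pred}.
HB.instance Definition _ := SubChoice.on sub_of.
HB.instance Definition _ := [SubChoice_isSubLmodule of sub_of by <:].

Definition stable (f : V -> V) := forall v, W v -> W (f v).

Lemma sub_ofP (v : sub_of) : W (val v).
Proof. exact/sm_predP/(valP v). Qed.

Section Restr.
Variables (f : {linear V -> V}) (fW : stable f).

Lemma restr_subproof (v : sub_of) : f (val v) \in sm_pred.
Proof. apply/sm_predP/fW; exact: sub_ofP. Qed.

Definition restr_fun (v : sub_of) : sub_of := Sub (f (val v)) (restr_subproof v).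

Lemma restr_fun_linear : linear restr_fun.
Proof. by move=> a u v; apply: val_inj; rewrite /= !linearP. Qed.

HB.instance Definition _ :=
  GRing.isLinear.Build F sub_of sub_of *:%R restr_fun restr_fun_linear.

End Restr.

(* The restriction of [f] to [W]; only used when [W] is [f]-stable. *)
Definition restr (f : {linear V -> V}) : {linear sub_of -> sub_of} :=
  match pselect (stable f) with
  | left fW => restr_fun fW
  | right _ => \0
  end.

Lemma val_restr (f : {linear V -> V}) (v : sub_of) :
  stable f -> val (restr f v) = f (val v).
Proof. by rewrite /restr; case: pselect. Qed.

End Submodules.

Section Tensor.
Variables (F : fieldType) (l : nat) (V : 'I_l -> lmodType F).

Local Notation tuples := (forall i, V i).

Definition multilinear (W : lmodType F) (f : tuples -> W) :=
  forall (v : tuples) (i : 'I_l) (a : F) (x y : V i),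
    f (dfwith v i (a *: x + y)) = a *: f (dfwith v i x) + f (dfwith v i y).

Definition presum := seq (F * tuples).
HB.instance Definition _ := gen_eqMixin presum.
HB.instance Definition _ := gen_choiceMixin presum.

Definition psum (W : lmodType F) (f : tuples -> W) (s : presum) : W :=
  \sum_(p <- s) p.1 *: f p.2.

(* Two formal sums of pure tensors are identified when every multilinear map
   takes the same value on them; this is exactly the quotient of the free space
   on the tuples by the multilinearity relations, see [tens_universal]. *)
Definition teq (s t : presum) : bool :=
  `[< forall (W : lmodType F) (f : tuples -> W),
        multilinear f -> psum f s = psum f t >].

Lemma teqP s t : reflect (forall (W : lmodType F) (f : tuples -> W),
  multilinear f -> psum f s = psum f t) (teq s t).
Proof. exact: asboolP. Qed.

Lemma teq_refl : reflexive teq. Proof. by move=> s; apply/teqP. Qed.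
Lemma teq_sym : symmetric teq.
Proof. by move=> s t; apply/teqP/teqP => h W f mf; rewrite h. Qed.
Lemma teq_trans : transitive teq.
Proof.
by move=> t s u /teqP h1 /teqP h2; apply/teqP => W f mf; rewrite h1 // h2.
Qed.

Canonical teq_equiv := EquivRel teq teq_refl teq_sym teq_trans.

Definition tens := {eq_quot teq}.
HB.instance Definition _ := Choice.on tens.



Definition tcls (s : presum) : tens := \pi_tens s.

Lemma tclsP s t : (tcls s = tcls t) <->
  (forall (W : lmodType F) (f : tuples -> W),
     multilinear f -> psum f s = psum f t).
Proof.
split; first by move=> /eqquotP/teqP.
by move=> h; apply/eqquotP/teqP.
Qed.

Lemma tcls_repr (x : tens) : tcls (repr x) = x. Proof. exact: reprK. Qed.

Lemma psum_repr (W : lmodType F) (f : tuples -> W) s :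
  multilinear f -> psum f (repr (tcls s)) = psum f s.
Proof. by move=> mf; move/tclsP: (tcls_repr (tcls s)) => ->. Qed.

Lemma psum_cat (W : lmodType F) (f : tuples -> W) s t :
  psum f (s ++ t) = psum f s + psum f t.
Proof. by rewrite /psum big_cat. Qed.

Definition pscale (a : F) (s : presum) : presum := [seq (a * p.1, p.2) | p <- s].

Lemma psum_scale (W : lmodType F) (f : tuples -> W) a s :
  psum f (pscale a s) = a *: psum f s.
Proof.
rewrite /psum big_map scaler_sumr; apply: eq_bigr => p _ /=.
by rewrite scalerA.
Qed.

Definition tadd (x y : tens) : tens := tcls (repr x ++ repr y).
Definition tscale (a : F) (x : tens) : tens := tcls (pscale a (repr x)).
Definition topp (x : tens) : tens := tscale (-1) x.

Lemma taddE s t : tadd (tcls s) (tcls t) = tcls (s ++ t).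
Proof. by apply/tclsP => W f mf; rewrite !psum_cat !psum_repr. Qed.

Lemma tscaleE a s : tscale a (tcls s) = tcls (pscale a s).
Proof. by apply/tclsP => W f mf; rewrite !psum_scale !psum_repr. Qed.

Lemma tens_ind (P : tens -> Prop) : (forall s, P (tcls s)) -> forall x, P x.
Proof. by move=> h x; rewrite -(tcls_repr x). Qed.

Lemma taddA : associative tadd.
Proof.
elim/tens_ind=> x; elim/tens_ind=> y; elim/tens_ind=> z.
by rewrite !taddE catA.
Qed.
Lemma taddC : commutative tadd.
Proof.
elim/tens_ind=> x; elim/tens_ind=> y; rewrite !taddE.
by apply/tclsP => W f mf; rewrite !psum_cat addrC.
Qed.
Lemma tadd0 : left_id (tcls [::]) tadd.
Proof. by elim/tens_ind=> x; rewrite taddE. Qed.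
Lemma taddN : left_inverse (tcls [::]) topp tadd.
Proof.
elim/tens_ind=> x; rewrite /topp tscaleE taddE; apply/tclsP => W f mf.
by rewrite psum_cat psum_scale scaleN1r addNr /psum big_nil.
Qed.

HB.instance Definition _ := GRing.isZmodule.Build tens taddA taddC tadd0 taddN.

Lemma tscaleA a b x : tscale a (tscale b x) = tscale (a * b) x.
Proof.
elim/tens_ind: x => s; rewrite !tscaleE; apply/tclsP => W f mf.
by rewrite !psum_scale scalerA.
Qed.
Lemma tscale1 : left_id 1 tscale.
Proof.
elim/tens_ind=> s; rewrite !tscaleE; apply/tclsP => W f mf.
by rewrite !psum_scale scale1r.
Qed.
Lemma tscaleDr : right_distributive tscale +%R.
Proof.
move=> a; elim/tens_ind=> x; elim/tens_ind=> y.
have -> : tcls x + tcls y = tcls (x ++ y) by exact: taddE.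
rewrite !tscaleE; have -> : tcls (pscale a x) + tcls (pscale a y) =
  tcls (pscale a x ++ pscale a y) by exact: taddE.
by apply/tclsP => W f mf; rewrite !(psum_cat, psum_scale) scalerDr.
Qed.
Lemma tscaleDl x : {morph tscale^~ x : a b / a + b}.
Proof.
elim/tens_ind: x => s a b; rewrite !tscaleE.
have -> : tcls (pscale a s) + tcls (pscale b s) =
  tcls (pscale a s ++ pscale b s) by exact: taddE.
by apply/tclsP => W f mf; rewrite !(psum_cat, psum_scale) scalerDl.
Qed.

HB.instance Definition _ :=
  GRing.Zmodule_isLmodule.Build F tens tscaleA tscale1 tscaleDr tscaleDl.

Definition pure (v : tuples) : tens := tcls [:: (1, v)].

Section Lift.
Variables (W : lmodType F) (f : tuples -> W) (mf : multilinear f).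

Definition tlift_fun of multilinear f := fun x : tens => psum f (repr x).

Lemma tlift_linear : linear (tlift_fun mf).
Proof.
move=> a; elim/tens_ind=> x; elim/tens_ind=> y.
have -> : a *: tcls x + tcls y = tcls (pscale a x ++ y).
  by rewrite -taddE -tscaleE.
by rewrite /tlift_fun !psum_repr // psum_cat psum_scale.
Qed.

HB.instance Definition _ :=
  GRing.isLinear.Build F tens W *:%R (tlift_fun mf) tlift_linear.

Definition tlift : {linear tens -> W} := tlift_fun mf.

Lemma tlift_pure v : tlift (pure v) = f v.
Proof.
by rewrite /tlift /= /tlift_fun psum_repr // /psum big_seq1 scale1r.
Qed.

End Lift.

Lemma pure_multilinear : multilinear pure.
Proof.
move=> v i a x y.
have -> : a *: pure (dfwith v i x) + pure (dfwith v i y) =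
  tcls (pscale a [:: (1, dfwith v i x)] ++ [:: (1, dfwith v i y)]).
  by rewrite -taddE -tscaleE.
apply/tclsP => W f mf; rewrite psum_cat psum_scale /psum !big_seq1 /=.
by rewrite !scale1r mf.
Qed.

Lemma tens_span (x : tens) :
  exists s : seq (F * tuples), x = \sum_(p <- s) p.1 *: pure p.2.
Proof.
elim/tens_ind: x => s; exists s; elim: s => [|[a v] s ih]; first by rewrite big_nil.
rewrite big_cons -ih /=.
have -> : a *: pure v + tcls s = tcls (pscale a [:: (1, v)] ++ s).
  by rewrite -taddE -tscaleE.
apply/tclsP => W f mf; rewrite psum_cat psum_scale /psum big_cons big_seq1 /=.
by rewrite scale1r.
Qed.

Lemma tens_universal (W : lmodType F) (f : tuples -> W) : multilinear f ->
  exists! g : tens -> W, linear g /\ forall v, g (pure v) = f v.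
Proof.
move=> mf; exists (tlift mf); split.
  by split; [exact: linearP | exact: tlift_pure].
move=> g [lg gE]; apply/funext => x.
pose G : {linear tens -> W} :=
  HB.pack g (GRing.isLinear.Build F tens W *:%R g lg).
have [s ->] := tens_span x.
rewrite linear_sum -[RHS]/(G _) linear_sum; apply: eq_bigr => p _.
by rewrite !linearZ tlift_pure /= gE.
Qed.

Section TMap.
Variable f : forall i, {linear V i -> V i}.

Lemma tmap_multilinear : multilinear (fun v => pure (fun i => f i (v i))).
Proof.
move=> v i a x y.
have E (z : V i) : (fun j => f j (dfwith v i z j)) =
    dfwith (fun j => f j (v j)) i (f i z).
  apply: functional_extensionality_dep => j.
  have [<-|nij] := eqVneq i j; first by rewrite !dfwithin.
  by rewrite !dfwithout.
by rewrite !E linearP pure_multilinear.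
Qed.

Definition tmap : {linear tens -> tens} := tlift tmap_multilinear.

Lemma tmap_pure v : tmap (pure v) = pure (fun i => f i (v i)).
Proof. exact: tlift_pure. Qed.

End TMap.
End Tensor.

(* An index [i] of [1/2 Z] is encoded by the integer [2 i]: [a : int] stands for
   [a / 2], so that elements of [Z] become even integers and elements of
   [1/2 + Z] odd ones. *)
Definition par (a : int) : bool := odd `|a|%N.

Definition setIt : set int := [set a | a != 0].

(* [p, n = None] stand for infinity. *)
Definition setI_ (p n : option nat) : set int := [set a |
  [/\ par a,
      if p is Some p' then - (p'.*2)%:Z < a else true
    & if n is Some n' then a < (n'.*2)%:Z else true]].

Definition setIbar (q m : nat) (p n : option nat) : set int := [set a |
  if par a then
    - (q.*2)%:Z < a /\ (if n is Some n' then a < (n'.*2)%:Z else true)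
  else
    [/\ a != 0, a <= (m.*2)%:Z
      & if p is Some p' then - (p'.*2)%:Z <= a else true]].

Definition lt_std : rel int := fun a b => a < b.

(* negative integers, negative half-odd integers, positive integers, positive
   half-odd integers *)
Definition block (a : int) : nat := ((0 < a)%R.*2 + par a)%N.
Definition lt_bar : rel int := fun a b =>
  (block a < block b)%N || ((block a == block b) && (a < b)).

Lemma setI_sub_It p n : setI_ p n `<=` setIt.
Proof. by move=> a [pa _ _]; apply/eqP => a0; move: pa; rewrite a0. Qed.

Lemma setIbar_sub_It q m p n : setIbar q m p n `<=` setIt.
Proof.
move=> a; rewrite /setIbar /setIt /=; case: ifP => [pa _|_ []//].
by apply/eqP => a0; move: pa; rewrite a0.
Qed.

Lemma setI_sub p n : setI_ p n `<=` setI_ None None.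
Proof. by move=> a [pa _ _]. Qed.

Lemma setIbar_sub q m p n : setIbar q m p n `<=` setIbar q m None None.
Proof. by move=> a; rewrite /setIbar /=; case: (par a) => -[]. Qed.

Section Algebra.
Variable F : fieldType.

Definition mat : lmodType F := int -> int -> F^o.
(* the pair [(A, c)] stands for [A + c K] *)
Definition ext : lmodType F := (mat * F^o)%type.

(* [\sum_(k \in A) u k] is meaningful when [u] has finite support in [A]; this
   holds below for finitely supported matrices and for products with [Jmat]. *)
Definition mmul (A B : mat) : mat :=
  fun i j => \sum_(k \in [set: int]) (A i k * B k j).

(* The sign is (-1)^(|E_{i,k}| |E_{k,j}|): on homogeneous [A], [B] this is
   [A B - (-1)^(|A| |B|) B A]. *)
Definition sbr (A B : mat) : mat := fun i j => \sum_(k \in [set: int])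
  (A i k * B k j
   - (-1) ^+ ((par i (+) par k) && (par k (+) par j)) * (B i k * A k j)).

Definition Str (A : mat) : F := \sum_(i \in [set: int]) (-1) ^+ par i * A i i.

Definition Jmat : mat := fun i j => - ((i == j) && (i < 0))%:R.

Definition Emx (a b : int) : mat := fun i j => ((i == a) && (j == b))%:R.

Definition extbr (x y : ext) : ext :=
  (sbr x.1 y.1, Str (mmul (sbr Jmat x.1) y.1)).

Definition Eext (a b : int) : ext := (Emx a b, 0).
Definition Kext : ext := (0, 1).

Definition iota_ext (A : mat) : ext := (A, Str (mmul Jmat A)).

(* All the algebras of the text are subalgebras of one ambient space: this one
   is spanned by [K] and the [E_{a,b}], [a, b] in [S]. *)
Definition gS (S : set int) : set ext := [set x |
  finite_set [set ij : int * int | x.1 ij.1 ij.2 != 0] /\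
  forall i j, x.1 i j != 0 -> S i /\ S j].

Definition levi (S : set int) : set ext := [set x |
  gS S x /\ forall i j, x.1 i j != 0 -> (0 < i) = (0 < j)].

Definition homog (b : bool) : set ext := [set x |
  (forall i j, x.1 i j != 0 -> par i (+) par j = b) /\ (b -> x.2 = 0)].

(* A Z_2-graded module over [gS S]. The grading is given by the involution [sgn]
   equal to 1 on the even and to -1 on the odd part; the values of [rho] outside
   of [gS S] are irrelevant. *)
Record gmod (S : set int) := GMod {
  gcar :> lmodType F;
  rho : ext -> {linear gcar -> gcar};
  sgn : {linear gcar -> gcar};
  rho_lin : forall (a : F) x y v, gS S x -> gS S y ->
    rho (a *: x + y) v = a *: rho x v + rho y v;
  rho_br : forall (bx by_ : bool) x y v, gS S x -> gS S y ->
    homog bx x -> homog by_ y ->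
    rho (extbr x y) v
    = rho x (rho y v) - (-1) ^+ (bx && by_) *: rho y (rho x v);
  sgnK : forall v, sgn (sgn v) = v;
  sgn_rho : forall (b : bool) x v, gS S x -> homog b x ->
    sgn (rho x v) = (-1) ^+ b *: rho x (sgn v) }.

(* [g.1] is the coefficient of [Lambda_0], [g.2 a] that of [epsilon_(a/2)]. *)
Definition weight : lmodType F := (F^o * (int -> F^o))%type.
Definition eps (a : int) : weight := (0, fun b => (b == a)%:R).

Definition is_weight (S : set int) : set weight := [set g |
  finite_set [set a | g.2 a != 0] /\ forall a, g.2 a != 0 -> S a].

Section Modules.
Variables (S : set int) (M : gmod S).

Definition wt_space (g : weight) : set M := [set v |
  rho M Kext v = g.1 *: v /\
  forall a, S a -> rho M (Eext a a) v = g.2 a *: v].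

Section Basics.
Lemma gS0 : gS S 0.
Proof.
split; last by move=> i j /=; rewrite eqxx.
rewrite (_ : [set _ | _] = set0) //.
by rewrite -subset0 => ij /=; rewrite eqxx.
Qed.

Lemma gSK : gS S Kext.
Proof.
split; last by move=> i j /=; rewrite eqxx.
rewrite (_ : [set _ | _] = set0) //.
by rewrite -subset0 => ij /=; rewrite eqxx.
Qed.

Lemma Emx_neq0 a b i j : Emx a b i j != 0 -> i = a /\ j = b.
Proof.
by rewrite /Emx; case: (i =P a) => [->|_]; case: (j =P b) => [->|_] //=; rewrite eqxx.
Qed.

Lemma gSE a b : S a -> S b -> gS S (Eext a b).
Proof.
move=> Sa Sb; split; last by move=> i j /Emx_neq0[-> ->].
apply: (@sub_finite_set _ _ [set (a, b)]); last exact: finite_set1.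
by move=> [i j] /= /Emx_neq0[-> ->].
Qed.

Lemma homogE a b : homog (par a (+) par b) (Eext a b).
Proof. by split => // i j /Emx_neq0[-> ->]. Qed.

Lemma homogK : homog false Kext.
Proof. by split => // i j /=; rewrite eqxx. Qed.

Lemma rho0 v : rho M 0 v = 0.
Proof.
have := rho_lin (-1) v gS0 gS0; rewrite scaler0 addr0 => ->.
by rewrite scaleN1r addNr.
Qed.

Lemma rhoZ a x v : gS S x -> rho M (a *: x) v = a *: rho M x v.
Proof. by move=> Sx; rewrite -[a *: x]addr0 rho_lin // ?rho0 ?addr0 //; exact: gS0. Qed.

Lemma fsum1 (u : int -> F^o) k : (forall i, i != k -> u i = 0) ->
  \sum_(i \in [set: int]) u i = u k.
Proof.
move=> h; rewrite -(fsbig_widen [set k] setT) ?fsbig_set1 //.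
by move=> i [_ /eqP ik]; exact: h.
Qed.

Lemma fsum0 (u : int -> F^o) : (forall i, u i = 0) ->
  \sum_(i \in [set: int]) u i = 0.
Proof. by move=> h; rewrite fsbig1. Qed.

Lemma mmul0 B : mmul 0 B = 0.
Proof. by apply/funext => i; apply/funext => j; apply: fsum0 => k; rewrite mul0r. Qed.

Lemma Str0 : Str 0 = 0.
Proof. by apply: fsum0 => i; rewrite mulr0. Qed.

Lemma extbr_diagE h a b :
  extbr (Eext h h) (Eext a b) = ((h == a)%:R - (h == b)%:R : F) *: Eext a b.
Proof.
rewrite /extbr /= (_ : sbr Jmat (Emx h h) = 0) ?mmul0 ?Str0; last first.
  apply/funext => i; apply/funext => j; apply: fsum0 => k; rewrite /Jmat /Emx.
  case: (eqVneq k h) => [->|kh] /=; last by rewrite andbF mul0r !mulr0 subrr.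
  case: (eqVneq j h) => [->|jh] /=.
    rewrite addbb andbF expr0 mul1r andbT mulr1 /=.
    by case: (eqVneq i h) => [->|_] /=; rewrite ?mul1r ?subrr // oppr0 mul0r subrr.
  by rewrite oppr0 !mulr0 subrr.
apply/pair_equal_spec; split; last by rewrite /= scaler0.
apply/funext => i; apply/funext => j.
rewrite /sbr (@fsum1 _ h); last first.
  by move=> k kh; rewrite /Emx (negPf kh) /= !andbF !mul0r !mulr0 subrr.
rewrite -[RHS]/(_ * _) /= /Emx eqxx /= andbT.
case: (eqVneq j h) => [->|jh] /=.
  rewrite addbb andbF /= expr0 mul1r mulr1.
  case: (eqVneq h b) => [_|]; last by rewrite !andbF !mulr0 subrr.
  by rewrite !andbT; case: (eqVneq h a) => [->|]; rewrite ?mulr1 ?subrr ?mul0r ?mulr0 ?sub0r ?mulN1r.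
rewrite !mulr0 subr0; case: (eqVneq j b) jh => [->|]; last by rewrite !andbF !mulr0.
by rewrite eq_sym => /negPf ->; rewrite subr0 !andbT; case: (eqVneq h a) => [->|]; rewrite ?mulr1 ?mul1r ?mul0r ?mulr0.
Qed.

Lemma extbrK x : extbr Kext x = 0.
Proof.
apply/pair_equal_spec; split.
  apply/funext => i; apply/funext => j; apply: fsum0 => k.
  by rewrite /= mul0r !mulr0 subrr.
rewrite /= (_ : sbr Jmat 0 = 0) ?mmul0 ?Str0 //.
apply/funext => i; apply/funext => j; apply: fsum0 => k.
by rewrite /= mulr0 !mul0r mulr0 subrr.
Qed.

Lemma rhoKC b x v : gS S x -> homog b x ->
  rho M Kext (rho M x v) = rho M x (rho M Kext v).
Proof.
move=> Sx hx; have := rho_br v gSK Sx homogK hx.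
by rewrite extbrK rho0 expr0 scale1r => /esym/eqP; rewrite subr_eq0 => /eqP.
Qed.

Lemma wt_space_E g a b v : S a -> S b -> wt_space g v ->
  wt_space (g + eps a - eps b) (rho M (Eext a b) v).
Proof.
move=> Sa Sb [Kv Ev]; split.
  rewrite (rhoKC _ (gSE Sa Sb) (homogE a b)) Kv linearZ /=.
  by rewrite addr0 oppr0 addr0.
move=> h Sh; have := rho_br v (gSE Sh Sh) (gSE Sa Sb) (homogE h h) (homogE a b).
rewrite addbb expr0 scale1r extbr_diagE rhoZ; last exact: gSE.
rewrite Ev // linearZ /= => /eqP; rewrite eq_sym subr_eq => /eqP ->.
by rewrite -scalerDl addrC addrA.
Qed.

Lemma wt_space_K g v : wt_space g v -> wt_space g (rho M Kext v).
Proof.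
move=> [Kv Ev]; rewrite Kv; split; first by rewrite linearZ /= Kv.
by move=> a Sa; rewrite linearZ /= Ev // !scalerA mulrC.
Qed.

Lemma wt_space_sgn g v : wt_space g v -> wt_space g (sgn M v).
Proof.
move=> [Kv Ev]; split.
  have := sgn_rho v gSK homogK; rewrite Kv linearZ /= expr0 scale1r => <- //.
move=> a Sa; have := sgn_rho v (gSE Sa Sa) (homogE a a).
by rewrite addbb expr0 scale1r Ev // linearZ /= => <-.
Qed.

Lemma weight_shiftE (g : weight) a b c : c != a -> c != b ->
  (g + eps a - eps b).2 c = g.2 c.
Proof.
move=> /negPf ca /negPf cb.
rewrite -[LHS]/(g.2 c + (c == a)%:R - (c == b)%:R) ca cb.
by rewrite addr0 subr0.
Qed.

Lemma is_weight_shift S' g a b : S' a -> S' b -> is_weight S' g ->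
  is_weight S' (g + eps a - eps b).
Proof.
move=> Sa Sb [gf gS']; split.
  apply: (@sub_finite_set _ _ ([set c | g.2 c != 0] `|` ([set a] `|` [set b]))).
    move=> c /= h; case: (c =P a) => [->|/eqP ca]; first by right; left.
    case: (c =P b) => [->|/eqP cb]; first by right; right.
    by left; rewrite /= -(weight_shiftE g ca cb).
  by rewrite finite_setU; split => //; rewrite finite_setU; split; exact: finite_set1.
move=> c /= h; case: (c =P a) => [->//|/eqP ca]; case: (c =P b) => [->//|/eqP cb].
by apply: gS'; rewrite -(weight_shiftE g ca cb).
Qed.

End Basics.

Section Truncation.
Variables (S' : set int) (S'S : S' `<=` S).

Definition trunc_set : set M := [set v | exists s : seq M,
  v = \sum_(w <- s) w /\
  forall w, w \in s -> exists2 g, is_weight S' g & wt_space g w].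

Lemma trunc_set0 : trunc_set 0.
Proof. by exists [::]; rewrite big_nil. Qed.

Lemma trunc_set_lin (a : F) u v :
  trunc_set u -> trunc_set v -> trunc_set (a *: u + v).
Proof.
move=> [s [-> hs]] [t [-> ht]]; exists ([seq a *: w | w <- s] ++ t); split.
  by rewrite big_cat big_map scaler_sumr.
move=> w; rewrite mem_cat => /orP[/mapP[w' ws ->]|]; last exact: ht.
have [g Sg [Kw Ew]] := hs _ ws; exists g => //; split.
  by rewrite linearZ /= Kw !scalerA mulrC.
by move=> b Sb; rewrite linearZ /= Ew // !scalerA mulrC.
Qed.

Definition trunc_sub : submod M := Submod trunc_set0 trunc_set_lin.

Lemma trunc_stable_gen (f : {linear M -> M}) :
  (forall g w, is_weight S' g -> wt_space g w ->
     exists2 g', is_weight S' g' & wt_space g' (f w)) ->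
  stable trunc_sub f.
Proof.
move=> h v [s [-> hs]]; exists (map f s); split.
  by rewrite big_map linear_sum.
by move=> w /mapP[w' ws ->]; have [g Sg wg] := hs _ ws; exact: h Sg wg.
Qed.

Lemma gS_sub x : gS S' x -> gS S x.
Proof. by move=> [fx sx]; split => // i j /sx[/S'S Si /S'S Sj]. Qed.

Lemma trunc_stable x : gS S' x -> stable trunc_sub (rho M x).
Proof.
case=> /finite_seqP[s sE] Sx.
have {sE} : [set ij : int * int | x.1 ij.1 ij.2 != 0] `<=` [set` s] by rewrite sE.
have finS (y : ext) (t : seq (int * int)) : [set ij : int * int | y.1 ij.1 ij.2 != 0] `<=` [set` t] ->
    (forall i j, y.1 i j != 0 -> S' i /\ S' j) -> gS S y.
  move=> yt yS; split; first by apply: sub_finite_set yt _; apply/finite_seqP; exists t.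
  by move=> i j /yS[/S'S Si /S'S Sj].
elim: s x Sx => [|[i j] s ih] x Sx sE.
  have -> : x = x.2 *: Kext.
    case: x sE {Sx} => A c sE; apply/pair_equal_spec; split; last exact/esym/mulr1.
    apply/funext => i; apply/funext => j; rewrite /= scaler0.
    by apply/eqP/negPn/negP => Aij; have := sE (i, j) Aij.
  move=> v tv; rewrite rhoZ; last exact: gSK.
  rewrite -[_ *: _]addr0; apply: trunc_set_lin; last exact: trunc_set0.
  by apply: trunc_stable_gen tv => g w Sg wg; exists g => //; exact: wt_space_K.
have [xij0|xij0] := eqVneq (x.1 i j) 0.
  apply: ih => // -[a b] /= xab; have /= := sE (a, b) xab.
  rewrite in_cons => /orP[/eqP[ea eb]|//].
  by move: xab; rewrite ea eb xij0 eqxx.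
have [Si Sj] := Sx _ _ xij0.
have [y xy yE] : exists2 y : ext, x = x.1 i j *: Eext i j + y &
    forall a b, y.1 a b = x.1 a b - x.1 i j * Emx i j a b.
  by exists (x - x.1 i j *: Eext i j); rewrite // addrC subrK.
have ys : [set ij : int * int | y.1 ij.1 ij.2 != 0] `<=` [set` s].
  move=> [a b] /=; rewrite yE /Emx.
  have [[-> ->]|/eqP] := eqVneq (a, b) (i, j).
    by rewrite !eqxx mulr1 subrr eqxx.
  have [->|ai] := eqVneq a i; have [->|bj] := eqVneq b j => //= ne;
    rewrite ?mulr0 ?subr0 => /[dup] xab /(sE (_, _)) /=;
    rewrite in_cons xpair_eqE ?eqxx ?(negPf ai) ?(negPf bj) ?andbF //=.
have yS a b : y.1 a b != 0 -> S' a /\ S' b.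
  rewrite yE; have [->|/eqP xab _] := eqVneq (x.1 a b) 0; last exact/Sx/eqP.
  rewrite sub0r oppr_eq0 mulf_eq0 negb_or => /andP[_ /Emx_neq0[-> ->]] //.
move=> v tv; rewrite xy rho_lin; [|exact: gSE (S'S Si) (S'S Sj)|exact: finS ys yS].
apply: trunc_set_lin; last exact: (ih y).
apply: trunc_stable_gen tv => g w Sg wg; exists (g + eps i - eps j).
  exact: is_weight_shift.
by apply: wt_space_E => //; exact: S'S.
Qed.

Lemma trunc_stable_sgn : stable trunc_sub (sgn M).
Proof.
by apply: trunc_stable_gen => g w Sg wg; exists g => //; exact: wt_space_sgn.
Qed.

Definition trunc_rho (x : ext) : {linear sub_of trunc_sub -> sub_of trunc_sub} :=
  restr trunc_sub (rho M x).
Definition trunc_sgn : {linear sub_of trunc_sub -> sub_of trunc_sub} :=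
  restr trunc_sub (sgn M).

Lemma trunc_rho_lin (a : F) x y v : gS S' x -> gS S' y ->
  trunc_rho (a *: x + y) v = a *: trunc_rho x v + trunc_rho y v.
Proof.
move=> Sx Sy; apply: val_inj.
have stx := trunc_stable Sx; have sty := trunc_stable Sy.
have E w : rho M (a *: x + y) w = a *: rho M x w + rho M y w.
  by rewrite rho_lin //; exact: gS_sub.
have st : stable trunc_sub (rho M (a *: x + y)).
  by move=> w Ww; rewrite E; apply: sm_lin; [exact: stx|exact: sty].
by rewrite linearP /= /trunc_rho !(val_restr _ st, val_restr _ stx, val_restr _ sty) E.
Qed.

Lemma trunc_rho_br (bx by_ : bool) x y v : gS S' x -> gS S' y ->
  homog bx x -> homog by_ y ->
  trunc_rho (extbr x y) v = trunc_rho x (trunc_rho y v)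
    - (-1) ^+ (bx && by_) *: trunc_rho y (trunc_rho x v).
Proof.
move=> Sx Sy hx hy; apply: val_inj.
have stx := trunc_stable Sx; have sty := trunc_stable Sy.
have E w : rho M (extbr x y) w = rho M x (rho M y w)
    - (-1) ^+ (bx && by_) *: rho M y (rho M x w).
  by rewrite (@rho_br _ _ bx by_) //; exact: gS_sub.
have st : stable trunc_sub (rho M (extbr x y)).
  move=> w Ww; rewrite E addrC -scaleNr.
  by apply: sm_lin; [exact/sty/stx|exact/stx/sty].
rewrite linearB linearZ /= /trunc_rho.
by rewrite !(val_restr _ st, val_restr _ stx, val_restr _ sty) E scalerN.
Qed.

Lemma trunc_sgnK v : trunc_sgn (trunc_sgn v) = v.
Proof.
by apply: val_inj; rewrite !(val_restr _ trunc_stable_sgn) sgnK.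
Qed.

Lemma trunc_sgn_rho (b : bool) x v : gS S' x -> homog b x ->
  trunc_sgn (trunc_rho x v) = (-1) ^+ b *: trunc_rho x (trunc_sgn v).
Proof.
move=> Sx hx; apply: val_inj; have stx := trunc_stable Sx.
rewrite linearZ /= /trunc_rho /trunc_sgn.
rewrite !(val_restr _ trunc_stable_sgn, val_restr _ stx).
by rewrite (@sgn_rho _ _ b) //; exact: gS_sub.
Qed.

Definition trunc : gmod S' :=
  GMod trunc_rho_lin trunc_rho_br trunc_sgnK trunc_sgn_rho.

End Truncation.

(* [lt] is the order on the indices defining the Borel subalgebra. *)
Section Category.
Variables (lt : rel int) (P : set weight).

Definition finite_span (A : set M) := exists s : seq M, forall v, A v ->
  exists c : 'I_(size s) -> F, v = \sum_(i < size s) c i *: s`_i.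

Definition weight_module :=
  (forall v : M, exists s : seq M, v = \sum_(w <- s) w /\
    forall w, w \in s -> exists2 g, is_weight S g & wt_space g w) /\
  (forall g, is_weight S g -> finite_span (wt_space g)).

Definition levi_stable (W : submod M) :=
  forall x, levi S x -> stable W (rho M x).

Definition levi_irreducible (W : submod M) := [/\ levi_stable W,
  exists2 v, W v & v != 0 &
  forall U : submod M, levi_stable U -> U `<=` W ->
    (forall v, U v -> v = 0) \/ W `<=` U].

Definition levi_highest_weight (W : submod M) (g : weight) :=
  exists v, [/\ W v /\ v != 0, wt_space g v,
    forall a b, S a -> S b -> (0 < a) = (0 < b) -> lt a b ->
      rho M (Eext a b) v = 0 &
    forall U : submod M, levi_stable U -> U v -> W `<=` U].

Definition direct_sum (J : choiceType) (W : J -> submod M) :=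
  (forall v : M, exists (s : seq J) (w : J -> M),
     (forall j, W j (w j)) /\ v = \sum_(j <- s) w j) /\
  (forall (s : seq J) (w : J -> M), uniq s -> (forall j, W j (w j)) ->
     \sum_(j <- s) w j = 0 -> forall j, j \in s -> w j = 0).

Definition simple_root : set weight := [set r | exists a b,
  [/\ [/\ S a, S b & lt a b], forall c, S c -> ~ (lt a c /\ lt c b)
    & r = eps a - eps b]].

Definition graded_by_weight := forall g v (N : int),
  is_weight S g -> wt_space g v ->
  \sum_(a \in [set a | par a]) g.2 a = N%:~R -> sgn M v = (-1) ^+ par N *: v.

Definition inO := [/\ weight_module, graded_by_weight,
  (exists (J : choiceType) (W : J -> submod M), direct_sum W /\
     forall j, levi_irreducible (W j) /\
       (exists2 g, P g & levi_highest_weight (W j) g)) &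
  (exists L : seq weight, (forall g, g \in L -> P g) /\
     forall g, is_weight S g -> (exists2 v, wt_space g v & v != 0) ->
       exists2 g', g' \in L & exists s : seq weight,
         (forall r, r \in s -> simple_root r) /\ g' - g = \sum_(r <- s) r)].

End Category.
End Modules.
End Algebra.

Record intpart := IntPart {
  parts :> seq nat;
  _ : sorted geq parts && (0%N \notin parts) }.

(* [nu_i] and [nu'_i], for [1 <= i] *)
Definition part (nu : intpart) (i : nat) : nat := nth 0%N nu i.-1.
Definition conjpart (nu : intpart) (i : nat) : nat := count (leq i) nu.

(* [theta nu (2 r)] is the coefficient [theta(nu)_r] for [r] in [1/2 N]; the
   truncated subtraction accounts for the brackets [< >]. *)
Definition theta (nu : intpart) (a : nat) : nat :=
  let i := uphalf a in
  if odd a then ((conjpart nu i).+1 - i)%N else (part nu i - i)%N.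

Section Weights.
Variable F : fieldType.

Definition mkweight (cp cm : nat -> nat) (d : F) : weight F :=
  (d, fun a => if 0 < a then (cp `|a|%N)%:R
               else if a < 0 then - (cm `|a|%N)%:R else 0).

Definition wtilde (lp lm : intpart) (d : F) : weight F :=
  mkweight (theta lp) (theta lm) d.

Definition wstd (lp lm : intpart) (d : F) : weight F :=
  mkweight (fun a => if odd a then conjpart lp (uphalf a) else 0%N)
           (fun a => if odd a then conjpart lm (uphalf a) else 0%N) d.

Definition wbar (q m : nat) (lp lm : intpart) (d : F) : weight F :=
  mkweight
    (fun a => let i := uphalf a in
       if odd a then (conjpart lp i - m)%N
       else if (i <= m)%N then part lp i else 0%N)
    (fun a => let i := uphalf a in
       if odd a then (if (i <= q)%N then conjpart lm i else 0%N)
       else (part lm i - q)%N) d.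

Definition Ptilde : set (weight F) :=
  [set g | exists lp lm d, g = wtilde lp lm d].

Definition Pbar (q m : nat) (p n : option nat) : set (weight F) :=
  [set g | exists lp lm d, [/\ g = wbar q m lp lm d,
     if n is Some n' then (conjpart lp n'.+1 <= m)%N else true
   & if p is Some p' then (part lm p'.+1 <= q)%N else true]].

Definition inOtilde (M : gmod F setIt) := inO M lt_std Ptilde.

Definition functorT (M : gmod F setIt) : gmod F (setI_ None None) :=
  trunc M (@setI_sub_It None None).
Definition functorTbar (q m : nat) (M : gmod F setIt) :
    gmod F (setIbar q m None None) :=
  trunc M (@setIbar_sub_It q m None None).
Definition tr (r k : nat) (M : gmod F (setI_ None None)) :
    gmod F (setI_ (Some r) (Some k)) :=
  trunc M (@setI_sub (Some r) (Some k)).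
Definition trbar (q m p n : nat) (M : gmod F (setIbar q m None None)) :
    gmod F (setIbar q m (Some p) (Some n)) :=
  trunc M (@setIbar_sub q m (Some p) (Some n)).

End Weights.

Section KZ.
Variable R : realType.
Local Notation C := R[i].
Variable l : nat.

Definition points := 'rV[C^o]_l.

Definition configuration : set points :=
  [set z | forall i j : 'I_l, i != j -> z 0 i != z 0 j].

Definition cexp (w : C) : C :=
  Complex (expR (complex.Re w) * cos (complex.Im w))
          (expR (complex.Re w) * sin (complex.Im w)).

Definition log_branch (U : set points) (L : 'I_l -> 'I_l -> points -> C^o) :=
  forall i j : 'I_l, (i < j)%N -> forall z, U z ->
    {for z, continuous (L i j)} /\ cexp (L i j z) = z 0 i - z 0 j.

Section Operators.
Variables (S : set int) (M : 'I_l -> gmod C S).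

Definition tensM : lmodType C := tens (fun i => gcar (M i)).

(* [x^{(i)}] for [x] of parity [b]: it passes the first [i - 1] factors, whence
   the sign involutions. *)
Definition tact (i : 'I_l) (b : bool) (x : ext C) : {linear tensM -> tensM} :=
  tmap (fun j : 'I_l =>
    if (j < i)%N then (if b then sgn (M j) else idfun)
    else if j == i then rho (M j) x else idfun).

Definition tacts (b : bool) (x : ext C) (t : tensM) : tensM :=
  \sum_(i < l) tact i b x t.

Definition tens_wt_space (g : weight C) : set tensM := [set t |
  tacts false (Kext C) t = g.1 *: t /\
  forall a, S a -> tacts false (Eext C a a) t = g.2 a *: t].

(* The action of [E_{a,b}] as an element of the matrix Lie superalgebra, through
   [iota_ext]. *)
Definition Eop (i : 'I_l) (a b : int) (t : tensM) : tensM :=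
  tact i (par a (+) par b) (iota_ext (Emx C a b)) t.

Definition Eops (a b : int) (t : tensM) : tensM := \sum_(i < l) Eop i a b t.

(* The sums over [a] and [b] are finite when [S] is. *)
Definition hamiltonian (i : 'I_l) (z : points) (t : tensM) : tensM :=
  \sum_(j < l | j != i) (z 0 i - z 0 j : C)^-1 *:
    (\sum_(a \in S) \sum_(b \in S) (-1) ^+ par b *: Eop i a b (Eop j b a t)).

(* Differentiability and partial derivatives of a function with values in a
   finite-dimensional space, in terms of its coordinates [f] with respect to
   finitely many vectors [e] of the weight space. *)
Definition KZ_solution (U : set points) (kappa : C) (g : weight C)
    (psi : U -> tensM) := exists N (e : 'I_N -> tensM) (f : 'I_N -> points -> C^o),
  [/\ forall k, tens_wt_space g (e k),
      forall k z, U z -> differentiable (f k) z,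
      forall z : U, psi z = \sum_(k < N) (f k (val z) : C) *: e k
    & forall (z : U) (i : 'I_l),
        kappa *: (\sum_(k < N) ('D_(delta_mx 0 i) (f k) (val z) : C) *: e k)
        = hamiltonian i (val z) (psi z)].

Definition singular (U : set points) (lt : rel int) (psi : U -> tensM) :=
  forall (z : U) a b, S a -> S b -> lt a b -> Eops a b (psi z) = 0.

Definition singular_solutions (U : set points) (kappa : C) (lt : rel int)
    (g : weight C) : set (U -> tensM) :=
  [set psi | KZ_solution kappa g psi /\ singular lt psi].

End Operators.

End KZ.

Arguments configuration : clear implicits.

Definition linear_iso (F : fieldType) (V W : lmodType F)
    (A : set V) (B : set W) := exists Phi : V -> W,
  (forall (a : F) u v, A u -> A v -> Phi (a *: u + v) = a *: Phi u + Phi v) /\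
  set_bij A B Phi.

(* Main.v *)
Require Import Defs.
From HB Require Import structures.
From mathcomp Require Import all_boot all_order all_algebra.
From mathcomp Require Import all_classical all_reals all_analysis.
From mathcomp Require Import complex.
From mathcomp Require Import ring lra zify.

Set Implicit Arguments.
Unset Strict Implicit.
Unset Printing Implicit Defensive.

Import Order.TTheory GRing.Theory Num.Theory.
Import numFieldNormedType.Exports.

Local Open Scope classical_set_scope.
Local Open Scope ring_scope.

(* By the structure of highest weight modules over the Levi subalgebra, the weights
   of objects of the big category have nonnegative coefficients at positive indices
   and nonpositive ones at negative indices: an index can be moved to the end of the
   order by reflections, and its coefficient in a singular vector is then extremal.
   Hence in a weight space of the tensor product both truncations only see the
   indices in the support of the weight, and both systems become the KZ system for
   one finite set A of indices of both parities on the same tensor product of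
   untruncated modules, up to a multiple of K_i K_j / (z_i - z_j) which is removed
   by the gauge factor \prod (z_i - z_j)^(c K_i K_j / kappa). The two singularity
   conditions are those of two orders on A, connected by odd reflections of adjacent
   indices x, y of the same sign. Each reflection acts on solutions by E_{y,x}, which
   commutes with the Hamiltonians and is invertible with inverse E_{x,y} up to the
   scalar mu_x + mu_y; when this scalar is 0 both mu_x and mu_y vanish and nothing has
   to be done. The weight transfers carry mu to its barred counterpart. *)

(** * Eigenvector decompositions and functional calculus *)

(** In general neither index set contains the other, while [E_{y,x}] commutes with the Hamiltonians
    only if [x] and [y] are both among the indices summed over. This forces the passage to a common
    [A], and hence to the untruncated modules. Enlarging [A] has a cost: through [iota_ext] a
    negative index outside the support still acts by a multiple of [K]. A module of the category
    need not have a single level, so [K_i] is only diagonalizable and the gauge factor is an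
    operator, built by functional calculus. The branches of the logarithm enter only there. For the
    signs of weights the obstacle is infinite rank: the Levi subalgebra has no last index. It
    suffices to move one index past the supports of the highest weight and of the given weight,
    which takes finitely many reflections. The combinatorics of the transfer is a Young diagram read
    cell by cell: when an integer index and a half-odd index are exchanged, a unit passes to the
    integer exactly if the cell in that row and column belongs to the diagram. An integer that
    passes all half-odd indices beyond [q] thus collects its row minus the first [q] cells ([q = 0]
    on the positive side). *)

Section LinearClosure.
Variables (F : fieldType) (V : lmodType F).

(** The linear span of [P], taken as an intersection of submodules: applying a membership to a
    submodule is then an induction on linear combinations. *)
Definition gen (P : V -> Prop) (v : V) :=
  forall W : submod V, (forall x, P x -> W x) -> W v.

Lemma sm_add (W : submod V) u v : W u -> W v -> W (u + v).
Proof. by move=> Wu Wv; rewrite -[u]scale1r; exact: sm_lin. Qed.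

Lemma sm_scale (W : submod V) a v : W v -> W (a *: v).
Proof. by move=> Wv; rewrite -[_ *: _]addr0; apply: sm_lin => //; exact: sm_zero. Qed.

Lemma sm_sum (W : submod V) (J : Type) (r : seq J) (P : pred J) (f : J -> V) :
  (forall j, P j -> W (f j)) -> W (\sum_(j <- r | P j) f j).
Proof.
by move=> h; elim/big_ind: _ => //; [exact: sm_zero | exact: sm_add].
Qed.

Lemma gen_zero P : gen P 0. Proof. by move=> W _; exact: sm_zero. Qed.
Lemma gen_lin P a u v : gen P u -> gen P v -> gen P (a *: u + v).
Proof. by move=> gu gv W h; apply: sm_lin; [exact: gu|exact: gv]. Qed.

Definition genm P : submod V := Submod (@gen_zero P) (@gen_lin P).

Lemma gen_sub P v : P v -> gen P v. Proof. by move=> Pv W; exact. Qed.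

Lemma gen_seq (s : seq V) P : (forall w, w \in s -> P w) -> gen P (\sum_(w <- s) w).
Proof.
by move=> h; rewrite big_seq; apply: (@sm_sum (genm P)) => w ws; exact/gen_sub/h.
Qed.

Definition smK (f : {linear V -> V}) : submod V.
Proof.
exists (fun v => f v = 0); first by rewrite linear0.
by move=> a u v fu fv; rewrite linearP fu fv scaler0 addr0.
Defined.

End LinearClosure.

Definition smpre (F : fieldType) (V V' : lmodType F) (f : {linear V -> V'})
  (W : submod V') : submod V.
Proof.
exists (fun v => W (f v)); first by rewrite linear0; exact: sm_zero.
by move=> a u v fu fv; rewrite linearP; exact: sm_lin.
Defined.

Definition sm_eq (F : fieldType) (V V' : lmodType F) (f g : {linear V -> V'}) :
  submod V.
Proof.
exists (fun v => f v = g v); first by rewrite !linear0.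
by move=> a u v fu fv; rewrite !linearP fu fv.
Defined.

Section FunctionalCalculus.
Variables (F : fieldType) (V : lmodType F) (I : Type) (A : I -> {linear V -> V}).

Definition eigen (chi : I -> F^o) (v : V) := forall i, A i v = chi i *: v.

Lemma eigen_sm chi : exists W : submod V, forall v, W v <-> eigen chi v.
Proof.
unshelve eexists (@Submod F V (eigen chi) _ _) => //.
  by move=> i; rewrite linear0 scaler0.
move=> a u v hu hv i; rewrite linearP hu hv scalerDr !scalerA.
by rewrite mulrC.
Qed.

(** [B] is a product of factors [A i - chi i], one for each [chi] in [cs], with [i] chosen where
    [chi] differs from [chi0]. Every factor preserves all joint eigenspaces. *)
Lemma eigen_separator (chi0 : I -> F^o) (cs : seq (I -> F^o)) :
  chi0 \notin cs ->
  exists (B : {linear V -> V}) (b : F), [/\ b != 0,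
    forall v, eigen chi0 v -> B v = b *: v,
    forall chi v, chi \in cs -> eigen chi v -> B v = 0
  & forall chi v, eigen chi v -> eigen chi (B v)].
Proof.
elim: cs => [|chi cs ih].
  move=> _; exists idfun, 1; split => //; first exact: oner_neq0.
  by move=> v _; rewrite scale1r.
rewrite in_cons negb_or => /andP[ne /ih[B [b [b0 B1 B2 B3]]]].
have [i hi] : exists i, chi0 i != chi i.
  apply: contrapT => h; move/eqP: ne; apply; apply/funext => i.
  by apply/eqP; apply: contrapT => /negP hi; apply: h; exists i.
pose C : {linear V -> V} := A i \+ (- chi i) \*: idfun.
have CE v : C v = A i v - chi i *: v by rewrite /C /= scaleNr.
have Ceig chi' v : eigen chi' v -> C v = (chi' i - chi i) *: v.
  by move=> h; rewrite CE h scalerBl.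
exists (C \o B), ((chi0 i - chi i) * b); split.
- by rewrite mulf_neq0 // subr_eq0.
- move=> v h; rewrite -[LHS]/(C (B v)) (Ceig chi0); last exact: B3.
  by rewrite B1 // scalerA.
- move=> chi' v; rewrite in_cons => /orP[/eqP ->|cs'] h; rewrite -[LHS]/(C (B v)).
    by rewrite (Ceig chi) ?subrr ?scale0r //; exact: B3.
  by rewrite (B2 _ _ cs' h) linear0.
- move=> chi' v h; have [W hW] := eigen_sm chi'.
  rewrite -[X in eigen _ X]/(C (B v)) (Ceig chi'); last exact: B3.
  by apply/hW/sm_scale/hW; exact: B3.
Qed.

Lemma eigen_indep (s : seq ((I -> F^o) * V)) (chi : I -> F^o) :
  (forall p, p \in s -> eigen p.1 p.2) -> \sum_(p <- s) p.2 = 0 ->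
  \sum_(p <- s | p.1 == chi) p.2 = 0.
Proof.
move=> h s0.
have [|B [b [b0 B1 B2 _]]] := @eigen_separator chi [seq c <- map fst s | c != chi].
  by rewrite mem_filter eqxx.
have /eqP := congr1 B s0; rewrite linear0 linear_sum (bigID (fun p => p.1 == chi)) /=.
rewrite [X in _ + X]big1_seq ?addr0; last first.
  move=> p /andP[pc ps]; apply: (B2 p.1); last exact: h.
  by rewrite mem_filter pc map_f.
rewrite big_seq_cond (eq_bigr (fun p => b *: p.2)); last first.
  by move=> p /andP[ps /eqP pc]; apply: B1; rewrite -pc; exact: h.
by rewrite -big_seq_cond -scaler_sumr scaler_eq0 (negPf b0) => /eqP.
Qed.

(** Regrouping by character reduces this to [eigen_indep]. It makes [calc_fun] independent of the
    decomposition chosen for its argument. *)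
Lemma eigen_indep_fun (phi : (I -> F^o) -> F) (s : seq ((I -> F^o) * V)) :
  (forall p, p \in s -> eigen p.1 p.2) -> \sum_(p <- s) p.2 = 0 ->
  \sum_(p <- s) phi p.1 *: p.2 = 0.
Proof.
move=> h s0; pose u := undup (map fst s).
transitivity (\sum_(c <- u) \sum_(p <- s | p.1 == c) phi p.1 *: p.2).
  rewrite [LHS]big_seq [RHS](exchange_big_dep xpredT) //= [RHS]big_seq.
  apply: eq_bigr => p ps; rewrite (big_rem p.1) /= ?mem_undup ?map_f // eqxx.
  rewrite big1_seq ?addr0 // => c /andP[/eqP <-].
  by rewrite mem_rem_uniqF // undup_uniq.
apply: big1 => c _; rewrite (eq_bigr (fun p => phi c *: p.2)); last by move=> p /eqP ->.
by rewrite -scaler_sumr eigen_indep ?scaler0.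
Qed.

Definition diagonalizable := forall v, gen (fun x => exists chi, eigen chi x) v.

Lemma eigen_decomp_in (P : (I -> F^o) -> Prop) v :
  gen (fun x => exists2 c, P c & eigen c x) v ->
  exists s : seq ((I -> F^o) * V), v = \sum_(p <- s) p.2 /\
    forall p, p \in s -> P p.1 /\ eigen p.1 p.2.
Proof.
pose Q v := exists s : seq ((I -> F^o) * V), v = \sum_(p <- s) p.2 /\
    forall p, p \in s -> P p.1 /\ eigen p.1 p.2.
have Q0 : Q 0 by exists [::]; rewrite big_nil.
have Qlin a u w : Q u -> Q w -> Q (a *: u + w).
  move=> [s [-> hs]] [t [-> ht]].
  exists ([seq (p.1, a *: p.2) | p <- s] ++ t); split.
    by rewrite big_cat big_map scaler_sumr.
  move=> p; rewrite mem_cat => /orP[/mapP[p' ps ->]|]; last exact: ht.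
  have [Pp ep] := hs _ ps; split=> //.
  by have [W hW] := eigen_sm p'.1; exact/hW/sm_scale/hW.
move=> /(_ (Submod Q0 Qlin)); apply => x [c Pc h]; exists [:: (c, x)].
by split=> [|p]; rewrite ?big_seq1 // inE => /eqP ->.
Qed.

Lemma eigen_decomp v : gen (fun x => exists chi, eigen chi x) v ->
  exists s : seq ((I -> F^o) * V),
    v = \sum_(p <- s) p.2 /\ forall p, p \in s -> eigen p.1 p.2.
Proof.
move=> g; have [|s [vs hs]] := @eigen_decomp_in xpredT v.
  by move=> W h; apply: g => x [c hc]; apply: h; exists c.
by exists s; split=> // p /hs[].
Qed.

(** Adding [- v] to a decomposition of [v] with characters in [P] gives a zero sum in which, if
    [P chi] failed, [- v] would be the only term of character [chi]. *)
Lemma eigen_gen_mem (P : (I -> F^o) -> Prop) chi v : v != 0 -> eigen chi v ->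
  gen (fun x => exists2 c, P c & eigen c x) v -> P chi.
Proof.
move=> v0 hv g; apply: contrapT => nP.
have [s [vE hs]] : exists s : seq ((I -> F^o) * V), v = \sum_(p <- s) p.2 /\
    forall p, p \in s -> P p.1 /\ eigen p.1 p.2 by exact: eigen_decomp_in.
have h : \sum_(p <- (chi, - v) :: s | p.1 == chi) p.2 = 0.
  apply: eigen_indep; last by rewrite big_cons -vE addNr.
  move=> p; rewrite in_cons => /orP[/eqP -> /=|/hs[]//].
  by have [W hW] := eigen_sm chi; apply/hW; rewrite -scaleN1r; exact/sm_scale/hW.
move: h; rewrite big_cons /= eqxx big1_seq ?addr0; last first.
  by move=> p /andP[/eqP pc /hs[]]; rewrite pc.
by move/eqP; rewrite oppr_eq0 (negPf v0).
Qed.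

Hypothesis dA : diagonalizable.

Section Calc.
Variable phi : (I -> F^o) -> F.

Definition calc_fun (v : V) : V :=
  \sum_(p <- projT1 (cid (eigen_decomp (dA v)))) phi p.1 *: p.2.

Lemma calc_funE v (s : seq ((I -> F^o) * V)) : v = \sum_(p <- s) p.2 ->
  (forall p, p \in s -> eigen p.1 p.2) ->
  calc_fun v = \sum_(p <- s) phi p.1 *: p.2.
Proof.
move=> vs hs; rewrite /calc_fun; case: cid => t /= [vt ht].
have : \sum_(p <- t ++ [seq (p.1, - p.2) | p <- s]) phi p.1 *: p.2 = 0.
  apply: eigen_indep_fun; last first.
    rewrite big_cat big_map /= -vt.
    by rewrite (eq_bigr (fun p => -1 *: p.2)) -?scaler_sumr -?vs ?scaleN1r ?subrr // => p _; rewrite scaleN1r.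
  move=> p; rewrite mem_cat => /orP[/ht//|/mapP[q qs ->]] /=.
  by have [W hW] := eigen_sm q.1; apply/hW; rewrite -scaleN1r; exact/sm_scale/hW/hs.
rewrite big_cat big_map /= (eq_bigr (fun p => -1 *: (phi p.1 *: p.2)) (r := s)).
  by rewrite -scaler_sumr scaleN1r => /subr0_eq.
by move=> p _; rewrite scalerN scaleN1r.
Qed.

Lemma calc_fun_linear : linear calc_fun.
Proof.
move=> a u v; have [s [us hs]] := eigen_decomp (dA u).
have [t [vt ht]] := eigen_decomp (dA v).
rewrite (calc_funE us hs) (calc_funE vt ht).
rewrite (@calc_funE _ ([seq (p.1, a *: p.2) | p <- s] ++ t)); first last.
- move=> p; rewrite mem_cat => /orP[/mapP[q qs ->]|/ht//].
  by have [W hW] := eigen_sm q.1; apply/hW/sm_scale/hW/hs.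
- by rewrite big_cat big_map /= -scaler_sumr -us -vt.
rewrite big_cat big_map /= scaler_sumr; congr (_ + _); apply: eq_bigr => p _.
by rewrite !scalerA mulrC.
Qed.

HB.instance Definition _ := GRing.isLinear.Build F V V *:%R calc_fun calc_fun_linear.

(* [phi] applied to the commuting diagonalizable operators [A]. *)
Definition calc : {linear V -> V} := calc_fun.

Lemma calc_eigen chi v : eigen chi v -> calc v = phi chi *: v.
Proof.
move=> h; rewrite /calc /= (@calc_funE _ [:: (chi, v)]) ?big_seq1 //.
by move=> p; rewrite inE => /eqP ->.
Qed.

End Calc.

Lemma diag_ind (W : submod V) : (forall chi v, eigen chi v -> W v) -> forall v, W v.
Proof. by move=> h v; apply: dA => x [chi /h]. Qed.

Lemma calc_comm phi (B : {linear V -> V}) : (forall i v, A i (B v) = B (A i v)) ->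
  forall v, calc phi (B v) = B (calc phi v).
Proof.
move=> hB; apply: (@diag_ind (sm_eq (calc phi \o B) (B \o calc phi))) => chi v h /=.
rewrite (calc_eigen _ h) linearZ /= (@calc_eigen _ chi) // => i.
by rewrite hB h linearZ.
Qed.

End FunctionalCalculus.

(** * Tensor products *)

Section TensorTools.
Variables (F : fieldType) (l : nat) (V : 'I_l -> lmodType F).
Local Notation tuples := (forall i, V i).
Local Notation T := (tens V).

Lemma dfwith_same (v : tuples) i : dfwith v i (v i) = v.
Proof.
apply: functional_extensionality_dep => j.
by have [<-|ij] := eqVneq i j; rewrite ?dfwithin ?dfwithout.
Qed.

Lemma dfwith_at (u v : tuples) i : (forall k, k != i -> u k = v k) ->
  u = dfwith v i (u i).
Proof.
move=> h; apply: functional_extensionality_dep => k.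
by have [<-|ik] := eqVneq i k; rewrite ?dfwithin ?dfwithout // h // eq_sym.
Qed.

Lemma pure_at (u v w : tuples) i (a : F) : u i = a *: v i + w i ->
  (forall k, k != i -> u k = v k) -> (forall k, k != i -> w k = v k) ->
  pure u = a *: pure v + pure w.
Proof.
move=> ui uv wv; rewrite (dfwith_at uv) (dfwith_at wv) ui pure_multilinear.
by rewrite dfwith_same.
Qed.

Lemma pure_zero (v : tuples) i : v i = 0 -> pure v = 0.
Proof.
move=> vi; apply/eqP; rewrite -(subrr (pure v)) -[X in _ == X]addrC -scaleN1r; apply/eqP.
by rewrite -(@pure_at v v v i) // vi scaler0 addr0.
Qed.

Lemma pure_scale (u v : tuples) i (a : F) : u i = a *: v i ->
  (forall k, k != i -> u k = v k) -> pure u = a *: pure v.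
Proof.
move=> ui uv; rewrite (@pure_at u v (dfwith v i 0) i a) ?dfwithin ?addr0 //.
  by rewrite (@pure_zero (dfwith v i 0) i) ?dfwithin ?addr0.
by move=> k ki; rewrite dfwithout // eq_sym.
Qed.

Lemma tens_elim (P : forall i, V i -> Prop) (W : submod T) :
  (forall i v, gen (P i) v) -> (forall v, (forall i, P i (v i)) -> W (pure v)) ->
  forall t, W t.
Proof.
move=> gP WP; suff Wpure v : W (pure v).
  move=> t; have [s ->] := tens_span t.
  by apply: sm_sum => p _; apply: sm_scale.
(* [k] counts the leading factors known to satisfy [P]. The induction descends from [k = l], freeing
   one factor at a time by multilinearity. *)
suff: forall k : nat, (k <= l)%N -> forall v : tuples,
    (forall i : 'I_l, (i < k)%N -> P i (v i)) -> W (pure v).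
  by move=> /(_ 0%N isT v); apply.
move=> k kl; rewrite -(subKn kl); elim: (l - k)%N (leq_subr k l) => [|d ih] dl u hu.
  by apply: WP => i; apply: hu; rewrite subn0.
have lt_d : (l - d.+1 < l)%N by rewrite ltn_subrL /= (leq_trans _ dl).
pose i0 := Ordinal lt_d.
suff h x : W (pure (dfwith u i0 x)) by rewrite -(dfwith_same u i0).
have W0 : W (pure (dfwith u i0 0)).
  by rewrite (@pure_zero _ i0) ?dfwithin //; exact: sm_zero.
have Wlin a y z : W (pure (dfwith u i0 y)) -> W (pure (dfwith u i0 z)) ->
    W (pure (dfwith u i0 (a *: y + z))).
  by move=> hy hz; rewrite pure_multilinear; exact: sm_lin.
apply: (gP i0 x (Submod W0 Wlin)) => y Py; apply: ih; first exact: ltnW.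
move=> i hi; have [ii0|ii0] := eqVneq i0 i; first by subst i; rewrite dfwithin.
rewrite dfwithout //; apply: hu.
have := hi; rewrite -subnSK // ltnS leq_eqVlt => /orP[/eqP ei|//].
by case/eqP: ii0; apply: val_inj; rewrite /= ei.
Qed.

Lemma tens_ext (V' : lmodType F) (f g : {linear T -> V'}) :
  (forall v, f (pure v) = g (pure v)) -> forall t, f t = g t.
Proof.
move=> h; apply: (@tens_elim (fun _ _ => True) (sm_eq f g)) => [i v|v _].
  exact: gen_sub.
exact: h.
Qed.

End TensorTools.

Section HeteroMap.
Variables (F : fieldType) (l : nat) (V V' : 'I_l -> lmodType F).
Variable f : forall i, {linear V i -> V' i}.

Lemma hmap_multilinear :
  multilinear (fun v : forall i, V i => pure (fun i => f i (v i))).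
Proof.
move=> v i a x y; apply: (@pure_at _ _ _ _ _ _ i).
- by rewrite !dfwithin linearP.
- by move=> k ki; rewrite !dfwithout // eq_sym.
- by move=> k ki; rewrite !dfwithout // eq_sym.
Qed.

Definition hmap : {linear tens V -> tens V'} := tlift hmap_multilinear.

Lemma hmap_pure v : hmap (pure v) = pure (fun i => f i (v i)).
Proof. exact: tlift_pure. Qed.

End HeteroMap.

Section SuperAction.
Variables (R : realType) (l : nat).
Local Notation C := R[i].
Variables (S : set int) (M : 'I_l -> gmod C S).
Local Notation T := (tensM M).

Lemma tact_pure i b x v : tact M i b x (pure v) =
  pure (fun j => (if (j < i)%N then (if b then sgn (M j) else idfun)
                  else if j == i then rho (M j) x else idfun) (v j)).
Proof. by rewrite /tact tmap_pure. Qed.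

Lemma sgn_exp (M1 : gmod C S) b v :
  (if b then sgn M1 else idfun : {linear _ -> _}) v = (if b then sgn M1 v else v).
Proof. by case: b. Qed.

Lemma tact_lin i b a x y t : gS S x -> gS S y ->
  tact M i b (a *: x + y) t = a *: tact M i b x t + tact M i b y t.
Proof.
move=> Sx Sy; move: t.
apply: (tens_ext (f := tact M i b (a *: x + y)) (g := a \*: tact M i b x \+ tact M i b y)).
move=> v /=; rewrite !tact_pure; apply: (@pure_at _ _ _ _ _ _ i).
- by rewrite ltnn eqxx rho_lin.
- by move=> k /negPf ->.
- by move=> k /negPf ->.
Qed.

(** The sign arises only in the leftmost of the two factors, where the parity involution carried by
    the other operator is moved past the action. *)
Lemma tact_comm (i j : 'I_l) bx by_ x y t : i != j ->
  gS S x -> gS S y -> homog bx x -> homog by_ y ->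
  tact M i bx x (tact M j by_ y t) =
  (-1) ^+ (bx && by_) *: tact M j by_ y (tact M i bx x t).
Proof.
move=> ij Sx Sy hx hy; move: t.
apply: (tens_ext (f := tact M i bx x \o tact M j by_ y)
  (g := (-1) ^+ (bx && by_) \*: (tact M j by_ y \o tact M i bx x))) => v /=.
rewrite !tact_pure.
have [ltij|ltji|e] := ltngtP i j; last by rewrite (val_inj e) eqxx in ij.
- apply: (@pure_scale _ _ _ _ _ i).
    rewrite ltnn eqxx ltij /=; case: by_ hy => hy; last by rewrite andbF scale1r.
    rewrite andbT [in RHS](sgn_rho _ Sx hx) scalerA -expr2 sqrr_sign scale1r //.
  move=> k ki /=; have [ki'|ik|e] := ltngtP k i; last by rewrite (val_inj e) eqxx in ki.
    by rewrite (ltn_trans ki' ltij) !sgn_exp; case: bx {hx}; case: by_ {hy}.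
  by rewrite (negPf ki).
- apply: (@pure_scale _ _ _ _ _ j).
    rewrite ltnn eqxx ltji /=; case: bx hx => hx; last by rewrite scale1r.
    by rewrite /= (sgn_rho _ Sy hy).
  move=> k kj /=; have [kj'|jk|e] := ltngtP k j; last by rewrite (val_inj e) eqxx in kj.
    by rewrite (ltn_trans kj' ltji) !sgn_exp; case: bx {hx}; case: by_ {hy}.
  by rewrite (negPf kj).
Qed.

(** In the factor [i] this is the module axiom; on the factors before it the involutions of [x] and
    [y] multiply to that of parity [bx (+) by_]. *)
Lemma tact_br (i : 'I_l) bx by_ x y t :
  gS S x -> gS S y -> homog bx x -> homog by_ y ->
  tact M i bx x (tact M i by_ y t) =
  (-1) ^+ (bx && by_) *: tact M i by_ y (tact M i bx x t)
  + tact M i (bx (+) by_) (extbr x y) t.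
Proof.
move=> Sx Sy hx hy; move: t.
apply: (tens_ext (f := tact M i bx x \o tact M i by_ y)
  (g := (-1) ^+ (bx && by_) \*: (tact M i by_ y \o tact M i bx x) \+
        tact M i (bx (+) by_) (extbr x y))) => v /=.
rewrite !tact_pure; apply: (@pure_at _ _ _ _ _ _ i).
- by rewrite ltnn eqxx (@rho_br _ _ _ bx by_) // addrC subrK.
- move=> k ki; rewrite (negPf ki); case: ifP => // _.
  by rewrite !sgn_exp; case: bx {hx}; case: by_ {hy}.
- move=> k ki; rewrite (negPf ki); case: ifP => // _.
  by rewrite !sgn_exp; case: bx {hx}; case: by_ {hy}; rewrite /= ?sgnK.
Qed.

End SuperAction.

(** * Commutation relations *)

Section Brackets.
Variable F : fieldType.
Local Notation Emx := (Emx F).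
Local Notation Eext := (Eext F).
Local Notation Kext := (Kext F).

Lemma fsum_sub2 (u v : int -> F^o) k1 k2 :
  (forall k, k != k1 -> u k = 0) -> (forall k, k != k2 -> v k = 0) ->
  \sum_(k \in [set: int]) (u k - v k) = u k1 - v k2.
Proof.
move=> hu hv; rewrite (fsbigE (undup [:: k1; k2])) ?undup_uniq //; first last.
  move=> k _; rewrite mem_undup !inE negb_or => /andP[k1' k2'].
  by rewrite hu // hv // subrr.
rewrite (eq_bigl xpredT); last by move=> k; rewrite in_setT.
rewrite sumrB; congr (_ - _).
  rewrite (bigD1_seq k1) ?undup_uniq ?mem_undup ?inE ?eqxx ?orbT //=.
  by rewrite big1 ?addr0 // => k /hu.
rewrite (bigD1_seq k2) ?undup_uniq ?mem_undup ?inE ?eqxx ?orbT //=.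
by rewrite big1 ?addr0 // => k /hv.
Qed.

Lemma ext_linE (a : F) (x y : ext F) i j :
  (a *: x + y).1 i j = a * x.1 i j + y.1 i j.
Proof. by rewrite [LHS]/=. Qed.

Definition Jd (a : int) : F := - ((a < 0)%R)%:R.

Lemma sbrE a b c d : sbr (Emx a b) (Emx c d) =
  ((b == c)%:R : F) *: Emx a d
  - ((-1) ^+ ((par a (+) par b) && (par c (+) par d)) * (d == a)%:R) *: Emx c b.
Proof.
apply/funext => i; apply/funext => j.
rewrite /sbr (@fsum_sub2 _ _ b a); first last.
- by move=> k /negPf ka; rewrite /Emx ka /= mulr0n !mulr0.
- by move=> k /negPf kb; rewrite /Emx kb andbF mul0r.
rewrite -[RHS]/(_ * Emx a d i j - _ * Emx c b i j) /Emx !eqxx /= !andbT.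
congr (_ - _).
  by rewrite -!natrM; congr (_%:R); do 3 case: eqP.
have [->|] := eqVneq d a; last by rewrite andbF mulr0n mul0r !mulr0 mul0r.
rewrite mulr1 andbT -natrM mulnb.
have [->|] := eqVneq i c; last by rewrite /= !mulr0.
have [->|] := eqVneq j b; last by rewrite /= !mulr0.
by rewrite andbC.
Qed.

Lemma sbrJ a b : sbr (Jmat F) (Emx a b) = (Jd a - Jd b) *: Emx a b.
Proof.
apply/funext => i; apply/funext => j.
rewrite /sbr (@fsum_sub2 _ _ i j); first last.
- by move=> k /negPf kj; rewrite /Jmat kj /= oppr0 !mulr0.
- by move=> k; rewrite eq_sym => /negPf ki; rewrite /Jmat ki /= oppr0 mul0r.
rewrite -[RHS]/(_ * Emx a b i j) /Jmat /Emx !eqxx !addbb andbF mul1r /=.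
have [->|] := eqVneq i a; last by rewrite !mulr0n !mulr0 mul0r subrr.
have [->|] := eqVneq j b; last by rewrite !mulr0n !mulr0 mul0r subrr.
by rewrite !mulr1 mul1r.
Qed.

Lemma StrZE (x : F) a b c d : Str (mmul (x *: Emx a b) (Emx c d)) =
  ((b == c) && (d == a))%:R * (-1) ^+ par a * x.
Proof.
rewrite /Str (@fsum1 _ _ a); last first.
  move=> i /negPf ia; rewrite /mmul fsum0 ?mulr0 // => k.
  by rewrite -[X in X * _]/(x * Emx a b i k) /Emx ia mulr0 mul0r.
rewrite /mmul (@fsum1 _ _ b); last first.
  move=> k /negPf kb; rewrite -[X in X * _]/(x * Emx a b a k) /Emx kb andbF.
  by rewrite mulr0 mul0r.
rewrite -[X in _ * (X * _)]/(x * Emx a b a b) /Emx !eqxx mulr1.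
rewrite -[X in _ * X]/(x * _) [(a == d)]eq_sym.
by case: (_ && _); rewrite ?mulr0 ?mul0r ?mulr1 ?mul1r.
Qed.

(** The [Kext] term is the cocycle, nonzero only on opposite matrix units whose two indices have
    different signs. *)
Lemma extbrE a b c d : extbr (Eext a b) (Eext c d) =
  ((b == c)%:R : F) *: Eext a d
  - ((-1) ^+ ((par a (+) par b) && (par c (+) par d)) * (d == a)%:R) *: Eext c b
  + (((b == c) && (d == a))%:R * (-1) ^+ par a * (Jd a - Jd b)) *: Kext.
Proof.
apply/pair_equal_spec; split => /=.
  by rewrite sbrE scaler0 addr0.
by rewrite sbrJ StrZE !scaler0 oppr0 !add0r [RHS]mulr1.
Qed.

Lemma iotaE a b : iota_ext (Emx a b) =
  Eext a b + ((a == b)%:R * (-1) ^+ par a * Jd a) *: Kext.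
Proof.
apply/pair_equal_spec; split => /=; first by rewrite scaler0 addr0.
rewrite add0r [RHS]mulr1 /Str (@fsum1 _ _ a); last first.
  move=> i /negPf ia; rewrite /mmul fsum0 ?mulr0 // => k.
  rewrite /Jmat /Emx; have [<-|] := eqVneq i k; first by rewrite ia mulr0.
  by rewrite oppr0 mul0r.
rewrite /mmul (@fsum1 _ _ a); last first.
  by move=> k; rewrite eq_sym /Jmat => /negPf ->; rewrite oppr0 mul0r.
rewrite /Jmat /Emx /Jd !eqxx /=.
by case: (a == b); rewrite ?mulr1 ?mulr0 ?mul1r ?mul0r ?mulr0.
Qed.

Lemma iota_ne a b : a != b -> iota_ext (Emx a b) = Eext a b.
Proof. by move=> /negPf ab; rewrite iotaE ab !mul0r scale0r addr0. Qed.

End Brackets.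

Section Elements.
Variables (F : fieldType) (S : set int).
Local Notation Emx := (Emx F).
Local Notation Eext := (Eext F).
Local Notation Kext := (Kext F).

Lemma gS_lin (a : F) (x y : ext F) : gS S x -> gS S y -> gS S (a *: x + y).
Proof.
move=> [fx Sx] [fy Sy].
have xy i j : (a *: x + y).1 i j != 0 -> x.1 i j != 0 \/ y.1 i j != 0.
  rewrite ext_linE.
  have [->|] := eqVneq (x.1 i j) 0; last by left.
  by rewrite mulr0 add0r; right.
split; last by move=> i j /xy[/Sx|/Sy].
apply: (@sub_finite_set _ _ ([set ij : int * int | x.1 ij.1 ij.2 != 0] `|`
  [set ij : int * int | y.1 ij.1 ij.2 != 0])); last by rewrite finite_setU.
by move=> [i j] /= /xy.
Qed.

Lemma gS_scale (a : F) (x : ext F) : gS S x -> gS S (a *: x).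
Proof. by move=> Sx; rewrite -[_ *: _]addr0; apply: gS_lin => //; exact: gS0. Qed.

Lemma gS_add (x y : ext F) : gS S x -> gS S y -> gS S (x + y).
Proof. by move=> Sx; rewrite -[x in x + _]scale1r; exact: gS_lin. Qed.

Lemma gS_sum (J : Type) (r : seq J) (P : pred J) (f : J -> ext F) :
  (forall j, P j -> gS S (f j)) -> gS S (\sum_(j <- r | P j) f j).
Proof. by move=> h; elim/big_ind: _ => //; [exact: gS0 | exact: gS_add]. Qed.

Lemma gS_iota a b : S a -> S b -> gS S (iota_ext (Emx a b)).
Proof.
move=> Sa Sb; rewrite iotaE; apply: gS_add; first exact: gSE.
by apply: gS_scale; exact: gSK.
Qed.

Lemma homog_iota a b : homog (par a (+) par b) (iota_ext (Emx a b)).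
Proof.
split; first by move=> i j /Emx_neq0[-> ->].
have [->|ab _] := eqVneq a b; first by rewrite addbb.
by rewrite iota_ne.
Qed.

Lemma extbr_addK (x y : ext F) k : extbr x (y + k *: Kext) = extbr x y.
Proof.
rewrite /extbr /= (_ : y.1 + k *: 0 = y.1) //.
by rewrite scaler0 addr0.
Qed.

(** No central term is left over: the cocycle is the coboundary of [A -> Str(J A)], which is what
    [iota_ext] adds. So the operators in the Hamiltonians obey the plain matrix relations whatever
    the signs of the indices. *)
Lemma extbr_iota c d a b : extbr (Eext c d) (iota_ext (Emx a b)) =
  ((d == a)%:R : F) *: iota_ext (Emx c b)
  - ((-1) ^+ ((par c (+) par d) && (par a (+) par b)) * (b == c)%:R)
     *: iota_ext (Emx a d).
Proof.
rewrite iotaE extbr_addK extbrE !iotaE !scalerDr opprD !scalerA.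
rewrite addrACA; congr (_ + _); rewrite -scalerBl; congr (_ *: _).
rewrite [a == d]eq_sym [c == b]eq_sym.
have [->|_] := eqVneq d a; last by rewrite !mul0r mulr0 subr0.
have [->|_] := eqVneq b c; last by rewrite !(mulr0, mul0r) subr0.
rewrite !mul1r mulr1 mulrBr; congr (_ - _).
by case: (par c); case: (par a); rewrite /= ?(expr0, expr1, mul1r, mulN1r, opprK).
Qed.

End Elements.

Section ModuleRel.
Variables (F : fieldType) (S : set int) (M : gmod F S).

Lemma rhoD x y (v : M) : gS S x -> gS S y -> rho M (x + y) v = rho M x v + rho M y v.
Proof. by move=> Sx Sy; have := rho_lin 1 v Sx Sy; rewrite !scale1r. Qed.

Lemma rho_sum (J : Type) (r : seq J) (P : pred J) (f : J -> ext F) (v : M) :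
  (forall j, P j -> gS S (f j)) ->
  rho M (\sum_(j <- r | P j) f j) v = \sum_(j <- r | P j) rho M (f j) v.
Proof.
move=> h; elim: r => [|j r ih]; first by rewrite !big_nil rho0.
rewrite !big_cons; case: ifP => [Pj|//].
by rewrite rhoD ?ih //; [exact: h | exact: gS_sum].
Qed.

Lemma extbrE_levi a b c d : ((a < 0) == (b < 0)) || ((c < 0) == (d < 0)) ->
  extbr (Eext F a b) (Eext F c d) = ((b == c)%:R : F) *: Eext F a d
  - ((-1) ^+ ((par a (+) par b) && (par c (+) par d)) * (d == a)%:R) *: Eext F c b.
Proof.
move=> ss; rewrite extbrE (_ : _ * (Jd _ _ - _) = 0) ?scale0r ?addr0 //.
have [e1|] := eqVneq b c; last by rewrite !mul0r.
have [e2|] := eqVneq d a; last by rewrite !mul0r.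
move: ss; rewrite e1 e2 [in X in _ || X]eq_sym orbb /Jd => /eqP ->.
by rewrite subrr mulr0.
Qed.

Lemma rho_sub2 (k1 k2 : F) x y (v : M) : gS S x -> gS S y ->
  rho M (k1 *: x - k2 *: y) v = k1 *: rho M x v - k2 *: rho M y v.
Proof.
move=> Sx Sy; have Sy' := gS_scale (- k2) Sy.
by rewrite -[in LHS]scaleNr rho_lin // rhoZ // scaleNr.
Qed.

Lemma rho_EE a b c d (v : M) : S a -> S b -> S c -> S d ->
  ((a < 0) == (b < 0)) || ((c < 0) == (d < 0)) ->
  rho M (Eext F a b) (rho M (Eext F c d) v) =
  (-1) ^+ ((par a (+) par b) && (par c (+) par d)) *:
    rho M (Eext F c d) (rho M (Eext F a b) v)
  + (((b == c)%:R : F) *: rho M (Eext F a d) v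
  - ((-1) ^+ ((par a (+) par b) && (par c (+) par d)) * (d == a)%:R)
     *: rho M (Eext F c b) v).
Proof.
move=> Sa Sb Sc Sd ss.
have := rho_br v (gSE F Sa Sb) (gSE F Sc Sd) (homogE _ a b) (homogE _ c d).
move=> /eqP; rewrite eq_sym subr_eq => /eqP ->; rewrite addrC; congr (_ + _).
by rewrite extbrE_levi // rho_sub2 //; exact: gSE.
Qed.

End ModuleRel.

Section TensorRel.
Variables (R : realType) (l : nat).
Local Notation C := R[i].
Variables (S : set int) (M : 'I_l -> gmod C S).
Local Notation T := (tensM M).

Lemma tacts_linear b x : linear (tacts (M := M) b x).
Proof.
move=> a u v; rewrite /tacts scaler_sumr -big_split; apply: eq_bigr => i _.
by rewrite linearP.
Qed.
HB.instance Definition _ b x :=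
  GRing.isLinear.Build C T T *:%R (tacts (M := M) b x) (tacts_linear b x).

Lemma tact_scale i b a x (t : T) : gS S x ->
  tact M i b (a *: x) t = a *: tact M i b x t.
Proof.
move=> Sx; have S0 := gS0 C S.
have t0 : tact M i b 0 t = 0.
  by have := tact_lin i b (-1) t S0 S0; rewrite scaler0 addr0 scaleN1r addNr.
by have := tact_lin i b a t Sx S0; rewrite addr0 t0 addr0.
Qed.

Lemma tact_sub2 i b (k1 k2 : C) x y (t : T) : gS S x -> gS S y ->
  tact M i b (k1 *: x - k2 *: y) t = k1 *: tact M i b x t - k2 *: tact M i b y t.
Proof.
move=> Sx Sy; have Sy' := gS_scale (- k2) Sy.
by rewrite -[in LHS]scaleNr tact_lin // tact_scale // scaleNr.
Qed.

Lemma tacts_tact (i : 'I_l) bx by_ x y (t : T) :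
  gS S x -> gS S y -> homog bx x -> homog by_ y ->
  tacts bx x (tact M i by_ y t) =
  (-1) ^+ (bx && by_) *: tact M i by_ y (tacts bx x t)
  + tact M i (bx (+) by_) (extbr x y) t.
Proof.
move=> Sx Sy hx hy; rewrite [LHS]/tacts.
transitivity (\sum_j ((-1) ^+ (bx && by_) *: tact M i by_ y (tact M j bx x t)
  + if j == i then tact M i (bx (+) by_) (extbr x y) t else 0)).
  apply: eq_bigr => j _; case: eqVneq => [->|ji]; first by rewrite tact_br.
  by rewrite addr0 tact_comm.
by rewrite big_split /= -big_mkcond big_pred1_eq -scaler_sumr -linear_sum.
Qed.

Lemma tacts_br bx by_ x y (t : T) :
  gS S x -> gS S y -> homog bx x -> homog by_ y ->
  tacts bx x (tacts by_ y t) =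
  (-1) ^+ (bx && by_) *: tacts by_ y (tacts bx x t)
  + tacts (bx (+) by_) (extbr x y) t.
Proof.
move=> Sx Sy hx hy; transitivity (\sum_i tacts bx x (tact M i by_ y t)).
  by rewrite -linear_sum.
by rewrite (eq_bigr _ (fun i _ => tacts_tact i t Sx Sy hx hy)) big_split /= -scaler_sumr.
Qed.

Definition Et (a b : int) : {linear T -> T} :=
  tacts (M := M) (par a (+) par b) (Eext C a b).

Lemma Et_tacts a b (t : T) : Et a b t = tacts (par a (+) par b) (Eext C a b) t.
Proof. by []. Qed.

Lemma Et_rel a b c d (t : T) : S a -> S b -> S c -> S d ->
  ((a < 0) == (b < 0)) || ((c < 0) == (d < 0)) ->
  Et a b (Et c d t) =
  (-1) ^+ ((par a (+) par b) && (par c (+) par d)) *: Et c d (Et a b t)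
  + (((b == c)%:R : C) *: Et a d t
  - ((-1) ^+ ((par a (+) par b) && (par c (+) par d)) * (d == a)%:R) *: Et c b t).
Proof.
move=> Sa Sb Sc Sd ss; rewrite [LHS]tacts_br; try exact: gSE; try exact: homogE.
congr (_ + _); rewrite extbrE_levi // /tacts.
rewrite (eq_bigr _ (fun i _ => tact_sub2 i _ _ _ t (gSE C Sa Sd) (gSE C Sc Sb))).
rewrite sumrB -!scaler_sumr /Et /= /tacts; congr (_ - _).
  have [->|] := eqVneq b c; last by rewrite !scale0r.
  by rewrite -addbA [par c (+) (_ (+) _)]addbA addbb addFb.
have [->|] := eqVneq d a; last by rewrite !mulr0 !scale0r.
suff -> : (par a (+) par b) (+) (par c (+) par a) = par c (+) par b by [].
by case: (par a); case: (par b); case: (par c).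
Qed.

Lemma Eops_Et a b (t : T) : a != b -> Eops a b t = Et a b t.
Proof. by move=> ab; rewrite /Eops /Eop iota_ne. Qed.

End TensorRel.

(** * Reflections and signs of weights *)

Section Reflections.
Variables (F : numFieldType) (V : lmodType F) (E : int -> int -> {linear V -> V}).

Definition sg (a b c d : int) : F :=
  (-1) ^+ ((par a (+) par b) && (par c (+) par d)).

(** The relations in which the cocycle vanishes because one of the two matrix units is in the Levi
    subalgebra. They are abstracted so that the same reflections serve a single module and the
    tensor product. *)
Definition gl_rel := forall a b c d v, a != 0 -> b != 0 -> c != 0 -> d != 0 ->
  ((a < 0) == (b < 0)) || ((c < 0) == (d < 0)) ->
  E a b (E c d v) = sg a b c d *: E c d (E a b v)
    + (((b == c)%:R : F) *: E a d v - (sg a b c d * (d == a)%:R) *: E c b v).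

Hypothesis Erel : gl_rel.

Definition wt (w : int -> F) (v : V) := forall a, a != 0 -> E a a v = w a *: v.

Definition wshift (w : int -> F) a b : int -> F :=
  fun c => w c + (c == a)%:R - (c == b)%:R.

Lemma wt_E w v a b : a != 0 -> b != 0 -> wt w v -> wt (wshift w a b) (E a b v).
Proof.
move=> a0 b0 h c c0; rewrite Erel ?eqxx // /sg addbb /= expr0 scale1r mul1r h //.
rewrite linearZ /wshift scalerBl scalerDl -addrA; congr (_ + (_ - _)).
  by have [->|] := eqVneq c a; rewrite ?scale0r.
by rewrite eq_sym; have [->|] := eqVneq c b; rewrite ?scale0r.
Qed.

Definition lev (a b : int) := [&& a != 0, b != 0 & (a < 0) == (b < 0)].

Section Odd.
Variables (x y : int).
Hypotheses (lxy : lev x y) (pxy : par x != par y).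

Lemma odd_refl_xy w v : wt w v -> E x y v = 0 ->
  E x y (E y x v) = (w x + w y) *: v.
Proof.
move: lxy => /and3P[x0 y0 /eqP sxy] wv exy.
rewrite Erel ?sxy ?eqxx // exy linear0 scaler0 add0r !wv // mulr1 scale1r.
rewrite /sg (_ : _ && _ = true) ?expr1 ?mulN1r ?scaleN1r ?opprK ?scalerDl //.
by have := pxy; case: (par x); case: (par y).
Qed.

(** The supercommutator of an odd element with itself is twice its square, and that of [E y x]
    vanishes. *)
Lemma odd_refl_sq v : E y x (E y x v) = 0.
Proof.
move: lxy => /and3P[x0 y0 /eqP sxy].
have /negPf nxy : x != y by apply: contraNneq pxy => ->.
have := Erel v y0 x0 y0 x0; rewrite sxy eqxx => /(_ isT).
rewrite nxy mulr0 !scale0r subr0 addr0 /sg (_ : _ && _ = true); last first.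
  by have := pxy; case: (par x); case: (par y).
rewrite expr1 scaleN1r => /eqP; rewrite -subr_eq0 opprK -mulr2n -scaler_nat.
by rewrite scaler_eq0 pnatr_eq0 => /eqP.
Qed.

Lemma refl_other v a b : a != 0 -> b != 0 -> E a b v = 0 ->
  (b = y -> E a x v = 0) -> (a = x -> E y b v = 0) -> E a b (E y x v) = 0.
Proof.
move: lxy => /and3P[x0 y0 /eqP sxy] a0 b0 eab h1 h2.
rewrite Erel ?sxy ?eqxx ?orbT // eab linear0 scaler0 add0r.
have -> : ((b == y)%:R : F) *: E a x v = 0.
  by have [/h1 ->|_] := eqVneq b y; rewrite ?scaler0 ?scale0r.
have -> : (sg a b y x * (x == a)%:R) *: E y b v = 0.
  by have [/esym/h2 ->|_] := eqVneq x a; rewrite ?scaler0 // mulr0 scale0r.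
by rewrite subr0.
Qed.

End Odd.

Section Even.
Variables (x y : int).
Hypotheses (lxy : lev x y) (pxy : par x = par y) (nxy : x != y).

Definition wpow (w : int -> F) k : int -> F :=
  fun c => w c + k%:R * ((c == y)%:R - (c == x)%:R).

Lemma wt_pow w v k : wt w v -> wt (wpow w k) (iter k (E y x) v).
Proof.
move: lxy => /and3P[x0 y0 _] wv; elim: k => [|k ih] /=.
  by move=> c c0; rewrite /wpow mul0r addr0 wv.
have := wt_E y0 x0 ih; rewrite (_ : wshift _ _ _ = wpow w k.+1) //.
by apply/funext => c; rewrite /wshift /wpow -addrA -addrA -[k.+1]addn1 natrD mulrDl mul1r.
Qed.

(** The sl2 identity e f^(k+1) v = (k+1)(h - k) f^k v on a vector killed by e. *)
Lemma even_refl_xy w v k : wt w v -> E x y v = 0 ->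
  E x y (iter k.+1 (E y x) v) =
  (k.+1%:R * (w x - w y - k%:R)) *: iter k (E y x) v.
Proof.
move: lxy => /and3P[x0 y0 /eqP sxy] wv exy.
have step u : E x y (E y x u) = E y x (E x y u) + (E x x u - E y y u).
  by rewrite Erel ?sxy ?eqxx // /sg pxy addbb expr0 !scale1r mul1r scale1r.
elim: k => [|k ih]; rewrite iterS step.
  rewrite exy linear0 add0r /= !wv // -scalerBl mul1r subr0 //.
rewrite ih !(wt_pow _ wv) // linearZ -[E y x (iter k _ _)]/(iter k.+1 (E y x) v) -scalerBl -scalerDl; congr (_ *: _).
rewrite /wpow !eqxx (negPf nxy) [y == x]eq_sym (negPf nxy) /=.
rewrite -[k.+2]addn1 !natrD -[k.+1]addn1 !natrD; ring.
Qed.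

Lemma even_refl_other (P : int -> int -> Prop) v k :
  (forall a b, P a b -> [/\ a != 0, b != 0 & E a b v = 0]) ->
  (forall a, P a y -> P a x) -> (forall b, P x b -> P y b) ->
  forall a b, P a b -> E a b (iter k (E y x) v) = 0.
Proof.
move=> h h1 h2; elim: k => [|k ih] a b Pab; first by have [] := h _ _ Pab.
rewrite iterS; have [a0 b0 _] := h _ _ Pab.
apply: refl_other => //; first exact: ih.
  by move=> e; apply: ih; apply: h1; rewrite -e.
by move=> e; apply: ih; apply: h2; rewrite -e.
Qed.

Lemma even_refl_neq0 w v n : wt w v -> E x y v = 0 -> v != 0 ->
  w x - w y = n%:R -> iter n (E y x) v != 0.
Proof.
move=> wv exy v0 wn; suff: forall k, (k <= n)%N -> iter k (E y x) v != 0 by apply.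
elim=> [//|k ih] kn; apply/eqP => e; have := even_refl_xy k wv exy.
rewrite e linear0 => /esym/eqP; rewrite scaler_eq0 (negPf (ih (ltnW kn))) orbF.
by rewrite mulf_eq0 pnatr_eq0 /= wn subr_eq0 eqr_nat eqn_leq leqNgt kn.
Qed.

End Even.

Section Generation.
Variables (lt : rel int) (v : V) (w : int -> F).
Hypothesis lt_total : forall a b, lev a b -> [\/ a = b, lt a b | lt b a].
Hypothesis wv : wt w v.
Hypothesis sv : forall a b, lev a b -> lt a b -> E a b v = 0.

Definition low (u : V) := forall W : submod V, W v ->
  (forall a b, lev a b -> lt a b -> stable W (E b a)) -> W u.

Lemma low0 : low 0. Proof. by move=> W _ _; exact: sm_zero. Qed.
Lemma low_lin a u u' : low u -> low u' -> low (a *: u + u').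
Proof. by move=> h h' W Wv Wl; apply: sm_lin; [exact: h|exact: h']. Qed.
Definition lowm : submod V := Submod low0 low_lin.

Lemma low_v : low v. Proof. by []. Qed.

Lemma low_lower a b u : lev a b -> lt a b -> low u -> low (E b a u).
Proof. by move=> lab ab h W Wv Wl; apply: (Wl _ _ lab ab); exact: h. Qed.

Lemma levC a b : lev a b -> lev b a.
Proof. by move=> /and3P[? ? h]; apply/and3P; split; rewrite // eq_sym. Qed.

(** A substitute for the triangular decomposition. Commuting past a lowering operator produces other
    matrix units, so the induction has to carry stability under all [E a b] at once; this is [Q]. *)
Lemma low_E a b u : lev a b -> low u -> low (E a b u).
Proof.
move=> lab lu; pose Q u := low u /\ forall a b, lev a b -> low (E a b u).
have Q0 : Q 0 by split=> [|c d _]; rewrite ?linear0; exact: low0.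
have Qlin k u1 u2 : Q u1 -> Q u2 -> Q (k *: u1 + u2).
  move=> [l1 h1] [l2 h2]; split; first exact: low_lin.
  by move=> c d lcd; rewrite linearP; apply: low_lin; [exact: h1|exact: h2].
have [] := lu (Submod Q0 Qlin); last by move=> _; exact.
  split; first exact: low_v.
  move=> c d lcd; have /and3P[c0 d0 _] := lcd.
  have [->|cd|dc] := lt_total lcd.
  - by rewrite wv //; apply: (@sm_scale _ _ lowm); exact: low_v.
  - by rewrite sv //; exact: low0.
  - by apply: low_lower => //; exact: levC.
move=> c d lcd cd u1 [lu1 h1]; split; first exact: low_lower.
move=> a1 b1 lab1; have /and3P[a0 b0 s1] := lab1; have /and3P[c0 d0 s2] := lcd.
rewrite Erel ?s1 //; apply: low_lin; first by apply: low_lower => //; exact: h1.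
apply: (@sm_add _ _ lowm).
  have [e|_] := eqVneq b1 d; last by rewrite scale0r; exact: low0.
  apply: (@sm_scale _ _ lowm); apply: h1; subst b1.
  by apply/and3P; split; rewrite // (eqP s1) eq_sym.
rewrite -scaleNr; have [e|_] := eqVneq c a1; last by rewrite mulr0 oppr0 scale0r; exact: low0.
apply: (@sm_scale _ _ lowm); apply: h1; subst a1.
by apply/and3P; split; rewrite // -(eqP s2).
Qed.

Definition wsum (ps : seq (int * int)) : int -> F :=
  fun c => w c + \sum_(p <- ps) ((c == p.2)%:R - (c == p.1)%:R).

Definition raising (ps : seq (int * int)) := all (fun p => lev p.1 p.2 && lt p.1 p.2) ps.

(** Lowering operators reach only combinations of weight vectors of weights [wsum ps], and by
    independence of characters no other weight occurs. The subtype removes 0, which is not an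
    index. *)
Lemma low_weights u (gam : int -> F) : low u -> u != 0 -> wt gam u ->
  exists2 ps, raising ps & forall c : int, c != 0 -> gam c = wsum ps c.
Proof.
move=> lu u0 wu.
pose A (i : {a : int | a != 0}) := E (val i) (val i).
pose res (f : int -> F) : {a : int | a != 0} -> F^o := fun i => f (val i).
have Awt f z : wt f z <-> eigen A (res f) z.
  by split=> [h [c c0]|h c c0]; [exact: h|exact: (h (exist _ c c0))].
have [f [ps rps ->] e] : exists2 f, exists2 ps, raising ps & f = wsum ps & res gam = res f.
  apply: (@eigen_gen_mem _ _ _ A
    (fun c => exists2 f, exists2 ps, raising ps & f = wsum ps & c = res f) (res gam) u) => //.
    exact/Awt.
  pose P z := exists2 c, (exists2 f, exists2 ps, raising ps & f = wsum ps & c = res f)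
                       & eigen A c z.
  apply: (lu (genm P)).
    apply: gen_sub; exists (res w); last exact/Awt.
    exists w => //; exists [::] => //.
    by apply/funext => c; rewrite /wsum big_nil addr0.
  move=> a b lab ab z gz; have /and3P[a0 b0 _] := lab.
  apply: (gz (smpre (E b a) (genm P))) => z1 [c [f [ps rps fE] ->] /Awt hz] /=.
  apply: gen_sub; exists (res (wshift f b a)); last by apply/Awt; exact: wt_E.
  exists (wshift f b a) => //; exists ((a, b) :: ps); first by rewrite /raising /= lab ab.
  apply/funext => c1; rewrite /wshift fE /wsum big_cons /=.
  by rewrite -!addrA; congr (_ + _); rewrite addrC -addrA.
exists ps => // c c0; have := congr1 (fun f => f (exist _ c c0)) e.
by rewrite /res.
Qed.

(* Lowering operators move weight towards the end of the order, so the sum of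
   the coefficients over a final segment [K] can only increase from [w], and over
   an initial segment only decrease; all of [K] but [s] is already settled. *)
Lemma low_segment (up : bool) u (gam : int -> F) (K : pred int) s :
  low u -> u != 0 -> wt gam u -> (forall c, K c -> c != 0) ->
  (forall a b, lev a b -> lt a b -> if up then K a -> K b else K b -> K a) -> K s ->
  (forall c, K c -> c != s -> gam c = w c) ->
  exists n : nat, gam s = w s + (if up then n%:R else - n%:R).
Proof.
move=> lu u0 wu K0 Kup Ks Keq; have [ps rps gE] := low_weights lu u0 wu.
(* [K] may be infinite; only the finitely many of its members that occur in [ps], together with [s],
   matter for the sum. *)
pose K0s := undup [seq c <- s :: map fst ps ++ map snd ps | K c].
have uK : uniq K0s by exact: undup_uniq.
have memK p : p \in ps -> (p.1 \in K0s) = K p.1 /\ (p.2 \in K0s) = K p.2.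
  move=> pps; rewrite !mem_undup !mem_filter !inE !mem_cat.
  by rewrite !map_f ?orbT ?andbT.
have sK : s \in K0s by rewrite mem_undup mem_filter Ks inE eqxx.
have : \sum_(c <- K0s) (gam c - w c) = \sum_(p <- ps) ((K p.2)%:R - (K p.1)%:R).
  rewrite big_seq (eq_bigr (fun c => \sum_(p <- ps) ((c == p.2)%:R - (c == p.1)%:R))); last first.
    move=> c; rewrite mem_undup mem_filter => /andP[/K0 c0 _].
    by rewrite gE // /wsum addrC addKr.
  rewrite -big_seq exchange_big /= big_seq [RHS]big_seq; apply: eq_bigr => p /memK[<- <-].
  have cnt z : \sum_(c <- K0s) (c == z)%:R = (z \in K0s)%:R :> F.
    rewrite -natr_sum; congr (_%:R); rewrite -(count_uniq_mem z uK) -sum1_count.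
    by rewrite [RHS]big_mkcond /=; apply: eq_bigr => c _; case: eqP.
  by rewrite sumrB !cnt.
rewrite (bigD1_seq s) //= big_seq_cond big1 ?addr0; last first.
  move=> c /andP[]; rewrite mem_undup mem_filter => /andP[Kc _] cs.
  by rewrite Keq // subrr.
move=> e; exists (\sum_(p <- ps) if up then K p.2 - K p.1 else K p.1 - K p.2)%N.
apply/eqP; rewrite addrC -subr_eq e natr_sum; apply/eqP.
rewrite [RHS](_ : _ = \sum_(p <- ps) if up then (K p.2 - K p.1)%:R else - (K p.1 - K p.2)%:R).
  rewrite big_seq [RHS]big_seq; apply: eq_bigr => p pps.
  have /andP[lp ltp] := allP rps _ pps; have := Kup _ _ lp ltp.
  by case: up {Kup}; case: (K p.1); case: (K p.2) => //= h;
    rewrite ?subrr ?subr0 ?sub0r ?oppr0 //; have := h isT.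
by case: up {Kup} => //; rewrite sumrN.
Qed.

End Generation.
End Reflections.

(** * Singular vectors of an irreducible Levi component under a change of order *)

Section Movement.
Variables (F : numFieldType) (V : lmodType F) (E : int -> int -> {linear V -> V}).
Hypothesis Erel : gl_rel E.
Variables (W : submod V).
Hypothesis Wst : forall a b, lev a b -> stable W (E a b).
Hypothesis Wirr : forall U : submod V, (forall a b, lev a b -> stable U (E a b)) ->
  U `<=` W -> (forall v, U v -> v = 0) \/ W `<=` U.

Definition sing (lt : rel int) (v : V) :=
  forall a b, lev a b -> lt a b -> E a b v = 0.

Definition levtotal (lt : rel int) :=
  forall a b, lev a b -> [\/ a = b, lt a b | lt b a].

Lemma irr_low lt v w : levtotal lt -> wt E w v -> sing lt v -> W v -> v != 0 ->
  forall u, W u -> low E lt v u.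
Proof.
move=> tot wv sv Wv v0; have [||h|//] := @Wirr (lowm E lt v).
- by move=> a b lab u lu; exact: (low_E Erel tot wv sv lab lu).
- by move=> u /(_ W Wv); apply => a b /levC lab _; exact: Wst.
- by move/eqP: v0; case; apply: h; exact: low_v.
Qed.

(* Otherwise [v] would be obtained from [v1] by lowering operators, which cannot
   raise the weight. *)
Lemma sing_zero lt v w v1 w1 x y (k : nat) : levtotal lt ->
  (forall a, ~~ lt a a) -> (forall a b c, lt a b -> lt b c -> lt a c) ->
  lev x y -> x != y -> lt x y -> (0 < k)%N -> wt E w v -> W v -> v != 0 ->
  wt E w1 v1 -> W v1 -> sing lt v1 -> w1 =1 wpow x y w k -> v1 = 0.
Proof.
move=> tot irr tr lxy nxy xy k0 wv Wv v0 wv1 Wv1 sv1 w1E.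
apply/eqP; apply: contrapT => /negP v10.
have /and3P[x0 y0 sxy] := lxy.
have [||||n] := @low_segment _ _ _ Erel lt v1 w1 wv1 true v w
    (fun c => [&& c != 0, (c < 0) == (x < 0) & lt x c]) y
    (irr_low tot wv1 sv1 Wv1 v10 Wv) v0 wv.
- by move=> c /and3P[].
- move=> a b /and3P[a0 b0 sab] ab /and3P[_ sax xa]; rewrite b0 (tr _ _ _ xa ab) andbT.
  by rewrite -(eqP sab).
- by rewrite y0 xy eq_sym sxy.
- move=> c /and3P[c0 _ xc] cy; rewrite w1E /wpow (negPf cy) (_ : c == x = false).
    by rewrite subrr mulr0 addr0.
  by apply/negbTE/eqP => e; move: xc; rewrite e (negPf (irr x)).
rewrite w1E /wpow eqxx [y == x]eq_sym (negPf nxy) subr0 mulr1 -addrA => /eqP.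
by rewrite -subr_eq0 opprD addNKr oppr_eq0 -natrD pnatr_eq0 addn_eq0 eqn0Ngt k0.
Qed.

Section Swap.
Variables (lt lt' : rel int) (x y : int).
Hypotheses (lxy : lev x y) (nxy : x != y) (xy : lt x y).
Hypotheses (tot : levtotal lt) (irr : forall a, ~~ lt a a)
  (tr : forall a b c, lt a b -> lt b c -> lt a c).
Hypothesis adj1 : forall a, lt a y -> a != x -> lt a x.
Hypothesis adj2 : forall b, lt x b -> b != y -> lt y b.
Hypothesis swap : forall a b, lt' a b ->
  (lt a b /\ ~~ ((a == x) && (b == y))) \/ (a = y /\ b = x).

Lemma levT a b c : lev a b -> lev b c -> lev a c.
Proof.
by move=> /and3P[a0 b0 /eqP ab] /and3P[_ c0 bc]; apply/and3P; split; rewrite // ab.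
Qed.

(** If [w x + w y] is nonzero, [E x y] recovers [v] from [E y x v], which is therefore the new
    singular vector. Otherwise [E y x v] is singular for the old order with a lower weight, hence
    zero, and [v] itself remains singular. *)
Lemma odd_swap v w : par x != par y -> wt E w v -> W v -> v != 0 -> sing lt v ->
  exists v', [/\ W v', v' != 0, sing lt' v' &
    wt E (if w x + w y == 0 then w else wshift w y x) v'].
Proof.
move=> pxy wv Wv v0 sv; have /and3P[x0 y0 sxy] := lxy.
have other a b : lev a b -> lt a b -> ~~ ((a == x) && (b == y)) ->
    E a b (E y x v) = 0.
  move=> lab ab nab; have /and3P[a0 b0 sab] := lab; apply: refl_other => //.
  - exact: sv.
  - move=> e; subst b; apply: sv; first exact: levT lab (levC lxy).
    by apply: adj1 => //; move: nab; rewrite eqxx andbT.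
  - move=> e; subst a; apply: sv; first exact: levT (levC lxy) lab.
    by apply: adj2 => //; move: nab; rewrite eqxx.
have Exy : E x y (E y x v) = (w x + w y) *: v by apply: odd_refl_xy => //; exact: sv.
case: eqVneq => [e|ne].
  exists v; split=> // a b lab /swap[[ab _]|[-> ->]]; first exact: sv.
  apply: (@sing_zero lt v w _ (wshift w y x) x y 1) => //.
  - exact: wt_E.
  - exact: (Wst (levC lxy)).
  - move=> c d lcd cd; case: (boolP ((c == x) && (d == y))); last exact: other.
    by move=> /andP[/eqP -> /eqP ->]; rewrite Exy e scale0r.
  - by move=> c; rewrite /wshift /wpow mul1r addrA.
exists (E y x v); split.
- exact: (Wst (levC lxy)).
- apply/eqP => e; move: Exy; rewrite e linear0 => /esym/eqP.
  by rewrite scaler_eq0 (negPf ne) (negPf v0).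
- move=> a b lab /swap[[ab nab]|[-> ->]]; first exact: other.
  exact: odd_refl_sq.
- exact: wt_E.
Qed.

(** The new singular vector is the lower end of the sl2-string of length [n]: one step further the
    vector would be singular for the old order with a lower weight, hence it is zero. *)
Lemma even_swap v w n : par x = par y -> wt E w v -> W v -> v != 0 -> sing lt v ->
  w x - w y = n%:R ->
  exists v', [/\ W v', v' != 0, sing lt' v' & wt E (wpow x y w n) v'].
Proof.
move=> pxy wv Wv v0 sv wn; have /and3P[x0 y0 sxy] := lxy.
have other k a b : lev a b -> lt a b -> ~~ ((a == x) && (b == y)) ->
    E a b (iter k (E y x) v) = 0.
  move=> lab ab nab; pose P a b := [/\ lev a b, lt a b & ~~ ((a == x) && (b == y))].
  have h := @even_refl_other _ _ _ Erel x y lxy P v k; apply: h => //.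
  - by move=> c d [lcd cd _]; have /and3P[c0 d0 _] := lcd; split=> //; exact: sv.
  - move=> c [lcy cy nc]; split; first exact: levT lcy (levC lxy).
      by apply: adj1 => //; move: nc; rewrite eqxx andbT.
    by rewrite [x == y](negPf nxy) andbF.
  - move=> d [lxd xd nd]; split; first exact: levT (levC lxy) lxd.
      by apply: adj2 => //; move: nd; rewrite eqxx.
    by rewrite [y == x]eq_sym (negPf nxy).
have Witer k : W (iter k (E y x) v) by elim: k => //= k; exact: (Wst (levC lxy)).
have Exy : E x y v = 0 by exact: sv.
have z : iter n.+1 (E y x) v = 0.
  apply: (@sing_zero lt v w _ (wpow x y w n.+1) x y n.+1) => //.
  - exact: wt_pow.
  - move=> c d lcd cd; case: (boolP ((c == x) && (d == y))); last exact: other.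
    move=> /andP[/eqP -> /eqP ->]; rewrite (even_refl_xy Erel lxy pxy nxy n wv) //.
    by rewrite wn subrr mulr0 scale0r.
exists (iter n (E y x) v); split => //.
- exact: (even_refl_neq0 Erel lxy pxy nxy wv Exy).
- move=> a b lab /swap[[ab nab]|[-> ->]]; first exact: other.
  exact: z.
- exact: wt_pow.
Qed.

End Swap.

(* The index [idx s] is moved away from 0, past [idx (s + 1), idx (s + 2), ...]:
   [key t] induces the order where it comes right after [idx t] in absolute value. *)
Section March.
Variables (up : bool) (s : nat) (x : nat -> nat).
Hypothesis s0 : (0 < s)%N.
Hypothesis x1 : forall j, (0 < j)%N -> x j = 0%N -> x j.+1 = 0%N.
Hypothesis x2 : forall j, (0 < j)%N -> (x j.+2 <= (x j).-1)%N.

Definition idx (u : nat) : int := if up then u%:Z else - u%:Z.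
Definition key (t : nat) (c : int) : int :=
  if c == idx s then (if up then (t.*2.+1)%:Z else - (t.*2.+1)%:Z) else 2 * c.
Definition klt (t : nat) : rel int := fun a b => key t a < key t b.
Definition sgx (n : nat) : F := if up then n%:R else - n%:R.

(** In absolute value, the coefficient at [idx s] loses one unit in an odd reflection (if it is not
    0) and in the following even reflection is exchanged with that of the index passed. Hence the
    two cases by the parity of [t - s]. *)
Definition state (t : nat) := exists (v : V) (w : int -> F),
  [/\ [/\ W v, v != 0 & wt E w v], sing (klt t) v,
      forall u, (t < u)%N -> w (idx u) = sgx (x u)
    & w (idx s) = sgx (if odd (t - s) then (x t.-1).-1 else x t)].

Lemma klt_total t : levtotal (klt t).
Proof.
move=> a b _; have [->|ab] := eqVneq a b; first by constructor 1.
suff: klt t a b || klt t b a by case/orP => h; [constructor 2|constructor 3].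
move: ab; rewrite /klt /key /idx; case: up.
  by case: (a =P s%:Z); case: (b =P s%:Z); lia.
by case: (a =P - s%:Z); case: (b =P - s%:Z); lia.
Qed.

Lemma klt_irr t a : ~~ klt t a a.
Proof. by rewrite /klt ltxx. Qed.

Lemma klt_tr t a b c : klt t a b -> klt t b c -> klt t a c.
Proof. exact: lt_trans. Qed.

Lemma klt_std a b : klt s a b = (a < b).
Proof.
rewrite /klt /key /idx; case: up.
  by case: (a =P s%:Z); case: (b =P s%:Z); lia.
by case: (a =P - s%:Z); case: (b =P - s%:Z); lia.
Qed.

Definition px t := if up then idx s else idx t.+1.
Definition py t := if up then idx t.+1 else idx s.

Lemma klt_adj1 t a : (s <= t)%N -> klt t a (py t) -> a != px t -> klt t a (px t).
Proof.
rewrite /klt /key /px /py /idx; case: up.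
  by case: (a =P s%:Z); repeat case: eqP; lia.
by case: (a =P - s%:Z); repeat case: eqP; lia.
Qed.

Lemma klt_adj2 t b : (s <= t)%N -> klt t (px t) b -> b != py t -> klt t (py t) b.
Proof.
rewrite /klt /key /px /py /idx; case: up.
  by case: (b =P s%:Z); repeat case: eqP; lia.
by case: (b =P - s%:Z); repeat case: eqP; lia.
Qed.

Lemma klt_swap t a b : (s <= t)%N -> klt t.+1 a b ->
  (klt t a b /\ ~~ ((a == px t) && (b == py t))) \/ (a = py t /\ b = px t).
Proof.
move=> st h; have [/andP[/eqP -> /eqP ->]|nab] := boolP ((a == py t) && (b == px t)).
  by right.
left; move: h nab; rewrite /klt /key /px /py /idx; case: up.
  by case: (a =P s%:Z); case: (b =P s%:Z); repeat case: eqP; lia.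
by case: (a =P - s%:Z); case: (b =P - s%:Z); repeat case: eqP; lia.
Qed.

Lemma px_py t : (s <= t)%N -> [/\ lev (px t) (py t), px t != py t & klt t (px t) (py t)].
Proof.
move=> st; rewrite /lev /klt /key /px /py /idx.
by case: up; split; repeat case: eqP; lia.
Qed.

Lemma idx_inj : injective idx.
Proof. by move=> u v; rewrite /idx; case: up; lia. Qed.

Lemma par_idx u : par (idx u) = odd u.
Proof. by rewrite /idx /par; case: up; rewrite ?abszN absz_nat. Qed.

Lemma sgx0 n : (sgx n == 0) = (n == 0%N).
Proof. by rewrite /sgx; case: up; rewrite ?oppr_eq0 pnatr_eq0. Qed.

Lemma sgxD m n : sgx m + sgx n = sgx (m + n).
Proof. by rewrite /sgx; case: up; rewrite natrD ?opprD. Qed.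

(** For an even reflection [x2] makes the difference of the two coefficients a natural number, as
    [even_swap] requires. For an odd one, [x1] shows that the sum vanishes exactly when the
    coefficient of [idx s] does, and then the weight does not change. *)
Lemma march t : (s <= t)%N -> state t -> state t.+1.
Proof.
move=> st [v [w [[Wv v0 wv] sv wgt ws]]].
have [lxy nxy xy] := px_py st.
have t0 : (0 < t)%N by exact: leq_trans st.
have wt1 : w (idx t.+1) = sgx (x t.+1) by apply: wgt.
rewrite /state subSn //= in ws *.
have nst u : (t < u)%N -> (idx u == idx s) = false.
  by move=> tu; apply/negbTE/eqP => /idx_inj e; rewrite e ltnNge st in tu.
have ntu u : (t.+1 < u)%N -> (idx u == idx t.+1) = false.
  by move=> tu; apply/negbTE/eqP => /idx_inj e; rewrite e ltnn in tu.
have par_ts : odd t = odd (t - s) (+) odd s by rewrite -oddD subnK.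
case: ifPn ws => oddts ws.
- have pe : par (px t) = par (py t).
    rewrite /px /py; case: {+}up; rewrite !par_idx /= par_ts oddts; by case: (odd s).
  have ts : (s < t)%N by rewrite ltn_neqAle st andbT; apply/eqP => e; move: oddts; rewrite e subnn.
  have t1 : (0 < t.-1)%N by lia.
  have xle : (x t.+1 <= (x t.-1).-1)%N by have := x2 t1; rewrite prednK.
  have wn : w (px t) - w (py t) = ((x t.-1).-1 - x t.+1)%:R.
    rewrite natrB //; move: wt1 ws; rewrite /px /py /sgx.
    by case: {+}up => -> ->; rewrite // opprK addrC.
  have [v' [Wv' v'0 sv' wv']] := even_swap lxy nxy xy (@klt_total t) (@klt_irr t)
    (@klt_tr t) (fun a => @klt_adj1 t a st) (fun b => @klt_adj2 t b st)
    (fun a b => @klt_swap t a b st) pe wv Wv v0 sv wn.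
  exists v', (wpow (px t) (py t) w ((x t.-1).-1 - x t.+1)); split => //.
  + move=> u tu; rewrite -wgt ?(ltnW tu) // /wpow /px /py.
    by case: {+}up; rewrite nst ?ntu ?(ltnW tu) // subrr mulr0 addr0.
  + move: wn; rewrite /wpow -wt1 /px /py; case: {+}up => <-.
      by rewrite eqxx [idx s == _]eq_sym nst // sub0r mulrN1 opprB addrC subrK.
    by rewrite eqxx [idx s == _]eq_sym nst // subr0 mulr1 addrC subrK.
- have pe : par (px t) != par (py t).
    rewrite /px /py; case: {+}up; rewrite !par_idx /= par_ts (negPf oddts);
      by case: (odd s).
  have wxy : w (px t) + w (py t) = sgx (x t + x t.+1).
    by rewrite -sgxD -ws -wt1 /px /py; case: {+}up; rewrite // addrC.
  have [v' [Wv' v'0 sv' wv']] := odd_swap lxy nxy xy (@klt_total t) (@klt_irr t)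
    (@klt_tr t) (fun a => @klt_adj1 t a st) (fun b => @klt_adj2 t b st)
    (fun a b => @klt_swap t a b st) pe wv Wv v0 sv.
  move: wv'; rewrite wxy sgx0 addn_eq0.
  have [xt0|xt0] /= := eqVneq (x t) 0%N.
    rewrite (x1 t0 xt0) eqxx => wv'; exists v', w; split=> //; last by rewrite ws xt0.
    by move=> u tu; apply: wgt; exact: ltnW.
  move=> wv'; exists v', (wshift w (py t) (px t)); split=> //.
    move=> u tu; rewrite -wgt ?(ltnW tu) // /wshift /px /py.
    by case: {+}up; rewrite nst ?ntu ?(ltnW tu) // subr0 addr0.
  have xt : x t = (x t).-1.+1 by rewrite prednK // lt0n.
  rewrite /wshift ws /px /py /sgx; case: {+}up.
    by rewrite eqxx [idx s == _]eq_sym nst // {1}xt addr0 -natrB // subn1.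
  by rewrite eqxx [idx s == _]eq_sym nst // {1}xt subr0 -natr1 opprD subrK.
Qed.

Lemma march_to t : (s <= t)%N -> state s -> state t.
Proof.
move=> st h; rewrite -(subnK st); elim: (t - s)%N => [//|d ih].
by rewrite addSn; apply: march => //; exact: leq_addl.
Qed.

(* For [t] large, [idx s] is extremal among the indices that matter for [gam], so
   [low_segment] compares [gam (idx s)] with the singular weight of [state t]. *)
Lemma march_weight N u gam : state s -> (forall j, (N < j)%N -> x j = 0%N) ->
  W u -> u != 0 -> wt E gam u -> (forall j, (N < j)%N -> gam (idx j) = 0) ->
  exists n : nat, gam (idx s) = sgx n.
Proof.
move=> h xN Wu u0 wu gN; pose t := maxn N s.
have [v [w [[Wv v0 wv] sv wgt ws]]] := march_to (leq_maxr N s) h.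
have st : (s <= t)%N by exact: leq_maxr.
pose K (c : int) := (c == idx s) || (if up then t%:Z < c else c < - t%:Z).
have Kidx c : K c -> c != idx s -> exists2 j, (t < j)%N & c = idx j.
  rewrite /K => /orP[/eqP ->|]; first by rewrite eqxx.
  by rewrite /idx; case: {+}up => tc _; exists `|c|%N; lia.
have [||||n gE] := @low_segment _ _ _ Erel (klt t) v w wv up u gam K (idx s)
    (irr_low (@klt_total t) wv sv Wv v0 Wu) u0 wu.
- by move=> c; rewrite /K /idx; case: {+}up; move=> /orP[/eqP ->|]; lia.
- move=> a b lab; rewrite /klt /key /K /idx; move: lab; rewrite /lev.
  by case: {+}up; repeat case: eqP; lia.
- by rewrite /K eqxx.
- move=> c /Kidx h' /h'[j tj ->]; have Nj : (N < j)%N by rewrite (leq_ltn_trans _ tj) // leq_maxl.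
  by rewrite gN // wgt // xN // /sgx; case: up; rewrite ?oppr0.
rewrite gE ws /sgx; set y := if odd _ then _ else _.
by exists (y + n)%N; rewrite natrD; case: up; rewrite // opprD.
Qed.

End March.
End Movement.

(** * Partitions and the coefficients of the highest weights of the big category *)

Section Partitions.

Lemma conj_part_seq (s : seq nat) i j : sorted geq s -> (0 < j)%N ->
  (i < count (leq j) s)%N = (j <= nth 0%N s i)%N.
Proof.
move=> ss j0; elim: s i ss => [|k s ih] i /=.
  by rewrite nth_nil [RHS]leqNgt j0.
move=> ks; have ss := path_sorted ks.
have all_k : all (fun a => a <= k)%N s.
  by apply: (order_path_min _ ks) => a b c /= ab bc; exact: leq_trans bc ab.
have [jk|kj] := leqP j k; first by case: i => [|i] //=; rewrite add1n ltnS ih.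
have -> : count (leq j) s = 0%N.
  apply/eqP; rewrite -leqn0 leqNgt -has_count -all_predC; apply/allP => a /(allP all_k) /= ak.
  by rewrite -ltnNge (leq_ltn_trans ak).
case: i => [|i] /=; rewrite ?addn0 ltn0 [RHS]leqNgt ?kj //.
have [si|si] := ltnP i (size s); last by rewrite nth_default ?j0.
by rewrite (leq_ltn_trans (allP all_k _ (mem_nth 0%N si)) kj).
Qed.

Variable nu : intpart.

Lemma nu_sorted : sorted geq nu.
Proof. by case: nu => s /= /andP[]. Qed.

Lemma conj_part i j : (0 < i)%N -> (0 < j)%N -> (i <= conjpart nu j)%N = (j <= part nu i)%N.
Proof.
by move=> i0 j0; rewrite -{1}(prednK i0) /part -conj_part_seq //; exact: nu_sorted.
Qed.

Lemma conj_le i j : (i <= j)%N -> (conjpart nu j <= conjpart nu i)%N.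
Proof. by move=> ij; apply: sub_count => a /= ja; exact: leq_trans ij ja. Qed.

Lemma part_le i j : (0 < i)%N -> (i <= j)%N -> (part nu j <= part nu i)%N.
Proof.
move=> i0 ij; case e : (part nu j) => [//|k]; rewrite -e -conj_part //; last by rewrite e.
by apply: (leq_trans ij); rewrite conj_part ?e //; exact: leq_trans ij.
Qed.

Lemma theta_odd i : theta nu i.*2.+1 = (conjpart nu i.+1 - i)%N.
Proof. by rewrite /theta /= odd_double /= doubleK subSS. Qed.

Lemma theta_even i : theta nu i.*2 = (part nu i - i)%N.
Proof. by rewrite /theta odd_double uphalf_double. Qed.

(** [theta nu j] vanishes when a certain cell, on the diagonal or just to the right of it, is absent
    from the diagram. These cells alternate along a staircase, and absence passes to the next
    one. *)
Lemma theta_next j : (0 < j)%N -> theta nu j = 0%N -> theta nu j.+1 = 0%N.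
Proof.
rewrite -[j]odd_double_half; case: (odd j) => /=.
  rewrite add1n -doubleS theta_odd theta_even => _ /eqP.
  by rewrite subn_eq0 leqNgt conj_part // -leqNgt => h; apply/eqP; rewrite subn_eq0 ltnW.
rewrite add0n theta_odd theta_even double_gt0 => i0 /eqP.
by rewrite subn_eq0 leqNgt -conj_part // -ltnNge => h; apply/eqP; rewrite subn_eq0 ltnW.
Qed.

Lemma theta_next2 j : (0 < j)%N -> (theta nu j.+2 <= (theta nu j).-1)%N.
Proof.
move=> j0; rewrite /theta /= negbK.
have i0 : (0 < uphalf j)%N by case: (j) j0.
case: ifP => _.
  by rewrite -subnS leq_sub2r // !ltnS; apply: conj_le; exact: leqnSn.
by rewrite -subnS leq_sub2r //; exact: part_le.
Qed.

Lemma theta_large j : ((size nu).*2 < j)%N -> theta nu j = 0%N.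
Proof.
move=> nj; have h : (size nu < uphalf j)%N.
  by rewrite -(uphalf_double (size nu)); lia.
rewrite /theta; case: ifP => _; apply/eqP; rewrite subn_eq0.
  by apply: leq_ltn_trans h; rewrite /conjpart count_size.
by rewrite /part nth_default //; case: (uphalf j) h.
Qed.

End Partitions.

Section ExtDecomposition.
Variables (F : fieldType) (S : set int).

Lemma ext_decomp (x : ext F) : gS S x -> exists s : seq (int * int),
  (forall p, p \in s -> [/\ S p.1, S p.2 & x.1 p.1 p.2 != 0]) /\
  x = x.2 *: Kext F + \sum_(p <- s) x.1 p.1 p.2 *: Eext F p.1 p.2.
Proof.
move=> [/finite_seqP[s0 s0E] Sx]; pose s := undup s0.
have us : uniq s by exact: undup_uniq.
have ms p : (p \in s) = (x.1 p.1 p.2 != 0).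
  rewrite mem_undup; have e : (x.1 p.1 p.2 != 0) <-> p \in s0.
    by rewrite -[X in X <-> _]/([set ij : int * int | x.1 ij.1 ij.2 != 0] p) s0E.
  by apply/idP/idP => /e.
exists s; split; first by move=> p; rewrite ms => /[dup] /Sx[].
have ent (f : int * int -> ext F) (r : seq (int * int)) a b :
    (\sum_(p <- r) f p).1 a b = \sum_(p <- r) (f p).1 a b.
  elim: r => [|p r ih]; first by rewrite !big_nil.
  by rewrite !big_cons -[f p]scale1r ext_linE ih mul1r scale1r.
have K2 (f : int * int -> ext F) (r : seq (int * int)) :
    (\sum_(p <- r) f p).2 = \sum_(p <- r) (f p).2.
  by elim: r => [|p r ih]; rewrite ?big_nil // !big_cons /= ih.
apply: injective_projections; last first.
  rewrite -[RHS]/((x.2 *: Kext F).2 + (\sum_(p <- s) x.1 p.1 p.2 *: Eext F p.1 p.2).2).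
  by rewrite K2 big1 ?addr0 => [|p _]; rewrite /= ?scaler0 // [RHS]mulr1.
apply/funext => a; apply/funext => b; rewrite ext_linE ent /= mulr0 add0r.
rewrite (eq_bigr (fun p => x.1 p.1 p.2 * Emx F p.1 p.2 a b)) //.
have [xab|xab] := boolP ((a, b) \in s).
  rewrite (bigD1_seq (a, b)) //= /Emx !eqxx mulr1 big1 ?addr0 // => -[c d] /= ne.
  by move: ne; rewrite xpair_eqE /Emx [a == c]eq_sym [b == d]eq_sym => /negPf ->; rewrite mulr0.
have := xab; rewrite ms negbK => /eqP ->; rewrite big_seq big1 // => -[c d] /= cds.
rewrite /Emx; case: eqP => [ac|]; case: eqP => [bd|]; rewrite ?mulr0 //.
by rewrite ac bd cds in xab.
Qed.

End ExtDecomposition.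

(** * Signs of the weights in the big category *)

Section WeightSigns.
Variables (F : numFieldType) (M : gmod F setIt).
Local Notation E := (fun a b => rho M (Eext F a b)).

Lemma rho_gl : gl_rel E.
Proof. by move=> a b c d v a0 b0 c0 d0 s; apply: rho_EE. Qed.

Lemma rho_decomp (W : submod M) (x : ext F) : gS setIt x ->
  stable W (rho M (Kext F)) ->
  (forall a b, a != 0 -> b != 0 -> x.1 a b != 0 -> stable W (E a b)) -> stable W (rho M x).
Proof.
move=> Sx WK WE v Wv; have [s [sP ->]] := ext_decomp Sx.
have S_ p : p \in s -> gS setIt (x.1 p.1 p.2 *: Eext F p.1 p.2).
  by move=> /sP[S1 S2 _]; apply: gS_scale; exact: gSE.
rewrite rhoD; [|exact/gS_scale/gSK|by rewrite big_seq; exact: gS_sum].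
rewrite rhoZ; last exact: gSK.
apply: sm_add; first by apply: sm_scale; exact: WK.
rewrite big_seq rho_sum //; apply: sm_sum => p ps; have [S1 S2 ne] := sP _ ps.
by rewrite rhoZ; [apply: sm_scale; exact: (WE p.1 p.2) | exact: gSE].
Qed.

Lemma pos_neg (a b : int) : a != 0 -> b != 0 -> ((0 < a) == (0 < b)) = ((a < 0) == (b < 0)).
Proof. by lia. Qed.

Lemma levi_E a b : lev a b -> levi setIt (Eext F a b).
Proof.
move=> /and3P[a0 b0 ab]; split; first exact: gSE.
by move=> i j /Emx_neq0[-> ->]; apply/eqP; rewrite pos_neg.
Qed.

Lemma levi_K : levi setIt (Kext F).
Proof. by split; [exact: gSK | move=> i j /=; rewrite eqxx]. Qed.

Section Component.
Variables (W : submod M) (lp lm : intpart) (d : F).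
Hypotheses (Wirr : levi_irreducible W)
  (Whw : levi_highest_weight lt_std W (wtilde lp lm d)).

Lemma W_E a b : lev a b -> stable W (E a b).
Proof. by case: Wirr => st _ _ /levi_E; exact: st. Qed.

Lemma W_K u : W u -> rho M (Kext F) u = d *: u.
Proof.
move=> Wu; have [v [[Wv v0] [Kv _] _ gen_v]] := Whw.
have [U UE] : exists U : submod M, forall v, U v <-> (W v /\ rho M (Kext F) v = d *: v).
  unshelve eexists (@Submod F M (fun v => W v /\ rho M (Kext F) v = d *: v) _ _) => //.
    by split; [exact: sm_zero | rewrite linear0 scaler0].
  move=> a u1 u2 [W1 h1] [W2 h2]; split; first exact: sm_lin.
  by rewrite linearP h1 h2 scalerDr !scalerA mulrC.
suff /UE[] : U u by [].
apply: (gen_v U _ _ u Wu); last by apply/UE.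
move=> x [Sx lx]; apply: rho_decomp => //.
  move=> u1 /UE[W1 h1]; apply/UE; rewrite h1; split; first exact: sm_scale.
  by rewrite linearZ /= h1.
move=> a b a0 b0 xab u1 /UE[W1 h1]; apply/UE; split.
  by apply: W_E => //; apply/and3P; split; rewrite // -pos_neg //; apply/eqP/lx.
by rewrite (rhoKC _ (gSE F a0 b0) (homogE F a b)) h1 linearZ.
Qed.

Lemma W_irr (U : submod M) : (forall a b, lev a b -> stable U (E a b)) -> U `<=` W ->
  (forall v, U v -> v = 0) \/ W `<=` U.
Proof.
move=> Ust UW; case: Wirr => _ _ /(_ U); apply => // x [Sx lx].
apply: rho_decomp => //.
  by move=> u Uu; rewrite W_K; [exact: sm_scale | exact: UW].
move=> a b a0 b0 xab; apply: Ust; apply/and3P; split; rewrite // -pos_neg //.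
exact/eqP/lx.
Qed.

(** [march_weight] for [x = theta]. The bound [N] covers both the support of [g] and the indices
    where [theta] can be nonzero. *)
Lemma component_weight g u s (up : bool) : (0 < s)%N -> is_weight setIt g -> W u -> u != 0 ->
  wt_space g u -> exists n : nat, g.2 (idx up s) = sgx F up n.
Proof.
move=> s0 [/finite_seqP[gs gsE] _] Wu u0 [_ gu].
pose x := theta (if up then lp else lm).
pose N := maxn (\max_(a <- gs) `|a|%N) (size (if up then lp else lm)).*2.
apply: (@march_weight _ _ E rho_gl W W_E W_irr up s x s0 _ _ N u g.2) => //.
- by move=> j; exact: theta_next.
- by move=> j; exact: theta_next2.
- have [v [[Wv v0] [Kv vw] sv _]] := Whw.
  exists v, (wtilde lp lm d).2; split=> //.
  + move=> a b lab; rewrite klt_std // => ab; have /and3P[a0 b0 h] := lab.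
    by apply: sv => //; apply/eqP; rewrite pos_neg.
  + move=> j sj; rewrite /wtilde /mkweight /= /idx /sgx /x.
    case: up {N x}; first by rewrite (_ : 0 < j%:Z)%R ?absz_nat //; lia.
    rewrite (_ : (0 < - j%:Z)%R = false); last by lia.
    by rewrite (_ : (- j%:Z < 0)%R) ?abszN ?absz_nat //; lia.
  + rewrite subnn /= /wtilde /mkweight /= /idx /sgx /x.
    case: up {N x}; first by rewrite (_ : 0 < s%:Z)%R ?absz_nat //; lia.
    rewrite (_ : (0 < - s%:Z)%R = false); last by lia.
    by rewrite (_ : (- s%:Z < 0)%R) ?abszN ?absz_nat //; lia.
- by move=> j; rewrite gtn_max => /andP[_ h]; exact: theta_large.
- move=> j; rewrite gtn_max => /andP[h _]; apply/eqP; apply: contraTT h => gj.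
  have : [set` gs] (idx up j) by rewrite -gsE.
  rewrite -leqNgt => /= jgs; rewrite (leq_trans _ (leq_bigmax_seq _ jgs isT)) //.
  by rewrite /idx; case: (up); rewrite ?abszN absz_nat.
Qed.

End Component.

Lemma weight_sign (g : weight F) (v : M) (a : int) : inOtilde M -> is_weight setIt g -> wt_space g v -> v != 0 ->
  a != 0 -> exists n : nat, g.2 a = sgx F (0 < a) n.
Proof.
move=> [_ _ [J [W [[dec indep] Wj]]] _] wg [Kv gv] v0 a0.
have [s [w [Ww vE]]] := dec v.
(* The decomposition may list a summand several times; repetitions are collected before independence
   is used. *)
pose w' j := w j *+ count_mem j s.
have Ww' j : W j (w' j).
  by rewrite /w' -scaler_nat; exact: sm_scale.
have vE' : v = \sum_(j <- undup s) w' j.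
  by rewrite vE -big_undup_iterop_count //=; apply: eq_bigr => j _; rewrite Monoid.iteropE.
(* Operators that preserve every summand have the components of an eigenvector as eigenvectors, so a
   nonzero component of [v] has the weight of [v]. *)
have cmp (f : {linear M -> M}) (c : F) : (forall j, stable (W j) f) -> f v = c *: v ->
    forall j, j \in undup s -> f (w' j) = c *: w' j.
  move=> fW fv j js; apply/eqP; rewrite -subr_eq0; apply/eqP.
  apply: (indep (undup s) (fun j => f (w' j) - c *: w' j)) => //; first exact: undup_uniq.
    move=> k; rewrite -scaleNr addrC; apply: sm_lin => //; exact: fW.
  by rewrite sumrB -linear_sum -scaler_sumr -vE' fv subrr.
have [j js wj0] : exists2 j, j \in undup s & w' j != 0.
  apply: contrapT => h; move/eqP: v0; apply; rewrite vE' big_seq big1 // => j js.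
  by apply/eqP; apply: contrapT => /negP w0; apply: h; exists j.
have [irr [h [lp [lm [d hE]]] hw]] := Wj j; rewrite hE in hw.
have st k : stable (W k) (rho M (Kext F)).
  by have [[st _ _] _] := Wj k; apply: st; exact: levi_K.
have stE k b : b != 0 -> stable (W k) (rho M (Eext F b b)).
  by have [[st' _ _] _] := Wj k => b0; apply/st'/levi_E; rewrite /lev b0 eqxx.
have gw : wt_space g (w' j).
  split; first exact: (cmp _ _ st Kv).
  by move=> b b0; apply: (cmp _ _ (fun k => stE k b b0) (gv b b0)).
have s0 : (0 < `|a|)%N by rewrite absz_gt0.
have [n nE] := component_weight irr hw (0 < a) s0 wg (Ww' j) wj0 gw.
exists n; move: nE; rewrite /idx /sgx.
by case: ifPn => ha <-; congr (g.2 _); lia.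
Qed.

End WeightSigns.

(** * The Casimir operators *)

Section Omega.
Variables (R : realType) (l : nat).
Local Notation C := R[i].
Variables (S : set int) (M : 'I_l -> gmod C S).
Local Notation T := (tensM M).

Definition Eopl i a b : {linear T -> T} := tact M i (par a (+) par b) (iota_ext (Emx C a b)).

Lemma Et_Eop c d a b i (t : T) : S a -> S b -> S c -> S d ->
  Et M c d (Eopl i a b t) = sg C c d a b *: Eopl i a b (Et M c d t)
    + (((d == a)%:R : C) *: Eopl i c b t
       - (sg C c d a b * (b == c)%:R) *: Eopl i a d t).
Proof.
move=> Sa Sb Sc Sd; rewrite [LHS](tacts_tact i t (gSE C Sc Sd) (gS_iota C Sa Sb)
  (homogE C c d) (homog_iota C a b)).
congr (_ + _); rewrite extbr_iota tact_sub2; try exact: gS_iota.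
congr (_ - _).
  have [->|] := eqVneq d a; last by rewrite !scale0r.
  rewrite /Eopl (_ : (par c (+) par a) (+) _ = par c (+) par b) //.
  by case: (par a); case: (par b); case: (par c).
have [->|] := eqVneq b c; last by rewrite !mulr0 !scale0r.
rewrite /Eopl (_ : (par c (+) par d) (+) _ = par a (+) par d) //.
by case: (par a); case: (par c); case: (par d).
Qed.

Definition Om (A : seq int) (i j : 'I_l) (t : T) : T :=
  \sum_(a <- A) \sum_(b <- A) (-1) ^+ par b *: Eopl i a b (Eopl j b a t).

Lemma Om_linear A i j : linear (Om A i j).
Proof.
move=> k u v; rewrite /Om scaler_sumr -big_split; apply: eq_bigr => a _.
rewrite scaler_sumr -big_split; apply: eq_bigr => b _ /=.
by rewrite linearP linearP scalerDr !scalerA [k * _]mulrC.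
Qed.
HB.instance Definition _ A i j :=
  GRing.isLinear.Build C T T *:%R (Om A i j) (Om_linear A i j).

Lemma sum_delta (V : lmodType C) (A : seq int) (f : int -> V) d : uniq A -> d \in A ->
  \sum_(a <- A) ((d == a)%:R : C) *: f a = f d.
Proof.
move=> uA dA; rewrite (bigD1_seq d) //= eqxx scale1r big1 ?addr0 // => a.
by rewrite eq_sym => /negPf ->; rewrite scale0r.
Qed.

(** The sign bookkeeping of [Om_comm]: [e] is the sign for passing [E_{c,d}] through either factor,
    and it occurs twice in the main term. *)
Lemma commutator_comb (V : lmodType C) (s e p q r w : C) (y1 y2 y3 y4 y5 : V) : e * e = 1 ->
  s *: (e *: (e *: y1 + (p *: y2 - (e * q) *: y3)) + (r *: y4 - (e * w) *: y5)) =
  s *: y1 + (((s * r) *: y4 - (s * q) *: y3) + ((s * e * p) *: y2 - (s * e * w) *: y5)).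
Proof.
move=> ee; rewrite !(scalerDr, scalerN, scalerA) -!mulrA ee mulr1.
rewrite [e * (e * q)]mulrA ee mul1r -!addrA; congr (_ + _).
by rewrite [LHS]addrCA [RHS]addrCA; congr (_ + _); rewrite addrCA.
Qed.

(** The brackets with the two factors give four families of correction terms. Since [c] and [d] are
    both in [A], each Kronecker delta is met exactly once in the double sum, and the families cancel
    in pairs. *)
Lemma Om_comm (A : seq int) i j c d (t : T) : uniq A -> (forall a, a \in A -> S a) ->
  c \in A -> d \in A -> Et M c d (Om A i j t) = Om A i j (Et M c d t).
Proof.
move=> uA AS cA dA; have Sc := AS _ cA; have Sd := AS _ dA.
pose P b := (-1) ^+ par b *: Eopl i c b (Eopl j b d t).
pose k (z a : int) : C := (-1) ^+ par z * sg C c d a z.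
pose Q z a := k z a *: Eopl i a d (Eopl j c a t).
(* This equality of signs makes the two families [Q] cancel: replacing [c] by [d] changes the
   exponent of -1 by an even number. *)
have kE a : k c a = k d a.
  rewrite /k /sg; case: (par a); case: (par c); case: (par d);
  by rewrite ?(expr0, expr1, mulr1, mul1r, mulrN1, opprK).
transitivity (\sum_(a <- A) \sum_(b <- A)
  ((-1) ^+ par b *: Eopl i a b (Eopl j b a (Et M c d t))
   + ((((d == a)%:R : C) *: P b - ((c == a)%:R : C) *: P b)
   + (((d == b)%:R : C) *: Q d a - ((c == b)%:R : C) *: Q c a)))).
  rewrite /Om linear_sum big_seq [RHS]big_seq; apply: eq_bigr => a aA.
  rewrite linear_sum big_seq [RHS]big_seq; apply: eq_bigr => b bA.
  have Sa := AS _ aA; have Sb := AS _ bA.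
  have sgs : sg C c d b a = sg C c d a b by rewrite /sg [par b (+) par a]addbC.
  have -> : ((d == a)%:R : C) *: P b =
      ((-1) ^+ par b * (d == a)%:R) *: Eopl i c b (Eopl j b a t).
    rewrite /P; have [->|_] := eqVneq d a; last by rewrite mulr0 !scale0r.
    by rewrite mulr1 scale1r.
  have -> : ((c == a)%:R : C) *: P b =
      ((-1) ^+ par b * (a == c)%:R) *: Eopl i a b (Eopl j b d t).
    rewrite /P eq_sym; have [->|_] := eqVneq a c; last by rewrite mulr0 !scale0r.
    by rewrite mulr1 scale1r.
  have -> : ((d == b)%:R : C) *: Q d a =
      ((-1) ^+ par b * sg C c d a b * (d == b)%:R) *: Eopl i a b (Eopl j c a t).
    rewrite /Q /k; have [->|_] := eqVneq d b; last by rewrite mulr0 !scale0r.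
    by rewrite mulr1 scale1r.
  have -> : ((c == b)%:R : C) *: Q c a =
      ((-1) ^+ par b * sg C c d a b * (b == c)%:R) *: Eopl i a d (Eopl j b a t).
    rewrite /Q /k eq_sym; have [->|_] := eqVneq b c; last by rewrite mulr0 !scale0r.
    by rewrite mulr1 scale1r.
  rewrite [Et M c d (_ *: _)]linearZ Et_Eop // Et_Eop // sgs linearD linearB ![Eopl i a b (_ *: _)]linearZ.
  apply: commutator_comb; rewrite /sg -expr2 sqrr_sign //.
rewrite [X in _ = X]/Om.
rewrite (eq_bigr (fun a => \sum_(b <- A) (-1) ^+ par b *: Eopl i a b (Eopl j b a (Et M c d t))
   + (\sum_(b <- A) (((d == a)%:R : C) *: P b - ((c == a)%:R : C) *: P b)
     + \sum_(b <- A) (((d == b)%:R : C) *: Q d a - ((c == b)%:R : C) *: Q c a)))); last first.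
  by move=> a _; rewrite -!big_split.
rewrite !big_split /= -[RHS]addr0; congr (_ + _).
rewrite exchange_big /= [X in X + _]big1 ?[X in _ + X]big1 ?addr0 // => [a _|b _].
  rewrite sumrB (sum_delta (fun=> Q d a)) // (sum_delta (fun=> Q c a)) //.
  by rewrite /Q kE subrr.
by rewrite sumrB (sum_delta (fun=> P b)) // (sum_delta (fun=> P b)) // subrr.
Qed.

End Omega.

(** * Weights of the factors and of the tensor product *)

Section FactorWeights.
Variables (F : numFieldType) (M : gmod F setIt).
Hypothesis hM : inOtilde M.

Definition is_wvec (v : M) := exists2 g, is_weight setIt g & wt_space g v.

Lemma gen_wvec v : gen is_wvec v.
Proof. by case: hM => -[h _] _ _ _; have [s [-> sP]] := h v; apply: gen_seq => w /sP. Qed.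

(** Otherwise the image would have coefficient -1 at a positive index or +1 at a negative one,
    against [weight_sign]. *)
Lemma weight_E0 g v a b : is_weight setIt g -> wt_space g v -> a != 0 -> b != 0 -> a != b ->
  ((0 < b) && (g.2 b == 0)) || ((a < 0) && (g.2 a == 0)) -> rho M (Eext F a b) v = 0.
Proof.
move=> wg gv a0 b0 ab h; apply/eqP; apply: contrapT => /negP u0.
have wg' : is_weight setIt (g + eps F a - eps F b) by exact: is_weight_shift.
have gv' := wt_space_E a0 b0 gv.
have e c : (g + eps F a - eps F b).2 c = g.2 c + (c == a)%:R - (c == b)%:R by [].
case/orP: h => /andP[hb /eqP g0].
  have [n] := weight_sign hM wg' gv' u0 b0.
  rewrite e g0 eqxx [b == a]eq_sym (negPf ab) addr0 sub0r /sgx hb => /eqP.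
  by rewrite eq_sym -subr_eq0 opprK natr1 pnatr_eq0.
have [n] := weight_sign hM wg' gv' u0 a0.
rewrite e g0 eqxx (negPf ab) add0r subr0 /sgx ltNge ltW //= => /eqP.
by rewrite -subr_eq0 opprK nat1r pnatr_eq0.
Qed.

End FactorWeights.

Section TensorWeights.
Variables (R : realType) (l : nat).
Local Notation C := R[i].
Variables (M : 'I_l -> gmod C setIt).
Hypothesis hM : forall i, inOtilde (M i).
Local Notation T := (tensM M).
Local Notation Et := (Et M).

Lemma tact_pure_eigen i x c (v : forall i, M i) : rho (M i) x (v i) = c *: v i ->
  tact M i false x (pure v) = c *: (pure v : T).
Proof.
move=> h; rewrite tact_pure; apply: (@pure_scale _ _ _ _ _ i); first by rewrite ltnn eqxx.
by move=> k /negPf ->; case: ifP.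
Qed.

Lemma tact_pure0 i b x (v : forall i, M i) : rho (M i) x (v i) = 0 ->
  tact M i b x (pure v) = 0 :> T.
Proof.
by move=> h; rewrite tact_pure (@pure_zero _ _ _ _ i) // ltnn eqxx.
Qed.

Lemma EtE a (t : T) : Et a a t = \sum_(i < l) tact M i false (Eext C a a) t.
Proof. by rewrite Et_tacts addbb. Qed.

Lemma Et_pure (gam : 'I_l -> weight C) (v : forall i, M i) a : a != 0 ->
  (forall i, wt_space (gam i) (v i)) ->
  Et a a (pure v) = (\sum_(i < l) (gam i).2 a) *: (pure v : T).
Proof.
move=> a0 gv; rewrite EtE scaler_suml; apply: eq_bigr => i _.
by apply: tact_pure_eigen; have [_ ->] := gv i.
Qed.

Lemma T_elim (W : submod T) :
  (forall (v : forall i, M i) (gam : 'I_l -> weight C),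
    (forall i, is_weight setIt (gam i) /\ wt_space (gam i) (v i)) -> W (pure v)) ->
  forall t, W t.
Proof.
move=> h; apply: (@tens_elim _ _ _ (fun i => @is_wvec _ (M i))).
  by move=> i v; exact: gen_wvec.
move=> v hv; have hv' i : exists g, is_weight setIt g /\ wt_space g (v i).
  by have [g] := hv i; exists g.
by apply: (h v (fun i => projT1 (cid (hv' i)))) => i; case: cid.
Qed.

Lemma T_rel : gl_rel (fun a b => Et a b).
Proof. by move=> a b c d t a0 b0 c0 d0 s; apply: Et_rel. Qed.

Local Notation wtT := (wt (fun a b => Et a b)).

(* A vector of weight [w] is a combination of tensor products of weight vectors
   whose weights add up to [w]. *)
Lemma T_weight_elim (W : submod T) (w : int -> C) :
  (forall (v : forall i, M i) (gam : 'I_l -> weight C),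
    (forall i, [/\ is_weight setIt (gam i), wt_space (gam i) (v i) & v i != 0]) ->
    (forall a, a != 0 -> \sum_(i < l) (gam i).2 a = w a) -> W (pure v)) ->
  forall t, wtT w t -> W t.
Proof.
move=> h t wt_.
pose A (i : {a : int | a != 0}) : {linear T -> T} := Et (val i) (val i).
pose res (f : int -> C) : {a : int | a != 0} -> C^o := fun i => f (val i).
have dA : diagonalizable A.
  apply: (T_elim (W := genm (fun x => exists chi, eigen A chi x))) => v gam hv.
  apply: gen_sub; exists (res (fun a => \sum_(i < l) (gam i).2 a)) => -[a a0].
  by apply: Et_pure => // i; have [] := hv i.
(* [calc dA phi] is the projection onto the weight space of [w]; it fixes [t] and kills the pure
   tensors of any other weight. *)
pose phi (chi : {a : int | a != 0} -> C^o) : C := (chi == res w)%:R.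
have ct : calc dA phi t = t.
  rewrite (@calc_eigen _ _ _ _ _ _ (res w)) /phi ?eqxx ?scale1r // => -[a a0].
  exact: wt_.
rewrite -ct; apply: (T_elim (W := smpre (calc dA phi) W)) => v gam hv /=.
rewrite (@calc_eigen _ _ _ _ _ _ (res (fun a => \sum_(i < l) (gam i).2 a))); last first.
  by move=> -[a a0]; apply: Et_pure => // i; have [] := hv i.
rewrite /phi; case: eqP => [e|_]; last by rewrite scale0r; exact: sm_zero.
rewrite scale1r; have [/existsP[i /eqP vi0]|/existsPn v0] := boolP [exists i, v i == 0].
  by rewrite (pure_zero vi0); exact: sm_zero.
apply: (h v gam); first by move=> i; have [] := hv i.
by move=> a a0; have := congr1 (fun f => f (exist _ a a0)) e.
Qed.

Lemma sgx_sum up (n : 'I_l -> nat) : \sum_(i < l) sgx C up (n i) = sgx C up (\sum_(i < l) n i).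
Proof. by case: up; rewrite /sgx natr_sum ?sumrN. Qed.

Lemma T_weight_sign w (t : T) a : wtT w t -> t != 0 -> a != 0 ->
  exists n : nat, w a = sgx C (0 < a) n.
Proof.
move=> wt_ t0 a0; apply: contrapT => nh; move/eqP: t0; apply.
(* [smK idfun] is the zero submodule: a single pure tensor of weight [w] with nonzero weight vectors
   as factors already gives the sign. *)
apply: (T_weight_elim (W := smK idfun) _ wt_) => v gam hv hw; case: nh.
have hn i : exists n : nat, (gam i).2 a = sgx C (0 < a) n.
  by have [wg gv v0] := hv i; exact: (weight_sign (hM i) wg gv v0 a0).
exists (\sum_(i < l) projT1 (cid (hn i)))%N; rewrite -hw //.
have -> : \sum_(i < l) (gam i).2 a = \sum_(i < l) sgx C (0 < a) (projT1 (cid (hn i))).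
  by apply: eq_bigr => i _; case: cid.
exact: sgx_sum.
Qed.

(** The reason is that of [weight_E0]. It makes the singularity conditions at indices outside the
    support automatic, provided that these are suitably placed in the order. *)
Lemma T_E0 w (t : T) a b : wtT w t -> a != 0 -> b != 0 -> a != b ->
  ((0 < b) && (w b == 0)) || ((a < 0) && (w a == 0)) -> Et a b t = 0.
Proof.
move=> wt_ a0 b0 ab h; apply/eqP; apply: contrapT => /negP u0.
have wt' := wt_E T_rel a0 b0 wt_.
case/orP: h => /andP[hb /eqP w0].
  have [n] := T_weight_sign wt' u0 b0.
  rewrite /wshift w0 eqxx [b == a]eq_sym (negPf ab) addr0 sub0r /sgx hb => /eqP.
  by rewrite eq_sym -subr_eq0 opprK natr1 pnatr_eq0.
have [n] := T_weight_sign wt' u0 a0.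
rewrite /wshift w0 eqxx (negPf ab) add0r subr0 /sgx ltNge ltW //= => /eqP.
by rewrite -subr_eq0 opprK nat1r pnatr_eq0.
Qed.

(* The coefficients at [a] of the factors' weights all have the sign of [a], so
   there is no cancellation. *)
Lemma T_weight_supp (gam : 'I_l -> weight C) (v : forall i, M i) a (w : int -> C) :
  (forall i, [/\ is_weight setIt (gam i), wt_space (gam i) (v i) & v i != 0]) ->
  (forall a, a != 0 -> \sum_(i < l) (gam i).2 a = w a) ->
  a != 0 -> w a = 0 -> forall i, (gam i).2 a = 0.
Proof.
move=> hv hw a0 wa0.
have hn i : exists n : nat, (gam i).2 a = sgx C (0 < a) n.
  by have [wg gv v0] := hv i; exact: (weight_sign (hM i) wg gv v0 a0).
pose n i := projT1 (cid (hn i)).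
have nE i : (gam i).2 a = sgx C (0 < a) (n i) by rewrite /n; case: cid.
have : sgx C (0 < a) (\sum_(i < l) n i) = 0.
  by rewrite -[RHS]wa0 -hw // (eq_bigr _ (fun i _ => nE i)) sgx_sum.
move/eqP; rewrite sgx0 sum_nat_eq0 => /forallP h i.
by apply/eqP; rewrite nE sgx0; exact: h.
Qed.

(** In both factors [E_{a,a}] acts, through [iota_ext], as [(-1) ^+ par a * Jd a] times [K]; the
    product of the two scalars is [(a < 0)%R%:R], and the remaining sign is that of the
    Hamiltonian. *)
Definition cS (A S : seq int) : C := \sum_(a <- A | a \notin S) (-1) ^+ par a * (a < 0)%R%:R.

(* An index of [A] outside [S] annihilates each factor, so it contributes only
   through the central term of [iota_ext]: this is the multiple of
   [K^{(i)} K^{(j)}] that the gauge factor removes from the KZ equations. *)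
Lemma Om_restrict (A S : seq int) i j w (t : T) : i != j -> uniq A -> uniq S ->
  (forall a, a \in A -> a != 0) -> {subset S <= A} ->
  wtT w t -> (forall a, a != 0 -> a \notin S -> w a = 0) ->
  Om A i j t = Om S i j t + cS A S *: tact M i false (Kext C) (tact M j false (Kext C) t).
Proof.
move=> ij uA uS A0 SA wt_ wS.
have [KK KKE] : exists KK : {linear T -> T}, forall u,
    KK u = tact M i false (Kext C) (tact M j false (Kext C) u).
  by exists (tact M i false (Kext C) \o tact M j false (Kext C)).
rewrite -KKE.
apply: (T_weight_elim (W := sm_eq (@Om _ _ _ M A i j) (@Om _ _ _ M S i j \+ cS A S \*: KK)) _ wt_).
move=> v gam hv hw.
change (Om A i j (pure v) = Om S i j (pure v) + cS A S *: KK (pure v)).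
have supp a a0 aS := T_weight_supp hv hw a0 (wS a a0 aS).
(* [E_{a,b}] and [E_{b,a}] change the coefficient at an index outside [S] in opposite directions, so
   one of them would give it the wrong sign and acts as zero on its factor. *)
have off a b : a \in A -> b \in A -> a != b -> ~~ ((a \in S) && (b \in S)) ->
    Eopl M i a b (Eopl M j b a (pure v)) = 0.
  move=> aA bA ab nab; have a0 := A0 _ aA; have b0 := A0 _ bA.
  have hi : rho (M i) (Eext C a b) (v i) = 0 \/ rho (M j) (Eext C b a) (v j) = 0.
    have [wi gi _] := hv i; have [wj gj _] := hv j.
    have key (c : int) : c != 0 -> (0 < c) || (c < 0) by case: (ltgtP c 0).
    case/nandP: nab => nS.
      have := key _ a0; case/orP => ha.
        right; apply: (weight_E0 (hM j) wj gj) => //; first by rewrite eq_sym.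
        by rewrite ha (supp a) ?eqxx.
      by left; apply: (weight_E0 (hM i) wi gi) => //; rewrite ha (supp a) ?eqxx ?orbT.
    have := key _ b0; case/orP => hb.
      by left; apply: (weight_E0 (hM i) wi gi) => //; rewrite hb (supp b) ?eqxx.
    right; apply: (weight_E0 (hM j) wj gj) => //; first by rewrite eq_sym.
    by rewrite hb (supp b) ?eqxx ?orbT.
  have ba : b != a by rewrite eq_sym.
  case: hi => hi.
    rewrite /Eopl (tact_comm _ ij (gS_iota C (S := setIt) a0 b0) (gS_iota C b0 a0)
      (homog_iota C a b) (homog_iota C b a)).
    by rewrite (tact_pure0 _ (i := i)) ?linear0 ?scaler0 // iota_ne.
  by rewrite /Eopl (tact_pure0 _ (i := j)) ?linear0 // iota_ne.
have diag k a (u : T) : a \in A -> a \notin S ->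
    Eopl M k a a (pure v) = ((-1) ^+ par a * Jd C a) *: tact M k false (Kext C) (pure v).
  move=> aA aS; have a0 := A0 _ aA; rewrite /Eopl addbb iotaE eqxx mul1r addrC.
  rewrite tact_lin; [|exact: gSK|exact: gSE].
  have [wk [Kk gk] _] := hv k.
  by rewrite (@tact_pure0 k false (Eext C a a)) ?addr0 // gk // supp ?scale0r.
have onA a : a \in A -> \sum_(b <- A) (-1) ^+ par b *: Eopl M i a b (Eopl M j b a (pure v)) =
    (if a \in S then \sum_(b <- S) (-1) ^+ par b *: Eopl M i a b (Eopl M j b a (pure v)) else 0)
    + (if a \in S then 0 else ((-1) ^+ par a * (a < 0)%R%:R) *: KK (pure v)).
  move=> aA; case: ifPn => aS.
    rewrite addr0 (bigID (mem S)) /= [X in _ + X]big_seq_cond [X in _ + X]big1 ?addr0.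
      rewrite -big_filter; apply: perm_big; apply: uniq_perm; rewrite ?filter_uniq //.
      by move=> b; rewrite mem_filter /=; case: (boolP (b \in S)) => // /SA ->.
    move=> b /andP[bA bS]; rewrite off ?scaler0 //; last by rewrite aS.
    by apply: contraNneq bS => <-.
  rewrite add0r (bigD1_seq a) //= [X in _ + X]big_seq_cond [X in _ + X]big1 ?addr0; last first.
    move=> b /andP[bA ba]; rewrite off ?scaler0 //; first by rewrite eq_sym.
    by rewrite (negPf aS).
  have Kv k : tact M k false (Kext C) (pure v) = (gam k).1 *: (pure v : T).
    by apply: tact_pure_eigen; have [_ []] := hv k.
  rewrite (diag j a) // Kv scalerA [Eopl _ _ _ _ (_ *: _)]linearZ (diag i a) // Kv.
  have -> : KK (pure v) = ((gam j).1 * (gam i).1) *: (pure v : T).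
    by rewrite KKE Kv linearZ Kv -[LHS]/(_ *: (_ *: _)) scalerA.
  rewrite -[X in _ *: X]/(_ *: (_ *: _)) !scalerA /Jd.
  congr (_ *: _); case: (a < 0)%R; case: (par a);
    by rewrite ?(expr0, expr1, mulr0, mul0r, mulr1, mul1r, oppr0, mulrN1, mulN1r, mulrN, mulNr, opprK) // mulrC.
have selS (f : int -> T) : \sum_(a <- A) (if a \in S then f a else 0) = \sum_(a <- S) f a.
  rewrite -big_mkcond -big_filter; apply: perm_big; apply: uniq_perm; rewrite ?filter_uniq //.
  by move=> a; rewrite mem_filter; case: (boolP (a \in S)) => // /SA ->.
rewrite /Om (eq_big_seq _ onA) big_split /=.
congr (_ + _); first exact: selS.
rewrite /cS scaler_suml [RHS]big_mkcond; apply: eq_bigr => a _.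
by case: (a \in S).
Qed.

End TensorWeights.

(** * The gauge factor *)

Section Caratheodory.
Variables (K : numFieldType) (V : normedModType K).

(** Differentiability in the form of Caratheodory, with [r] as a slope along [lam]. It asks only for
    continuity of the slope, so it serves both the exponential and a merely continuous logarithm. *)
Lemma caratheodory (f : V -> K^o) (x : V) (lam : {linear V -> K^o}) (r : V -> K^o) :
  continuous lam -> {for x, continuous r} ->
  (\forall y \near x, f y = f x + r y * lam (y - x)) ->
  differentiable f x /\ forall v, 'd f x v = r x * lam v.
Proof.
move=> lc rc fE; pose df : {linear V -> K^o} := r x \*: lam.
have dfc : continuous df.
  by move=> v; apply: (@cvgM _ _ _ _ (fun=> r x) lam); [exact: cvg_cst | exact: lc].
have dxf : f \o shift x = cst (f x) + df +o_ 0 id.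
  apply/eqaddoP => e e0.
  have [k k0 kP] := linear_lipschitz lc.
  have ek : 0 < e / k by rewrite divr_gt0.
  have h1 : \forall h \near (0 : V), f (h + x) = f x + r (h + x) * lam h.
    move: fE; rewrite (near_shift 0) subr0; apply: filterS => h /=.
    by rewrite addrK.
  have h2 : \forall h \near (0 : V), `|r x - r (h + x)| <= e / k.
    have : \forall y \near x, `|r x - r y| <= e / k by exact: (cvgr_dist_le _ _ rc _ ek).
    by rewrite (near_shift 0) subr0.
  apply: filterS2 h1 h2 => h h1 h2.
  rewrite -[X in `|X| <= _]/(f (h + x) - (f x + r x * lam h)).
  rewrite h1 opprD addrACA subrr add0r -mulrBl normrM distrC.
  have -> : e * `|id h| = e / k * (k * `|h|) by rewrite mulrA divfK ?lt0r_neq0.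
  by apply: ler_pM; [exact: normr_ge0|exact: normr_ge0|exact: h2|exact: kP].
have dE := diff_unique dfc dxf.
split; last by move=> v; rewrite dE.
by apply/diff_locallyP; rewrite dE.
Qed.

End Caratheodory.

Section ComplexExponential.
Variable R : realType.
Local Notation C := R[i].
Local Notation normc := (@Normc.normc R).
Local Notation cexp := (@cexp R).
Local Open Scope complex_scope.

Lemma cexpD (x y : C) : cexp (x + y) = cexp x * cexp y.
Proof.
case: x => a b; case: y => c d; rewrite /cexp /= expRD cosD sinD.
by apply/eqP; rewrite eq_complex /=; apply/andP; split; apply/eqP; ring.
Qed.

Lemma cexp0 : cexp 0 = 1.
Proof.
by apply/eqP; rewrite eq_complex /= expR0 cos0 sin0 mul1r mulr0 !eqxx.
Qed.

Lemma cexpN (x : C) : cexp (- x) * cexp x = 1.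
Proof. by rewrite -cexpD addNr cexp0. Qed.

Lemma cexp_neq0 (x : C) : cexp x != 0.
Proof. by apply/eqP => e; have := cexpN x; rewrite e mulr0 => /eqP; rewrite eq_sym oner_eq0. Qed.

Lemma real_expansion (f : R -> R) (df : R) : is_derive (0 : R) (1 : R) f df -> forall e : R, 0 < e ->
  exists2 d : R, 0 < d & forall h : R, `|h| < d -> `|f h - f 0 - h * df| <= e * `|h|.
Proof.
move=> [fd dfE] e e0; have := derivable_nbhs fd; rewrite dfE => /eqaddoP /(_ e e0).
move=> /nbhs_norm0P[d /= d0 dP]; exists d => // h hd.
have /= := dP h hd; rewrite opprD !addrA => H.
apply: le_trans H; rewrite le_eqVlt; apply/orP; left; apply/eqP; congr `|_|.
rewrite -[RHS]/(f (h *: 1 + 0) - f 0 - h *: df).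
by rewrite addr0 [h *: 1]mulr1.
Qed.

Lemma normcE' (a b : R) : normc (a +i* b) <= `|a| + `|b|.
Proof.
rewrite /= -(ler_pXn2r (n := 2)) ?nnegrE ?addr_ge0 ?sqrtr_ge0 //.
rewrite sqr_sqrtr ?addr_ge0 ?sqr_ge0 // sqrrD !real_normK ?num_real // lerD2r.
by rewrite lerDl mulrn_wge0 // mulr_ge0.
Qed.

Lemma normc_geRe (a b : R) : `|a| <= normc (a +i* b).
Proof. by rewrite /= -sqrtr_sqr ler_wsqrtr // lerDl sqr_ge0. Qed.

Lemma normc_geIm (a b : R) : `|b| <= normc (a +i* b).
Proof. by rewrite /= -sqrtr_sqr ler_wsqrtr // lerDr sqr_ge0. Qed.

Lemma cexp_expansion (e : R) : 0 < e -> exists2 d : R, 0 < d &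
  forall u : C, normc u < d -> normc (cexp u - 1 - u) <= e * normc u.
Proof.
(* The four terms of the remainder below are bounded by 1, 3, 1 and 4 times [e1 * N], hence the
   9. *)
move=> e0; have [e1 [e10 e11 e19]] : exists e1 : R, [/\ 0 < e1, e1 <= 1 & 9 * e1 <= e].
  exists (Num.min (e / 9) 1); split; first by rewrite lt_min ltr01 divr_gt0.
    by rewrite ge_min lexx orbT.
  by rewrite mulrC -ler_pdivlMr // ge_min lexx.
have [d1 d10 P1] := real_expansion (is_derive_expR (0 : R)) e10.
have [d2 d20 P2] := real_expansion (is_derive_cos (0 : R)) e10.
have [d3 d30 P3] := real_expansion (is_derive_sin (0 : R)) e10.
exists (Num.min (Num.min d1 d2) (Num.min d3 e1)); first by rewrite !lt_min d10 d20 d30 e10.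
case=> a b; set N := normc _; rewrite !lt_min => /andP[/andP[N1 N2] /andP[N3 Ne]].
have aN : `|a| <= N := normc_geRe a b.
have bN : `|b| <= N := normc_geIm a b.
have N0 : 0 <= N by apply: le_trans aN.
have := P1 a (le_lt_trans aN N1); rewrite expR0 mulr1; set X := _ - _ => X1.
have := P2 b (le_lt_trans bN N2); rewrite cos0 sin0 oppr0 mulr0 subr0; set Y := _ - _ => Y1.
have := P3 b (le_lt_trans bN N3); rewrite sin0 cos0 subr0 mulr1; set Z := _ - _ => Z1.
have XN : `|X| <= e1 * N by apply: (le_trans X1); rewrite ler_pM2l.
have YN : `|Y| <= e1 * N by apply: (le_trans Y1); rewrite ler_pM2l.
have ZN : `|Z| <= e1 * N by apply: (le_trans Z1); rewrite ler_pM2l.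
have eN : e1 * N <= N by rewrite ler_piMl.
have E1 : expR a = 1 + a + X by rewrite /X; ring.
have E2 : cos b = 1 + Y by rewrite /Y; ring.
have E3 : sin b = b + Z by rewrite /Z; ring.
have -> : cexp (a +i* b) - 1 - (a +i* b) =
    (X + Y * (1 + a + X)) +i* (Z + (a + X) * (b + Z)).
  apply/eqP; rewrite eq_complex /= E1 E2 E3; apply/andP; split; apply/eqP; ring.
apply: (le_trans (normcE' _ _)).
have N11 : N <= 1 by apply: ltW; apply: lt_le_trans e11.
have B1 : `|1 + a + X| <= 3.
  apply: (le_trans (ler_normD _ _)); apply: (le_trans (lerD (ler_normD _ _) (lexx _))).
  by rewrite normr1; lra.
have B2 : `|a + X| <= 2 * e1.
  apply: (le_trans (ler_normD _ _)); lra.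
have B3 : `|b + Z| <= 2 * N.
  apply: (le_trans (ler_normD _ _)); lra.
have Q1 : `|Y * (1 + a + X)| <= e1 * N * 3 by rewrite normrM; exact: ler_pM.
have Q2 : `|(a + X) * (b + Z)| <= 2 * e1 * (2 * N) by rewrite normrM; exact: ler_pM.
have e1N : 9 * e1 * N <= e * N by exact: ler_wpM2r.
have := ler_normD X (Y * (1 + a + X)); have := ler_normD Z ((a + X) * (b + Z)).
nra.
Qed.

Lemma normC (u : C) : `|u| = (normc u)%:C.
Proof. by []. Qed.

Lemma cexp_near (e : C) : 0 < e -> \forall u \near (0 : C^o), `|cexp u - 1 - u| <= e * `|u|.
Proof.
case: e => e e'; rewrite ltcE /= => /andP[/eqP -> e0].
have [d d0 dP] := cexp_expansion e0.
have d0' : (0 : C) < d%:C by rewrite ltcR.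
apply: filterS (nbhs0_lt (V := C^o) d0') => u.
by rewrite !normC ltcR => /dP; rewrite -[_ +i* 0]/(e%:C) -rmorphM lecR.
Qed.

(** The slope of the exponential at 0, completed by the derivative there so as to be continuous. *)
Definition dq (u : C) : C^o := if u == 0 then 1 else (cexp u - 1) / u.

Lemma dqE u : cexp u = 1 + dq u * u.
Proof.
rewrite /dq; case: eqVneq => [->|u0]; first by rewrite cexp0 mulr0 addr0.
by rewrite divfK // addrC subrK.
Qed.

Lemma dq0 : dq 0 = 1. Proof. by rewrite /dq eqxx. Qed.

Lemma dq_continuous : {for (0 : C^o), continuous (dq : C^o -> C^o)}.
Proof.
rewrite /prop_for /continuous_at dq0; apply/(@cvgrPdist_le C C^o C^o (nbhs (0 : C^o))) => e e0.
near=> u.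
have hu : `|cexp u - 1 - u| <= e * `|u| by near: u; exact: cexp_near.
rewrite /dq; case: eqVneq hu => [_ _|u0 hu]; first by rewrite subrr normr0 ltW.
rewrite distrC -[X in _ - X](divff u0) -mulrBl normrM normfV.
by rewrite ler_pdivrMr ?normr_gt0.
Unshelve. all: by end_near. Qed.

Lemma cexp_diff (w : C^o) : differentiable (cexp : C^o -> C^o) w /\
  forall v, 'd (cexp : C^o -> C^o) w v = cexp w * v.
Proof.
have [|||dc dE] := @caratheodory C C^o cexp w idfun (fun y => cexp w * dq (y - w)).
- by move=> x; exact: cvg_id.
- apply: (@continuousM C C^o (fun=> cexp w) (fun y => dq (y - w))).
    exact: cst_continuous.
  apply: (@continuous_comp _ _ _ (fun y : C^o => y - w) dq w).
    by apply: (@continuousB C C^o C^o id (fun=> w)); [exact: cvg_id | exact: cst_continuous].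
  by rewrite subrr; exact: dq_continuous.
- near=> y; rewrite -{1}(subrK w y) [y - w + w]addrC cexpD (dqE (y - w)) /=.
  by rewrite mulrDr mulr1 mulrA.
by split=> // v; rewrite dE subrr dq0 mulr1.
Unshelve. all: by end_near. Qed.

(** The identity [dq (f y - f z) * (f y - f z) = lam (y - z) / lam z] can be solved for [f y - f z]:
    by continuity of [f] the slope [dq] is near 1 close to [z], hence invertible. *)
Lemma log_diff (V : normedModType C) (U : set V) (f : V -> C^o) (lam : {linear V -> C^o}) :
  open U -> continuous lam ->
  (forall z, U z -> {for z, continuous f} /\ cexp (f z) = lam z) ->
  forall z, U z -> differentiable f z /\ forall v, 'd f z v = lam v / lam z.
Proof.
move=> Uo lc hf z Uz; have [fc fz] := hf _ Uz.
have lz0 : lam z != 0 by rewrite -fz cexp_neq0.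
pose g y := dq (f y - f z).
have gc : {for z, continuous g}.
  apply: (@continuous_comp _ _ _ (fun y => f y - f z) dq z).
    by apply: (@continuousB C C^o V f (fun=> f z)); [exact: fc | exact: cst_continuous].
  by rewrite subrr; exact: dq_continuous.
have gz : g z = 1 by rewrite /g subrr dq0.
have gz0 : g z != 0 by rewrite gz oner_neq0.
have [|||df dE] := @caratheodory C V f z lam (fun y => (g y)^-1 / lam z).
- exact: lc.
- apply: (@continuousM C V (fun y => (g y)^-1) (fun=> (lam z)^-1)); last exact: cst_continuous.
  by apply: (@continuousV C V g).
- near=> y.
  have Uy : U y by near: y; exact: open_nbhs_nbhs.
  have gy0 : g y != 0 by near: y; exact: (cvgr_neq0 (g z) gc gz0).
  have [_ fy] := hf _ Uy.
  have e : g y * (f y - f z) = lam (y - z) / lam z.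
    have := dqE (f y - f z); rewrite cexpD -/(g y) fy => e.
    have -> : g y * (f y - f z) = lam y * cexp (- f z) - 1 by rewrite e [RHS]addrC addKr.
    have -> : cexp (- f z) = (lam z)^-1.
      by rewrite -fz; apply: (mulIf (cexp_neq0 (f z))); rewrite cexpN mulVf ?cexp_neq0.
    by rewrite linearB mulrBl divff.
  have -> : (g y)^-1 / lam z * lam (y - z) = (g y)^-1 * (g y * (f y - f z)).
    by rewrite e; ring.
  by rewrite mulKf // addrC subrK.
by split=> // v; rewrite dE gz invr1 mul1r mulrC.
Unshelve. all: by end_near. Qed.

End ComplexExponential.

Section Gauge.
Variables (R : realType) (l : nat).
Local Notation C := R[i].
Local Notation pts := (points R l).

Definition zdiff (i j : 'I_l) (z : pts) : C^o := z 0 i - z 0 j.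

Lemma zdiff_linear i j : linear (zdiff i j).
Proof.
move=> a u v; rewrite /zdiff !mxE -[a *: _]/(a * (_ - _)).
ring.
Qed.
HB.instance Definition _ i j := GRing.isLinear.Build C pts C^o *:%R (zdiff i j) (zdiff_linear i j).

Lemma zdiff_continuous i j : continuous (zdiff i j).
Proof.
move=> z; apply: (@continuousB C C^o pts (fun z => z 0 i) (fun z => z 0 j));
  exact: coord_continuous.
Qed.

Variables (U : set pts) (L : 'I_l -> 'I_l -> pts -> C^o).
Hypotheses (Uo : open U) (hL : log_branch U L).

Lemma L_diff (i j : 'I_l) z : (i < j)%N -> U z -> differentiable (L i j) z /\
  forall v, 'd (L i j) z v = zdiff i j v / zdiff i j z.
Proof.
move=> ij Uz; apply: (log_diff (lam := zdiff i j) Uo) => //; first exact: zdiff_continuous.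
by move=> y; exact: hL.
Qed.

Variable c : 'I_l -> 'I_l -> C.

Definition expo (z : pts) : C^o := \sum_(i < l) \sum_(j < l | (i < j)%N) c i j * L i j z.

Definition gfac (z : pts) : C^o := cexp (expo z).

Lemma gfac_diff z : U z -> differentiable gfac z /\ forall v, 'd gfac z v =
  gfac z * \sum_(i < l) \sum_(j < l | (i < j)%N) c i j * (zdiff i j v / zdiff i j z).
Proof.
move=> Uz.
(* The sum is extended by zero to all pairs; the logarithms are controlled only for [i < j]. *)
pose G (i j : 'I_l) : pts -> C^o := if (i < j)%N then c i j \*: L i j else cst 0.
have G1 i j : differentiable (G i j) z.
  rewrite /G; case: ifPn => ij; last exact: differentiable_cst.
  by apply: differentiableZ; have [] := L_diff ij Uz.
have G2 i j v : 'D_v (G i j) z = if (i < j)%N then c i j * (zdiff i j v / zdiff i j z) else 0.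
  rewrite /G; case: ifPn => ij; last exact: derive_cst.
  have [d dE] := L_diff ij Uz.
  by rewrite deriveZ ?deriveE ?dE //; exact: diff_derivable.
have expoE : expo = \sum_(i < l) \sum_(j < l) G i j.
  apply/funext => y; rewrite fct_sumE; apply: eq_bigr => i _.
  rewrite fct_sumE big_mkcond; apply: eq_bigr => j _.
  by rewrite /G; case: ifP.
have H1 i : differentiable (\sum_(j < l) G i j) z by apply: differentiable_sum.
have ed : differentiable expo z by rewrite expoE; apply: differentiable_sum.
have eD v : 'd expo z v =
    \sum_(i < l) \sum_(j < l | (i < j)%N) c i j * (zdiff i j v / zdiff i j z).
  rewrite -deriveE // expoE derive_sum; last by move=> i; exact: diff_derivable.
  apply: eq_bigr => i _; rewrite derive_sum; last by move=> j; exact: diff_derivable.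
  by rewrite [RHS]big_mkcond; apply: eq_bigr => j _; rewrite G2.
have [cd cE] := cexp_diff (expo z).
split; first exact: (differentiable_comp ed cd).
by move=> v; rewrite -eD -cE; have := diff_comp ed cd => /(congr1 (fun f => f v)).
Qed.

End Gauge.

(** * The Knizhnik-Zamolodchikov system *)

Section KZGeneric.
Variables (R : realType) (l : nat).
Local Notation C := R[i].
Local Notation pts := (points R l).
Variables (U : set pts) (kappa : C).

Section Def.
Variables (V : lmodType C) (Tw : V -> Prop) (H : 'I_l -> pts -> V -> V).

(** The shape of [KZ_solution] for arbitrary coefficient space, weight space and Hamiltonians, so
    that solutions can be carried from the truncated to the untruncated tensor product. *)
Definition KZg (psi : U -> V) := exists N (e : 'I_N -> V) (f : 'I_N -> pts -> C^o),
  [/\ forall k, Tw (e k),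
      forall k z, U z -> differentiable (f k) z,
      forall z : U, psi z = \sum_(k < N) (f k (val z) : C) *: e k
    & forall (z : U) (i : 'I_l),
        kappa *: (\sum_(k < N) ('D_(delta_mx 0 i) (f k) (val z) : C) *: e k)
        = H i (val z) (psi z)].

Lemma KZg_seq (X : Type) (s : seq X) (ff : X -> pts -> C^o) (ee : X -> V) (psi : U -> V) :
  (forall x, Tw (ee x)) -> (forall x z, U z -> differentiable (ff x) z) ->
  (forall z : U, psi z = \sum_(x <- s) (ff x (val z) : C) *: ee x) ->
  (forall (z : U) (i : 'I_l),
     kappa *: (\sum_(x <- s) ('D_(delta_mx 0 i) (ff x) (val z) : C) *: ee x)
     = H i (val z) (psi z)) -> KZg psi.
Proof.
move=> h1 h2 h3 h4; exists (size s), (fun k => ee (tnth (in_tuple s) k)).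
exists (fun k => ff (tnth (in_tuple s) k)); split => //.
- by move=> k z; exact: h2.
- by move=> z; rewrite h3 (big_tnth _ _ s).
- by move=> z i; rewrite -h4 [in RHS](big_tnth _ _ s).
Qed.

End Def.

Lemma KZg_map (V V' : lmodType C) (Tw : submod V) (Tw' : V' -> Prop)
    (H : 'I_l -> pts -> V -> V) (H' : 'I_l -> pts -> V' -> V') (X : {linear V -> V'}) psi :
  (forall v, Tw v -> Tw' (X v)) ->
  (forall i z v, U z -> Tw v -> X (H i z v) = H' i z (X v)) ->
  KZg Tw H psi -> KZg Tw' H' (fun z => X (psi z)).
Proof.
move=> XT XH [N [e [f [h1 h2 h3 h4]]]]; exists N, (fun k => X (e k)), f; split => //.
- by move=> k; exact: XT.
- by move=> z; rewrite h3 linear_sum; apply: eq_bigr => k _; rewrite linearZ.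
- move=> z i; rewrite -XH; first last.
  + by rewrite h3; apply: sm_sum => k _; exact: sm_scale.
  + exact: set_valP.
  rewrite -h4 [RHS]linearZ /= [in RHS]linear_sum; congr (_ *: _); apply: eq_bigr => k _.
  by rewrite [RHS]linearZ.
Qed.

(* [gauge] is the operator [\prod_(i < j) (z_i - z_j) ^ (c A_i A_j / kappa)]. *)
Section GaugeTransform.
Variables (V : lmodType C) (A : 'I_l -> {linear V -> V}) (dA : diagonalizable A).
Variables (Tw : submod V) (c : C).
Variables (H H' : 'I_l -> pts -> V -> V).
Variables (L : 'I_l -> 'I_l -> pts -> C^o).
Hypotheses (kappa0 : kappa != 0) (Uo : open U) (hL : log_branch U L).
Hypothesis TwA : forall phi v, Tw v -> Tw (calc dA phi v).
Hypothesis Hlin : forall i z, linear (H i z).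
Hypothesis HA : forall i z j v, A j (H i z v) = H i z (A j v).
Hypothesis HE : forall i z v, U z -> Tw v -> H' i z v =
  H i z v + \sum_(j < l | j != i) (z 0 i - z 0 j : C)^-1 *: (c *: A i (A j v)).

Definition gexp (z : pts) (chi : 'I_l -> C^o) : C :=
  gfac L (fun i j => c / kappa * chi i * chi j) z.

Definition gauge (z : pts) : {linear V -> V} := calc dA (gexp z).

(** The gauge factor depends on [z] through the joint eigenvalues, so before differentiating a
    solution is expanded along eigenvectors, each of which then gets its own scalar factor. *)
Record piece := Piece { pf : pts -> C^o; pchi : 'I_l -> C^o; pe : V;
  pf_diff : forall z, U z -> differentiable pf z;
  pe_Tw : Tw pe; pe_eig : eigen A pchi pe }.

(** The eigencomponents of [v] stay in [Tw] because each is the image of [v] under the functional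
    calculus of an indicator. *)
Lemma Tw_eigen v : Tw v -> gen (fun x => Tw x /\ exists chi, eigen A chi x) v.
Proof.
move=> Tv; have [s [vE hs]] := eigen_decomp (dA v).
pose u := undup (map fst s).
pose ind (chi chi' : 'I_l -> C^o) : C := (chi' == chi)%:R.
have cE chi : calc dA (ind chi) v = \sum_(p <- s) ind chi p.1 *: p.2.
  rewrite vE linear_sum big_seq [RHS]big_seq; apply: eq_bigr => p ps.
  by rewrite (calc_eigen dA (ind chi) (hs _ ps)).
have -> : v = \sum_(chi <- u) calc dA (ind chi) v.
  rewrite (eq_bigr _ (fun chi _ => cE chi)) exchange_big /= {1}vE big_seq [RHS]big_seq.
  apply: eq_bigr => p ps; rewrite (bigD1_seq p.1) ?undup_uniq ?mem_undup ?map_f //=.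
  rewrite /ind eqxx scale1r big1 ?addr0 // => chi; rewrite eq_sym => /negPf ->.
  by rewrite scale0r.
apply: (@sm_sum _ _ (genm _)) => chi _; apply: gen_sub; split; first exact: TwA.
exists chi => i; rewrite cE linear_sum scaler_sumr big_seq [RHS]big_seq.
apply: eq_bigr => p ps; rewrite linearZ (hs _ ps) /= /ind; case: eqP => [->|_].
  by rewrite !scale1r.
by rewrite !scale0r scaler0.
Qed.

(** [w] stands for evaluation at a point or for a partial derivative; one and the same list of
    pieces has to serve both. It may be arbitrary since all pieces keep the coefficient [f]. *)
Lemma pieces f e : (forall z, U z -> differentiable f z) -> Tw e ->
  exists s : seq piece, forall (w : (pts -> C^o) -> C) ,
    \sum_(x <- s) w (pf x) *: pe x = w f *: e /\
    forall phi : ('I_l -> C^o) -> C,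
    \sum_(x <- s) (w (pf x) * phi (pchi x)) *: pe x = w f *: calc dA phi e.
Proof.
move=> fd Te; pose Q v := exists s : seq piece, forall (w : (pts -> C^o) -> C) ,
    \sum_(x <- s) w (pf x) *: pe x = w f *: v /\
    forall phi : ('I_l -> C^o) -> C,
    \sum_(x <- s) (w (pf x) * phi (pchi x)) *: pe x = w f *: calc dA phi v.
have Q0 : Q 0.
  exists [::] => w; split=> [|phi]; rewrite big_nil ?scaler0 //.
  by rewrite (linear0 (calc dA phi)) scaler0.
have Qlin a u v : Q u -> Q v -> Q (a *: u + v).
  move=> [s1 h1] [s2 h2].
  have eigZ x : eigen A (pchi x) (a *: pe x).
    by move=> i; rewrite [LHS]linearZ pe_eig /= !scalerA mulrC.
  exists ([seq Piece (@pf_diff x) (sm_scale a (pe_Tw x)) (eigZ x) | x <- s1] ++ s2) => w.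
  have [e1 p1] := h1 w; have [e2 p2] := h2 w.
  split=> [|phi]; rewrite big_cat big_map /=.
    rewrite e2 scalerDr; congr (_ + _); rewrite scalerA mulrC -scalerA -e1 scaler_sumr.
    by apply: eq_bigr => x _; rewrite !scalerA mulrC.
  rewrite p2 (linearP (calc dA phi)) scalerDr; congr (_ + _).
  rewrite scalerA mulrC -scalerA -p1 scaler_sumr.
  by apply: eq_bigr => x _; rewrite !scalerA mulrC.
apply: (Tw_eigen Te (W := Submod Q0 Qlin)) => x [Tx [chi ex]].
exists [:: Piece fd Tx ex] => w; split=> [|phi]; rewrite big_seq1 //=.
by rewrite (calc_eigen dA phi ex) scalerA.
Qed.

Lemma pieces_sum N (e : 'I_N -> V) (f : 'I_N -> pts -> C^o) :
  (forall k, Tw (e k)) -> (forall k z, U z -> differentiable (f k) z) ->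
  exists s : seq piece, forall (w : (pts -> C^o) -> C) ,
    \sum_(x <- s) w (pf x) *: pe x = \sum_(k < N) w (f k) *: e k /\
    forall phi : ('I_l -> C^o) -> C,
    \sum_(x <- s) (w (pf x) * phi (pchi x)) *: pe x = calc dA phi (\sum_(k < N) w (f k) *: e k).
Proof.
move=> Te fd; have h k := pieces (fd k) (Te k).
exists (flatten [seq projT1 (cid (h k)) | k <- enum 'I_N]) => w; split=> [|phi].
  rewrite big_flatten /= big_map big_enum /=; apply: eq_bigr => k _.
  by case: cid => s /= /(_ w)[].
rewrite big_flatten /= big_map big_enum linear_sum /=; apply: eq_bigr => k _.
by rewrite linearZ; case: cid => s /= /(_ w)[_ ->].
Qed.

(** Only pairs containing [m] contribute. The antisymmetry of [G] turns the pairs with [m] in second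
    place into the terms [j < m] of the sum over all [j != m]. *)
Lemma gexp_D z m chi : U z ->
  kappa * 'D_(delta_mx 0 m) ((fun z => gexp z chi) : pts -> C^o) z =
  gexp z chi * \sum_(j < l | j != m) (z 0 m - z 0 j : C)^-1 * (c * chi m * chi j).
Proof.
move=> Uz; have [d dE] := gfac_diff Uo hL (fun i j => c / kappa * chi i * chi j) Uz.
rewrite deriveE // dE mulrCA; congr (_ * _); rewrite mulr_sumr.
pose G i j : C := (z 0 i - z 0 j)^-1 * (c * chi i * chi j).
have Ganti i j : G j i = - G i j by rewrite /G -[z 0 j - _]opprB invrN mulNr; congr (- (_ * _)); ring.
have zE (i j : 'I_l) : zdiff i j (delta_mx 0 m) = (i == m)%:R - (j == m)%:R.
  by rewrite /zdiff !mxE.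
have step (i : 'I_l) : kappa * (\sum_(j < l | (i < j)%N) c / kappa * chi i * chi j *
     (zdiff i j (delta_mx 0 m) / zdiff i j z)) =
   \sum_(j < l | (i < j)%N) (G i j * (i == m)%:R - G i j * (j == m)%:R).
  rewrite mulr_sumr; apply: eq_bigr => j _; rewrite zE -mulrBr /G -/(zdiff i j z).
  rewrite -[X in _ = X^-1 * _ * _]/(zdiff i j z).
  by rewrite -[c in RHS](divfK kappa0); ring.
rewrite (eq_bigr _ (fun i _ => step i)).
transitivity (\sum_(i < l) \sum_(j < l | (i < j)%N) G i j * (i == m)%:R -
              \sum_(i < l) \sum_(j < l | (i < j)%N) G i j * (j == m)%:R).
  by rewrite -sumrB; apply: eq_bigr => i _; rewrite sumrB.
rewrite (bigD1 m) //= [X in _ + X - _]big1 ?addr0; last first.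
  by move=> i /negPf im; rewrite big1 // => j _; rewrite im mulr0.
rewrite eqxx (eq_bigr (fun j => G m j)); last by move=> j _; rewrite mulr1.
have -> : \sum_(i < l) \sum_(j < l | (i < j)%N) G i j * (j == m)%:R =
    - \sum_(j < l | (j < m)%N) G m j.
  rewrite -sumrN [RHS]big_mkcond; apply: eq_bigr => i _; rewrite -Ganti.
  rewrite big_mkcond (bigD1 m) //= eqxx mulr1 big1 ?addr0 //.
  by move=> j /negPf jm; rewrite jm mulr0; case: ifP.
rewrite opprK [RHS](bigID (fun j : 'I_l => (m < j)%N)) /=; congr (_ + _); apply: eq_bigl => j.
  by rewrite andbC; case: ltngtP => //= e; rewrite ?andbT //; apply/esym/eqP => ee; rewrite ee ltnn in e.
by rewrite -leqNgt -val_eqE /= [(j < m)%N]ltn_neqAle.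
Qed.

(** The product rule: differentiating the coefficients gives [H], which commutes with the gauge
    operator by [HA]; differentiating the scalar factors gives the terms [c A_m A_j]. *)
Lemma KZg_gauge psi : KZg Tw H psi -> KZg Tw H' (fun z => gauge (val z) (psi z)).
Proof.
move=> [N [e [f [h1 h2 h3 h4]]]]; have [s sP] := pieces_sum h1 h2.
have gd (x : piece) z : U z -> differentiable ((fun z => gexp z (pchi x)) : pts -> C^o) z.
  by move=> Uz; have [] := gfac_diff Uo hL (fun i j => c / kappa * pchi x i * pchi x j) Uz.
have psiT z : Tw (psi z) by rewrite h3; apply: sm_sum => k _; exact: sm_scale.
apply: (@KZg_seq _ _ _ piece s (fun x => (pf x : pts -> C^o) \* ((fun z => gexp z (pchi x)) : pts -> C^o)) (@pe)).
- exact: pe_Tw.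
- by move=> x z Uz; apply: differentiableM; [exact: pf_diff | exact: gd].
- by move=> z; rewrite h3; have [_ /(_ (gexp (val z))) e1] := sP (fun f => f (val z)); exact: esym.
move=> z m; have Uz : U (val z) by exact: set_valP.
rewrite HE //; last exact: TwA.
have GH v : gauge (val z) (H m (val z) v) = H m (val z) (gauge (val z) v).
  pose HL : {linear V -> V} := HB.pack (H m (val z))
    (GRing.isLinear.Build C V V *:%R (H m (val z)) (Hlin m (val z))).
  by apply: (calc_comm dA (gexp (val z)) (B := HL)) => i u; exact: HA.
rewrite -GH -h4 [gauge _ (_ *: _)]linearZ.
have [_ /(_ (gexp (val z))) e1] := sP (fun f => 'D_(delta_mx 0 m) f (val z)).
rewrite -[in RHS]e1.
have [_ /(_ (gexp (val z))) e2] := sP (fun f => f (val z)).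
rewrite h3 -e2.
transitivity (\sum_(x <- s) ((kappa * ('D_(delta_mx 0 m) (pf x) (val z) * gexp (val z) (pchi x))) *: pe x
   + \sum_(j < l | j != m) (((val z : pts) 0 m - (val z : pts) 0 j : C)^-1 * c) *:
       ((pf x (val z) * gexp (val z) (pchi x)) *: A m (A j (pe x))))).
  rewrite scaler_sumr; apply: eq_bigr => x _.
  rewrite deriveM; [|exact/diff_derivable/pf_diff|exact/diff_derivable/gd].
  rewrite scalerA mulrDr addrC scalerDl; congr (_ + _).
    by rewrite -[_ *: 'D_(_) (pf x) _]/(_ * _); congr (_ *: _); ring.
  rewrite -[_ *: 'D_(_) _ _]/(_ * _) mulrCA gexp_D // !mulr_sumr scaler_suml.
  apply: eq_bigr => j _; rewrite (pe_eig x) [A m (_ *: _)]linearZ (pe_eig x) /= !scalerA; congr (_ *: _); ring.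
rewrite big_split /=; congr (_ + _).
  by rewrite scaler_sumr; apply: eq_bigr => x _; rewrite scalerA.
rewrite exchange_big; apply: eq_bigr => j _.
rewrite (linear_sum (A j)) (linear_sum (A m)) !scaler_sumr; apply: eq_bigr => x _.
by rewrite [A j (_ *: _)]linearZ [A m (_ *: _)]linearZ /= !scalerA.
Qed.

End GaugeTransform.
End KZGeneric.

(** * Truncation *)

Section PointwiseIsomorphism.
Variables (F : fieldType) (U : Type).

(** The maps act pointwise in [U], as the gauge factor varies with the point. They need to be
    inverse only on values of solutions: an embedding or an odd reflection is not invertible on the
    whole space. *)
Definition biiso (V V' : lmodType F) (A : set (U -> V)) (B : set (U -> V')) :=
  exists (Phi : U -> {linear V -> V'}) (Psi : U -> {linear V' -> V}),
  [/\ forall psi, A psi -> B (fun z => Phi z (psi z)),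
      forall psi, B psi -> A (fun z => Psi z (psi z)),
      forall psi, A psi -> forall z, Psi z (Phi z (psi z)) = psi z
    & forall psi, B psi -> forall z, Phi z (Psi z (psi z)) = psi z].

Lemma biiso_sym (V V' : lmodType F) (A : set (U -> V)) (B : set (U -> V')) :
  biiso A B -> biiso B A.
Proof. by move=> [Phi [Psi [h1 h2 h3 h4]]]; exists Psi, Phi. Qed.

Lemma biiso_trans (V V' V'' : lmodType F) (A : set (U -> V)) (B : set (U -> V'))
  (D : set (U -> V'')) : biiso A B -> biiso B D -> biiso A D.
Proof.
move=> [Phi [Psi [h1 h2 h3 h4]]] [Phi' [Psi' [k1 k2 k3 k4]]].
exists (fun z => Phi' z \o Phi z), (fun z => Psi z \o Psi' z); split.
- by move=> psi /h1 /k1.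
- by move=> psi /k2 /h2.
- by move=> psi Apsi z /=; rewrite (k3 _ (h1 _ Apsi)) h3.
- by move=> psi Dpsi z /=; rewrite (h4 _ (k2 _ Dpsi)) k4.
Qed.

Lemma biiso_linear_iso (V V' : lmodType F) (A : set (U -> V)) (B : set (U -> V')) :
  biiso A B -> linear_iso A B.
Proof.
move=> [Phi [Psi [h1 h2 h3 h4]]]; exists (fun psi z => Phi z (psi z)); split.
  by move=> a u v _ _; apply/funext => z; rewrite -[LHS]/(Phi z (a *: u z + v z)) linearP.
split; first by move=> psi /h1.
- move=> u v /set_mem Au /set_mem Av e; apply/funext => z.
  by rewrite -(h3 _ Au z) -(h3 _ Av z) (congr1 (fun f => f z) e).
- by move=> psi Bpsi; exists (fun z => Psi z (psi z)); [exact: h2|apply/funext => z; exact: h4].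
Qed.

End PointwiseIsomorphism.

Section GaugeInverse.
Variables (R : realType) (l : nat).
Local Notation C := R[i].
Variables (kappa c : C) (V : lmodType C) (A : 'I_l -> {linear V -> V}).
Variables (dA : diagonalizable A) (L : 'I_l -> 'I_l -> points R l -> C^o).

Lemma gexpN z chi : gexp kappa (- c) L z chi * gexp kappa c L z chi = 1.
Proof.
rewrite /gexp /gfac (_ : expo L _ z = - expo L (fun i j => c / kappa * chi i * chi j) z).
  exact: cexpN.
rewrite /expo -sumrN; apply: eq_bigr => i _; rewrite -sumrN; apply: eq_bigr => j _.
by rewrite !mulNr.
Qed.

Lemma gaugeK z v : gauge kappa dA (- c) L z (gauge kappa dA c L z v) = v.
Proof.
move: v; apply: (diag_ind dA (W := sm_eq (gauge kappa dA (- c) L z \o gauge kappa dA c L z) idfun)).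
move=> chi v h /=; rewrite (calc_eigen dA _ h) linearZ (calc_eigen dA _ h) /= scalerA mulrC.
by rewrite gexpN scale1r.
Qed.

End GaugeInverse.

(** * Truncated modules inside untruncated ones *)

Section Embeddings.
Variables (F : numFieldType) (S : set int) (S0 : S `<=` setIt).

(** Both truncations of the theorem are iterated subtypes; this retains what is used of their
    inclusion in the big module. *)
Record embedding (N : gmod F S) (M : gmod F setIt) := Embedding {
  emb :> {linear N -> M};
  emb_inj : injective emb;
  emb_rho : forall x v, gS S x -> emb (rho N x v) = rho M x (emb v);
  emb_sgn : forall v, emb (sgn N v) = sgn M (emb v);
  emb_im : forall m, (exists n, emb n = m) <-> trunc_set S m }.

Lemma emb_trunc N M (j : embedding N M) v : trunc_set S (j v).
Proof. by apply/emb_im; exists v. Qed.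

Lemma trunc_E0 (M : gmod F setIt) (m : M) a : trunc_set S m -> a != 0 -> ~ S a ->
  rho M (Eext F a a) m = 0.
Proof.
move=> [s [-> sP]] a0 Sa; rewrite linear_sum big_seq big1 // => w /sP[g [_ gS'] [_ gw]].
rewrite gw //; have [->|/gS' //] := eqVneq (g.2 a) 0.
by rewrite scale0r.
Qed.

Variables (N : gmod F S) (M : gmod F setIt) (hM : inOtilde M) (j : embedding N M).

(** The slot 0, which is not an index, carries [K], so that a weight is a single character of this
    family. *)
Definition wop (a : int) : {linear M -> M} :=
  if a == 0 then rho M (Kext F) else rho M (Eext F a a).

Lemma wop_eigen g v : wt_space g v -> eigen wop (fun a => if a == 0 then g.1 else g.2 a) v.
Proof. by move=> [Kv gv] a; rewrite /wop; case: eqP => [//|/eqP a0]; exact: gv. Qed.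

Lemma wop_diag : diagonalizable wop.
Proof.
move=> v; apply: (gen_wvec hM v (W := genm _)) => w [g _ gw]; apply: gen_sub.
by exists (fun a => if a == 0 then g.1 else g.2 a); exact: wop_eigen.
Qed.

Definition proj : {linear M -> M} := calc wop_diag
  (fun chi => `[< is_weight S (chi 0, fun a => if a == 0 then 0 else chi a) >]%:R).

Lemma proj_wt g v : is_weight setIt g -> wt_space g v ->
  proj v = if `[< is_weight S g >] then v else 0.
Proof.
move=> [_ gI] gv; rewrite /proj (calc_eigen _ _ (wop_eigen gv)) /=.
set g' := (X in is_weight S X); rewrite (_ : g' = g).
  by case: ifP => _; rewrite ?scale1r ?scale0r.
rewrite /g'; case: g gI {gv g'} => d g /= gI; congr (_, _); apply/funext => a.
case: eqP => [->|//]; have [->//|/gI h] := eqVneq (g 0) 0.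
by case/negP: h.
Qed.

Lemma retract_ex : exists r : {linear M -> N}, forall n, r (j n) = n.
Proof.
have im m : exists n, j n = proj m.
  apply/emb_im; have [W WE] : exists W : submod M, forall v, W v <-> trunc_set S v.
    by exists (trunc_sub M S).
  apply/WE; apply: (gen_wvec hM m (W := smpre proj W)) => w [g gI gw] /=.
  rewrite (proj_wt gI gw); case: asboolP => gS'; last exact: sm_zero.
  by apply/WE; exists [:: w]; rewrite big_seq1; split=> // w'; rewrite inE => /eqP ->; exists g.
have id_tr m : trunc_set S m -> proj m = m.
  move=> [s [-> sP]]; rewrite linear_sum big_seq [RHS]big_seq; apply: eq_bigr => w ws.
  have [g gS' gw] := sP w ws; have gI : is_weight setIt g.
    by case: gS' => f s'; split=> // a /s' /S0.
  by rewrite (proj_wt gI gw) asboolT.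
pose r m := projT1 (cid (im m)).
have rE m : j (r m) = proj m by rewrite /r; case: cid.
have rlin : linear r.
  by move=> a u v; apply: (emb_inj (e := j)); rewrite linearP !rE linearP.
exists (HB.pack r (GRing.isLinear.Build F M N *:%R r rlin) : {linear M -> N}) => n.
by apply: (emb_inj (e := j)); rewrite -[LHS]/(j (r (j n))) rE id_tr //; exact: emb_trunc.
Qed.

Definition retract : {linear M -> N} := projT1 (cid retract_ex).

Lemma retractK n : retract (j n) = n.
Proof. by rewrite /retract; case: cid. Qed.

Lemma retract_im m : trunc_set S m -> j (retract m) = m.
Proof. by move=> /(emb_im j)[n <-]; rewrite retractK. Qed.

End Embeddings.

Section DoubleTruncation.
Variables (F : numFieldType) (M : gmod F setIt) (S1 S2 : set int)
  (h1 : S1 `<=` setIt) (h2 : S2 `<=` S1).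
Local Notation N := (trunc (trunc M h1) h2).

Definition vv (n : N) : M := val (val n).
Lemma vv_linear : linear vv.
Proof. by move=> a u v; rewrite /vv !linearP. Qed.
HB.instance Definition _ := GRing.isLinear.Build F N M *:%R vv vv_linear.

Lemma vv_inj : injective vv.
Proof. by move=> u v /val_inj /val_inj. Qed.

Lemma vv_rho x v : gS S2 x -> vv (rho N x v) = rho M x (vv v).
Proof.
move=> Sx; have Sx1 : gS S1 x by exact: gS_sub Sx.
have st2 := trunc_stable (M := trunc M h1) h2 Sx.
have st1 := trunc_stable (M := M) h1 Sx1.
have e2 : val (rho N x v) = rho (trunc M h1) x (val v) by exact: (val_restr v st2).
by rewrite /vv e2; exact: (val_restr (val v) st1).
Qed.

Lemma vv_sgn v : vv (sgn N v) = sgn M (vv v).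
Proof.
have e2 : val (sgn N v) = sgn (trunc M h1) (val v).
  exact: (val_restr v (@trunc_stable_sgn _ _ (trunc M h1) S2)).
by rewrite /vv e2; exact: (val_restr (val v) (@trunc_stable_sgn _ _ M S1)).
Qed.

(** The two notions of weight vector differ: in the intermediate truncation only the indices in [S1]
    are tested. At the others [E_{a,a}] acts by zero on the truncation, and weights supported on
    [S2] vanish there as well. *)
Lemma vv_im m : (exists n, vv n = m) <-> trunc_set S2 m.
Proof.
have up g : is_weight S2 g -> is_weight S1 g by move=> [f s]; split=> // a /s /h2.
split=> [[n <-]|[s [-> sP]]].
  have [s [nE sP]] := sub_ofP n; rewrite /vv nE.
  exists [seq val w | w <- s]; split.
    by rewrite big_map; exact: (linear_sum (val : {linear _ -> M})).
  move=> _ /mapP[w /sP[g gS2 [Kw gw]] ->]; exists g => //.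
  have tw : trunc_set S1 (val w) by exact: (sub_ofP (W := trunc_sub M S1) w).
  split.
    have e := val_restr w (trunc_stable (M := M) h1 (gSK F S1)).
    by rewrite -e -[restr _ _ _]/(rho (trunc M h1) (Kext F) w) Kw linearZ.
  move=> a a0; have [S1a|nS1a] := pselect (S1 a).
    have e := val_restr w (trunc_stable (M := M) h1 (gSE F S1a S1a)).
    by rewrite -e -[restr _ _ _]/(rho (trunc M h1) (Eext F a a) w) gw // linearZ.
  rewrite (trunc_E0 tw) //; have [->|] := eqVneq (g.2 a) 0; first by rewrite scale0r.
  by case: gS2 => _ gs /gs /h2.
have mk w : w \in s -> exists n : N, vv n = w.
  move=> /sP[g gS2 gw].
  have t1 : trunc_set S1 w.
    exists [:: w]; rewrite big_seq1; split=> // w'; rewrite inE => /eqP ->.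
    by exists g => //; exact: up.
  have p1 : w \in sm_pred (trunc_sub M S1) by exact/sm_predP.
  pose n1 : trunc M h1 := Sub w p1.
  have t2 : trunc_set S2 n1.
    exists [:: n1]; rewrite big_seq1; split=> // w'; rewrite inE => /eqP ->.
    case: gw => Kw gw; exists g => //; split.
      apply: val_inj; rewrite [RHS]linearZ.
      exact: etrans (val_restr n1 (trunc_stable (M := M) h1 (gSK F S1))) Kw.
    move=> a S1a; apply: val_inj; rewrite [RHS]linearZ.
    exact: etrans (val_restr n1 (trunc_stable (M := M) h1 (gSE F S1a S1a))) (gw a (h1 S1a)).
  have p2 : n1 \in sm_pred (trunc_sub (trunc M h1) S2) by exact/sm_predP.
  by exists (Sub n1 p2 : N).
elim: s mk {sP} => [|w s ih] mk; first by exists 0; rewrite big_nil linear0.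
have [n nE] := mk w (mem_head _ _).
have [n' n'E] := ih (fun u us => mk u (mem_behead (s := w :: s) us)).
exists (n + n'); rewrite big_cons -nE -n'E.
by have := vv_linear 1 n n'; rewrite !scale1r.
Qed.

End DoubleTruncation.

Definition trunc_embedding (F : numFieldType) (M : gmod F setIt) (S1 S2 : set int)
    (h1 : S1 `<=` setIt) (h2 : S2 `<=` S1) : embedding (trunc (trunc M h1) h2) M :=
  @Embedding F S2 (trunc (trunc M h1) h2) M (vv (h1 := h1) (h2 := h2))
    (@vv_inj _ _ _ _ h1 h2) (@vv_rho _ _ _ _ h1 h2) (@vv_sgn _ _ _ _ h1 h2)
    (@vv_im _ _ _ _ h1 h2).

(** * Solutions on truncated and untruncated tensor products *)

Section TensorSolutions.
Variables (R : realType) (l : nat).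
Local Notation C := R[i].
Variables (M : 'I_l -> gmod C setIt).
Hypothesis hM : forall i, inOtilde (M i).
Local Notation T := (tensM M).
Local Notation Et := (Et M).
Local Notation K := (Kext C).

Lemma tactsP b x a (u v : T) : tacts b x (a *: u + v) = a *: tacts b x u + tacts b x v.
Proof. exact: tacts_linear. Qed.

Lemma tacts0 b x : tacts b x (0 : T) = 0.
Proof. by rewrite /tacts big1 // => i _; rewrite linear0. Qed.

Lemma wt_sub_proof (g : weight C) (a : C) (u v : T) :
  tens_wt_space g u -> tens_wt_space g v -> tens_wt_space g (a *: u + v).
Proof.
move=> [Ku gu] [Kv gv]; split; first by rewrite tactsP Ku Kv scalerDr !scalerA mulrC.
by move=> b b0; rewrite tactsP gu // gv // scalerDr !scalerA mulrC.
Qed.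

Lemma wt_sub0 (g : weight C) : tens_wt_space g (0 : T).
Proof. by split=> [|b b0]; rewrite tacts0 scaler0. Qed.

Definition Twt (g : weight C) : submod T := Submod (@wt_sub0 g) (@wt_sub_proof g).

Lemma tacts_Et a (t : T) : tacts false (Eext C a a) t = Et a a t.
Proof. by rewrite EtE. Qed.

Lemma Twt_wt g t : Twt g t -> wt (fun a b => Et a b) g.2 t.
Proof. by move=> [_ h] a a0; rewrite -tacts_Et h. Qed.

Lemma Kcomm i j b x (t : T) : gS setIt x -> homog b x ->
  tact M i false K (tact M j b x t) = tact M j b x (tact M i false K t).
Proof.
move=> Sx hx; have [->|ij] := eqVneq i j.
  rewrite (tact_br _ t (gSK C setIt) Sx (homogK C) hx) extbrK scale1r.
  have := tact_scale j b 0 t (gSK C setIt); rewrite !scale0r => z.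
  by rewrite (_ : tact M j (false (+) b) 0 t = 0) ?addr0.
by rewrite tact_comm ?expr0 ?scale1r //; [exact: gSK | exact: homogK].
Qed.

Lemma Kcomm_tacts i b x (t : T) : gS setIt x -> homog b x ->
  tact M i false K (tacts b x t) = tacts b x (tact M i false K t).
Proof.
by move=> Sx hx; rewrite /tacts linear_sum; apply: eq_bigr => j _; rewrite Kcomm.
Qed.

Lemma Ktact_diag : diagonalizable (fun i => tact M i false K).
Proof.
apply: (T_elim hM (W := genm _)) => v gam hv; apply: gen_sub.
exists (fun i => (gam i).1) => i; apply: tact_pure_eigen.
by have [_ []] := hv i.
Qed.

Lemma calc_tacts phi b x (t : T) : gS setIt x -> homog b x ->
  calc Ktact_diag phi (tacts b x t) = tacts b x (calc Ktact_diag phi t).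
Proof. by move=> Sx hx; apply: calc_comm => i v; exact: Kcomm_tacts. Qed.

Lemma Twt_calc g phi t : Twt g t -> Twt g (calc Ktact_diag phi t).
Proof.
move=> [Kt gt]; split.
  by rewrite -calc_tacts ?Kt ?linearZ //; [exact: gSK | exact: homogK].
move=> a a0; rewrite -calc_tacts ?gt ?linearZ //; first exact: gSE.
by have := homogE C a a; rewrite addbb.
Qed.

Definition Hq (A : seq int) (i : 'I_l) (z : points R l) (t : T) : T :=
  \sum_(j < l | j != i) (z 0 i - z 0 j : C)^-1 *: Om A i j t.

Lemma Hq_linear A i z : linear (Hq A i z).
Proof.
move=> a u v; rewrite /Hq scaler_sumr -big_split; apply: eq_bigr => j _ /=.
by rewrite linearP scalerDr !scalerA mulrC.
Qed.

Lemma Eopl_K (A : seq int) i a b k (t : T) : (forall a, a \in A -> a != 0) -> a \in A -> b \in A ->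
  tact M k false K (Eopl M i a b t) = Eopl M i a b (tact M k false K t).
Proof.
move=> A0 aA bA; apply: Kcomm; last exact: homog_iota.
by apply: gS_iota; exact: A0.
Qed.

Lemma Hq_K (A : seq int) i z k (t : T) : (forall a, a \in A -> a != 0) ->
  tact M k false K (Hq A i z t) = Hq A i z (tact M k false K t).
Proof.
move=> A0; rewrite /Hq linear_sum; apply: eq_bigr => j _; rewrite linearZ; congr (_ *: _).
rewrite /Om linear_sum big_seq [RHS]big_seq; apply: eq_bigr => a aA.
rewrite linear_sum big_seq [RHS]big_seq; apply: eq_bigr => b bA.
by rewrite linearZ !(Eopl_K (A := A)).
Qed.

(** The order is recorded by the list itself, so that an odd reflection is an exchange of two
    neighbours. *)
Definition Sing (s : seq int) (t : T) : bool := pairwise (fun a b => `[< Et a b t = 0 >]) s.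

Lemma Sing_calc (s : seq int) phi t : (forall a, a \in s -> a != 0) -> Sing s t ->
  Sing s (calc Ktact_diag phi t).
Proof.
move=> s0; have al : all (fun a : int => a != 0) s by apply/allP => a /s0.
apply: (sub_in_pairwise _ al) => a b a0 b0 /asboolP h; apply/asboolP.
rewrite Et_tacts in h; rewrite Et_tacts -calc_tacts ?h ?linear0 //; [exact: gSE | exact: homogE].
Qed.

Variables (U : set (points R l)) (kappa : C).

Definition TSol (A s : seq int) (g : weight C) : set (U -> T) :=
  [set psi | KZg kappa (Twt g) (Hq A) psi /\ forall z, Sing s (psi z)].

Lemma KZg_Tw (V : lmodType C) (Tw : submod V) H (psi : U -> V) :
  KZg kappa Tw H psi -> forall z, Tw (psi z).
Proof. by move=> [N [e [f [h1 _ h3 _]]]] z; rewrite h3; apply: sm_sum => k _; exact: sm_scale. Qed.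

Section Side.
Hypotheses (kappa0 : kappa != 0) (Uo : open U).
Variables (L : 'I_l -> 'I_l -> points R l -> C^o).
Hypothesis hL : log_branch U L.
Variables (S : set int) (sS A : seq int).
Hypotheses (S0 : S `<=` setIt) (SE : S = [set` sS]) (usS : uniq sS) (uA : uniq A).
Hypotheses (A0 : forall a, a \in A -> a != 0) (sSA : {subset sS <= A}).
Variables (N : 'I_l -> gmod C S) (j : forall i, embedding (N i) (M i)).
Variables (g : weight C) (s : seq int) (lt : rel int).
Hypothesis gS0' : forall a, a != 0 -> a \notin sS -> g.2 a = 0.
Hypothesis lt_neq : forall a b, lt a b -> a != b.
Hypothesis s0 : forall a, a \in s -> a != 0.
Hypothesis sing_s : forall t, Twt g t ->
  (forall a b, S a -> S b -> lt a b -> Et a b t = 0) <-> Sing s t.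

Definition tens_emb : {linear tensM N -> T} := hmap (fun i => emb (j i)).
Definition tens_ret : {linear T -> tensM N} := hmap (fun i => retract S0 (hM i) (j i)).

Lemma tens_emb_pure v : tens_emb (pure v) = pure (fun i => emb (j i) (v i)).
Proof. exact: hmap_pure. Qed.

Lemma tens_ret_pure v : tens_ret (pure v) = pure (fun i => retract S0 (hM i) (j i) (v i)).
Proof. exact: hmap_pure. Qed.

Lemma tens_embK t : tens_ret (tens_emb t) = t.
Proof.
move: t; apply: (tens_ext (f := tens_ret \o tens_emb) (g := idfun)) => v /=.
rewrite -[LHS]/(tens_ret (tens_emb (pure v))) tens_emb_pure tens_ret_pure; congr pure.
by apply: functional_extensionality_dep => i; rewrite retractK.
Qed.

Lemma tens_emb_inj : injective tens_emb.
Proof. exact: can_inj tens_embK. Qed.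

Lemma tens_emb_tact i b x t : gS S x -> tens_emb (tact N i b x t) = tact M i b x (tens_emb t).
Proof.
move=> Sx; move: t; apply: (tens_ext (f := tens_emb \o tact N i b x) (g := tact M i b x \o tens_emb)) => v.
rewrite -[LHS]/(tens_emb (tact N i b x (pure v))) -[RHS]/(tact M i b x (tens_emb (pure v))).
rewrite (tact_pure (M := N)) !tens_emb_pure (tact_pure (M := M)); congr pure.
apply: functional_extensionality_dep => k; case: ifP => _.
  by case: b; rewrite //= emb_sgn.
by case: ifP => // _; rewrite emb_rho.
Qed.

Lemma tens_emb_tacts b x t : gS S x -> tens_emb (tacts b x t) = tacts b x (tens_emb t).
Proof. by move=> Sx; rewrite /tacts linear_sum; apply: eq_bigr => i _; rewrite tens_emb_tact. Qed.

Lemma tens_emb_off a t : a != 0 -> ~ S a -> Et a a (tens_emb t) = 0.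
Proof.
move=> a0 nS; move: t; apply: (tens_ext (f := Et a a \o tens_emb) (g := \0)) => v.
rewrite -[LHS]/(Et a a (tens_emb (pure v))) tens_emb_pure EtE [RHS]/= big1 // => i _.
by rewrite tact_pure0 // (trunc_E0 (emb_trunc (j i) (v i))).
Qed.

Lemma tens_emb_wt t : tens_wt_space g t <-> Twt g (tens_emb t).
Proof.
split=> -[Kt gt]; split.
- by rewrite -tens_emb_tacts ?Kt ?linearZ //; exact: gSK.
- move=> a a0; have [Sa|nSa] := pselect (S a).
    by rewrite -tens_emb_tacts ?gt ?linearZ //; exact: gSE.
  rewrite tacts_Et tens_emb_off // gS0' ?scale0r //.
  by apply/negP => aS; apply: nSa; rewrite SE.
- by apply: tens_emb_inj; rewrite tens_emb_tacts ?Kt ?linearZ //; exact: gSK.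
- move=> a Sa; apply: tens_emb_inj; rewrite tens_emb_tacts; last exact: gSE.
  by rewrite gt ?linearZ //; exact: S0.
Qed.

(** By [T_weight_supp] the factors of the pure tensors that make up [t] have weights supported on
    [S], so each factor lies in its truncation. *)
Lemma tens_retK t : Twt g t -> tens_emb (tens_ret t) = t.
Proof.
move=> /Twt_wt wt_; apply: (T_weight_elim hM (W := sm_eq (tens_emb \o tens_ret) idfun) _ wt_) => v gam hv hw.
change (tens_emb (tens_ret (pure v)) = pure v); rewrite tens_ret_pure tens_emb_pure; congr pure.
apply: functional_extensionality_dep => i; apply: retract_im.
have [[fin sup] gi _] := hv i.
exists [:: v i]; rewrite big_seq1; split=> // w; rewrite inE => /eqP ->; exists (gam i) => //.
split=> // a ga; have a0 : a != 0 := sup a ga.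
rewrite SE; apply: contrapT => /negP aS; move/eqP: ga; apply.
exact: (T_weight_supp hM hv hw a0 (gS0' a0 aS)).
Qed.

Lemma fsS (V : zmodType) (f : int -> V) : \sum_(a \in S) f a = \sum_(a <- sS) f a.
Proof. by rewrite SE -fsbig_seq. Qed.

Lemma tens_emb_Hq i z t : tens_emb (hamiltonian i z t) = Hq sS i z (tens_emb t).
Proof.
rewrite /hamiltonian /Hq linear_sum; apply: eq_bigr => k _; rewrite linearZ; congr (_ *: _).
rewrite fsS linear_sum /Om big_seq [RHS]big_seq; apply: eq_bigr => a aS.
rewrite fsS linear_sum big_seq [RHS]big_seq; apply: eq_bigr => b bS.
have Sa : S a by rewrite SE. have Sb : S b by rewrite SE.
rewrite linearZ; congr (_ *: _); rewrite /Eop tens_emb_tact ?tens_emb_tact //; exact: gS_iota.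
Qed.

Lemma Hq_restrict i z t : Twt g t -> Hq A i z t = Hq sS i z t +
  \sum_(k < l | k != i) (z 0 i - z 0 k : C)^-1 *:
    (cS R A sS *: tact M i false K (tact M k false K t)).
Proof.
move=> /Twt_wt wt_; rewrite /Hq -big_split; apply: eq_bigr => k ki /=.
rewrite -scalerDr; congr (_ *: _); apply: (Om_restrict hM _ uA usS A0 sSA wt_) => //.
by rewrite eq_sym.
Qed.

Lemma sS0 a : a \in sS -> a != 0.
Proof. by move=> /sSA /A0. Qed.

Lemma tens_emb_sing t : Twt g (tens_emb t) -> Sing s (tens_emb t) <->
  (forall a b, S a -> S b -> lt a b -> Eops a b t = 0).
Proof.
move=> Tt; rewrite -(sing_s Tt); split=> h a b Sa Sb ab.
  have h' := h a b Sa Sb ab; apply: tens_emb_inj.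
  rewrite Eops_Et ?lt_neq // Et_tacts linear0 tens_emb_tacts -?Et_tacts //; exact: gSE.
have := h a b Sa Sb ab; rewrite Eops_Et ?lt_neq // => /(congr1 tens_emb).
rewrite linear0 Et_tacts tens_emb_tacts -?Et_tacts //; exact: gSE.
Qed.

(** The embedding followed by the gauge factor. The latter is a function of the operators [K_i],
    which commute with every [E_{a,b}], so it preserves weights and singularity. *)
Lemma side_iso : biiso (singular_solutions (M := N) (U := U) kappa lt g) (TSol A s g).
Proof.
pose c := cS R A sS; pose dA := Ktact_diag.
pose G (c : C) (z : U) := gauge kappa dA c L (val z).
have GT c' z t : Twt g t -> Twt g (G c' z t) by exact: Twt_calc.
have Gs c' z t : Sing s t -> Sing s (G c' z t) by exact: Sing_calc.
have KJ psi : singular_solutions (M := N) (U := U) kappa lt g psi ->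
    KZg kappa (Twt g) (Hq sS) (fun z => tens_emb (psi z)).
  move=> [KZ _]; have Nwt0 : tens_wt_space g (0 : tensM N) by apply/tens_emb_wt; rewrite linear0; exact: wt_sub0.
  have Nlin a u v : tens_wt_space g u -> tens_wt_space g v -> tens_wt_space g (a *: u + v : tensM N).
    by move=> /tens_emb_wt hu /tens_emb_wt hv; apply/tens_emb_wt; rewrite linearP; exact: sm_lin.
  apply: (KZg_map (Tw := Submod Nwt0 Nlin) (H := fun i z t => hamiltonian i z t) _ _ KZ).
    by move=> v /tens_emb_wt.
  by move=> i z v _ _; exact: tens_emb_Hq.
exists (fun z => G c z \o tens_emb), (fun z => tens_ret \o G (- c) z); split.
- move=> psi hpsi; have h := KJ psi hpsi; split.
    apply: (KZg_gauge (dA := dA) (c := c) (H := Hq sS) (H' := Hq A) kappa0 Uo hL _ _ _ _ h) => //.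
    + by move=> phi v; exact: Twt_calc.
    + by move=> i z; exact: Hq_linear.
    + by move=> i z k v; apply: Hq_K; exact: sS0.
    + by move=> i z v _; exact: Hq_restrict.
  move=> z /=; apply: Gs; apply/(tens_emb_sing (KZg_Tw h z)); exact: hpsi.2.
- move=> psi [KZ hs].
  have h : KZg kappa (Twt g) (Hq sS) (fun z => G (- c) z (psi z)).
    apply: (KZg_gauge (dA := dA) (c := - c) (H := Hq A) (H' := Hq sS) kappa0 Uo hL _ _ _ _ KZ) => //.
    + by move=> phi v; exact: Twt_calc.
    + by move=> i z; exact: Hq_linear.
    + by move=> i z k v; apply: Hq_K; exact: A0.
    + move=> i z v _ Tv; rewrite (Hq_restrict i z Tv) -addrA -big_split /= big1 ?addr0 // => k _.
      by rewrite -scalerDr scaleNr subrr scaler0.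
  split.
    apply: (KZg_map (X := tens_ret) (H' := fun i z t => hamiltonian i z t) _ _ h).
      by move=> v Tv; apply/tens_emb_wt; rewrite tens_retK.
    by move=> i z v _ Tv; rewrite -{1}(tens_retK Tv) -tens_emb_Hq tens_embK.
  move=> z a b Sa Sb ab /=; have Tz := KZg_Tw h z.
  by apply: (tens_emb_sing _).1 => //; rewrite tens_retK //; exact: Gs.
- by move=> psi hpsi z /=; rewrite /G gaugeK tens_embK.
- move=> psi [KZ hs] z /=; rewrite tens_retK; last by apply: GT; exact: (KZg_Tw KZ).
  by rewrite /G -{1}[c]opprK gaugeK.
Qed.

End Side.
End TensorSolutions.

(** * Odd reflections on solutions *)

Section Swaps.
Variables (R : realType) (l : nat).
Local Notation C := R[i].
Variables (M : 'I_l -> gmod C setIt).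
Hypothesis hM : forall i, inOtilde (M i).
Local Notation T := (tensM M).
Local Notation Et := (Et M).
Variables (U : set (points R l)) (kappa : C) (A : seq int).
Hypotheses (uA : uniq A) (A0 : forall a, a \in A -> a != 0).
Local Notation TSol := (TSol (M := M) (U := U) kappa A).

Lemma K_Et x y (t : T) : x != 0 -> y != 0 ->
  tacts false (Kext C) (Et x y t) = Et x y (tacts false (Kext C) t).
Proof.
move=> x0 y0; rewrite [LHS](tacts_br t (gSK C setIt) (gSE C (S := setIt) x0 y0) (homogK C) (homogE C x y)).
rewrite extbrK scale1r; have := fun i => tact_scale (M := M) i (false (+) (par x (+) par y)) 0 t (gSK C setIt).
by move=> z; rewrite [X in _ + X](_ : _ = 0) ?addr0 // /tacts big1 // => i _;
  have := z i; rewrite !scale0r.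
Qed.

Lemma Twt_E g x y (t : T) : x != 0 -> y != 0 -> Twt M g t -> Twt M (g + eps C x - eps C y) (Et x y t).
Proof.
move=> x0 y0 gt; have [Kt _] := gt; split.
  by rewrite K_Et // Kt linearZ /= addr0 subr0.
move=> a a0; rewrite tacts_Et.
exact: (wt_E (@T_rel _ _ M) x0 y0 (Twt_wt gt) a0).
Qed.

Lemma Hq_E i z x y (t : T) : x \in A -> y \in A -> Et x y (Hq A i z t) = Hq A i z (Et x y t).
Proof.
move=> xA yA; rewrite /Hq linear_sum; apply: eq_bigr => j _; rewrite linearZ; congr (_ *: _).
by apply: Om_comm.
Qed.

Lemma KZg_E g x y k psi : x \in A -> y \in A -> KZg (U := U) kappa (Twt M g) (Hq A) psi ->
  KZg kappa (Twt M (g + eps C x - eps C y)) (Hq A) (fun z => k *: Et x y (psi z)).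
Proof.
move=> xA yA; apply: (KZg_map (X := k \*: Et x y)) => [v Tv|i z v _ _].
  by apply: sm_scale; apply: Twt_E => //; exact: A0.
by rewrite /= Hq_E // -[RHS]/(Hq A i z (k *: _)) -[k *: Et x y v]addr0 Hq_linear
  (_ : Hq A i z 0 = 0) ?addr0 // /Hq big1 // => j _; rewrite linear0 scaler0.
Qed.

Section OneSwap.
Variables (l1 l2 : seq int) (x y : int).
Local Notation s := (l1 ++ x :: y :: l2).
Local Notation s' := (l1 ++ y :: x :: l2).
Hypotheses (us : uniq s) (sA : {subset s <= A}).
Hypotheses (pxy : par x != par y) (sxy : (x < 0) = (y < 0)).

(** The conditions common to the two lists: all of them except the one on the pair [x], [y]. *)
Definition core (r : rel int) := [&& all (r^~ x) l1, all (r^~ y) l1, allrel r l1 l2,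
  pairwise r l1, all (r x) l2, all (r y) l2 & pairwise r l2].

Lemma pairwise_xy (r : rel int) : pairwise r s = r x y && core r.
Proof.
rewrite pairwise_cat /= allrel_consr allrel_consr /core.
by case: (all (r^~ x) l1); case: (all (r^~ y) l1); case: (allrel r l1 l2);
  case: (pairwise r l1); case: (r x y); case: (all (r x) l2); case: (all (r y) l2);
  case: (pairwise r l2).
Qed.

Lemma pairwise_yx (r : rel int) : pairwise r s' = r y x && core r.
Proof.
rewrite pairwise_cat /= allrel_consr allrel_consr /core.
by case: (all (r^~ x) l1); case: (all (r^~ y) l1); case: (allrel r l1 l2);
  case: (pairwise r l1); case: (r y x); case: (all (r x) l2); case: (all (r y) l2);
  case: (pairwise r l2).
Qed.

Lemma xA : x \in A. Proof. by apply: sA; rewrite mem_cat !inE eqxx orbT. Qed.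
Lemma yA : y \in A. Proof. by apply: sA; rewrite mem_cat !inE eqxx !orbT. Qed.

Lemma lxy : lev x y.
Proof. by rewrite /lev (A0 xA) (A0 yA) sxy eqxx. Qed.

Definition rE (t : T) : rel int := fun a b => `[< Et a b t = 0 >].

Lemma notxy a : (a \in l1) || (a \in l2) -> a != x /\ a != y.
Proof.
move: us; rewrite cat_uniq /= !inE !negb_or => /and3P[_ /and3P[xl1 yl1 l12] /and3P[/andP[xy xl2] yl2 _]].
by case/orP=> h; split; apply: contraTneq h => ->.
Qed.

Lemma core_E t : core (rE t) -> core (rE (Et y x t)).
Proof.
have l1A a : a \in l1 -> a != 0 by move=> h; apply/A0/sA; rewrite mem_cat h.
have l2A a : a \in l2 -> a != 0 by move=> h; apply/A0/sA; rewrite mem_cat !inE h !orbT.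
have n1 a : a \in l1 -> a != x /\ a != y by move=> h; apply: notxy; rewrite h.
have n2 a : a \in l2 -> a != x /\ a != y by move=> h; apply: notxy; rewrite h orbT.
have key a b : a != 0 -> b != 0 -> rE t a b -> (b = y -> rE t a x) -> (a = x -> rE t y b) ->
    rE (Et y x t) a b.
  move=> a0 b0 /asboolP h1 h2 h3; apply/asboolP.
  apply: (refl_other (@T_rel _ _ M) lxy a0 b0 h1); first by move=> /h2 /asboolP.
  by move=> /h3 /asboolP.
have far a b : a != 0 -> b != 0 -> a != x -> b != y -> rE t a b -> rE (Et y x t) a b.
  by move=> a0 b0 ax bY h; apply: key => // e; [rewrite e eqxx in bY | rewrite e eqxx in ax].
have x0 := A0 xA; have y0 := A0 yA; have nxy : x != y by apply: contraNneq pxy => ->.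
move=> /and5P[/allP c1 /allP c2 c3 c4 /and3P[/allP c5 /allP c6 c7]].
apply/and5P; split.
- by apply/allP => a al; have [ax ay] := n1 _ al; apply: (far a x) => //; [exact: l1A | exact: (c1 a al)].
- apply/allP => a al; have [ax ay] := n1 _ al; apply: (key a y) => //; [exact: l1A|exact: (c2 a al)| |].
    by move=> _; exact: (c1 a al).
  by move=> e; rewrite e eqxx in ax.
- apply/allrelP => a b al bl; have [ax _] := n1 _ al; have [_ bY] := n2 _ bl.
  by apply: far => //; [exact: l1A|exact: l2A|move/allrelP: c3; exact].
- have al : all (fun a => a \in l1) l1 by apply/allP.
  suff sub : {in (fun a => a \in l1) &, subrel (rE t) (rE (Et y x t))}.
    exact: (sub_in_pairwise sub al c4).
  move=> a b al1 bl1; rewrite /in_mem /= in al1 bl1.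
  by have [ax _] := n1 _ al1; have [_ bY] := n1 _ bl1; apply: far => //; exact: l1A.
apply/and3P; split.
- apply/allP => b bl; have [bx bY] := n2 _ bl; apply: (key x b) => //; [exact: l2A|exact: (c5 b bl)| |].
    by move=> e; rewrite e eqxx in bY.
  by move=> _; exact: (c6 b bl).
- apply/allP => b bl; have [bx bY] := n2 _ bl; apply: (far y b) => //; [exact: l2A|by rewrite eq_sym|exact: (c6 b bl)].
- have al : all (fun a => a \in l2) l2 by apply/allP.
  suff sub : {in (fun a => a \in l2) &, subrel (rE t) (rE (Et y x t))}.
    exact: (sub_in_pairwise sub al c7).
  move=> a b al1 bl1; rewrite /in_mem /= in al1 bl1.
  by have [ax _] := n2 _ al1; have [_ bY] := n2 _ bl1; apply: far => //; exact: l2A.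
Qed.

(** The only new condition is that [E_{y,x}] kills the image, which holds since its square is 0. The
    brackets arising in the others are again conditions of [core], as [x] and [y] are adjacent. *)
Lemma Sing_E t : Sing s t -> Sing s' (Et y x t).
Proof.
rewrite /Sing pairwise_xy pairwise_yx => /andP[_ /core_E ->]; rewrite andbT.
by apply/asboolP/(odd_refl_sq (@T_rel _ _ M) lxy pxy).
Qed.

(** By [T_E0] both [E_{x,y}] and [E_{y,x}] kill every vector of this weight, so the two singularity
    conditions coincide. *)
Lemma swap_trivial g : g.2 x = 0 -> g.2 y = 0 -> biiso (TSol s g) (TSol s' g).
Proof.
move=> gx gy; have nxy : x != y by apply: contraNneq pxy => ->.
have x0 := A0 xA; have y0 := A0 yA.
have e t : Twt M g t -> Sing s t = Sing s' t.
  move=> Tt; have wt_ := Twt_wt Tt; rewrite /Sing pairwise_xy pairwise_yx; congr (_ && _).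
  rewrite !asboolT //; apply: (T_E0 hM wt_) => //; rewrite ?gx ?gy ?eqxx ?andbT.
  - by rewrite eq_sym.
  - by rewrite -sxy; case: (ltgtP x 0) x0.
  - by rewrite sxy; case: (ltgtP y 0) y0.
exists (fun=> idfun), (fun=> idfun); split=> // psi [KZ hs]; split=> // z.
  by have := hs z; rewrite e //; exact: (KZg_Tw KZ z).
by have := hs z; rewrite -e //; exact: (KZg_Tw KZ z).
Qed.

End OneSwap.

(* [E_{y,x}] and [E_{x,y}] are inverse up to the scalar [g_x + g_y], commute with
   [Om], and exchange the two singularity conditions. *)
Lemma swap_odd l1 l2 x y g : uniq (l1 ++ x :: y :: l2) -> {subset l1 ++ x :: y :: l2 <= A} ->
  par x != par y -> (x < 0) = (y < 0) -> g.2 x + g.2 y != 0 ->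
  biiso (TSol (l1 ++ x :: y :: l2) g) (TSol (l1 ++ y :: x :: l2) (g + eps C y - eps C x)).
Proof.
move=> us sA pxy sxy gxy.
have pr : perm_eq (l1 ++ x :: y :: l2) (l1 ++ y :: x :: l2).
  by rewrite perm_cat2l -[x :: y :: l2]/([:: x] ++ [:: y] ++ l2) perm_catCA.
have us' : uniq (l1 ++ y :: x :: l2) by rewrite -(perm_uniq pr).
have sA' : {subset l1 ++ y :: x :: l2 <= A} by move=> a; rewrite -(perm_mem pr); exact: sA.
have xA' := xA sA; have yA' := yA sA.
have x0 := A0 xA'; have y0 := A0 yA'.
have lx := lxy sA sxy; have ly : lev y x by exact: levC.
have pyx : par y != par x by rewrite eq_sym.
set g' := g + eps C y - eps C x.
have gE : g' + eps C x - eps C y = g by rewrite /g' subrK addrK.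
have nxy : x != y by apply: contraNneq pxy => ->.
have g'xy : g'.2 y + g'.2 x = g.2 x + g.2 y.
  have -> : g'.2 y = g.2 y + (y == y)%:R - (y == x)%:R by [].
  have -> : g'.2 x = g.2 x + (x == y)%:R - (x == x)%:R by [].
  rewrite !eqxx (negPf nxy) [y == x]eq_sym (negPf nxy); ring.
exists (fun=> Et y x), (fun=> (g.2 x + g.2 y)^-1 \*: Et x y); split.
- move=> psi [KZ hs]; split.
    have := KZg_E 1 yA' xA' KZ; rewrite (_ : (fun z => 1 *: _) = (fun z => Et y x (psi z))) //.
    by apply/funext => z; rewrite scale1r.
  by move=> z; exact: Sing_E.
- move=> psi [KZ hs]; split; first by have := KZg_E (g.2 x + g.2 y)^-1 xA' yA' KZ; rewrite gE.
  move=> z /=; have := Sing_E us' sA' pyx (esym sxy) (hs z); rewrite /Sing.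
  by apply: sub_pairwise => a b /asboolP h; apply/asboolP; rewrite linearZ h; exact: scaler0.
- move=> psi [KZ hs] z /=; have Tz := KZg_Tw KZ z.
  rewrite (odd_refl_xy (@T_rel _ _ M) lx pxy (Twt_wt Tz)) ?scalerA ?mulVf ?scale1r //.
  by have := hs z; rewrite /Sing pairwise_xy => /andP[/asboolP].
- move=> psi [KZ hs] z /=; have Tz := KZg_Tw KZ z.
  rewrite [LHS]linearZ /= (odd_refl_xy (@T_rel _ _ M) ly pyx (Twt_wt Tz)).
    by rewrite g'xy scalerA mulVf ?scale1r.
  by have := hs z; rewrite /Sing pairwise_xy => /andP[/asboolP].
Qed.

End Swaps.

(* The effect on a highest weight of the odd reflection exchanging the adjacent
   indices [x] and [y]. Indices are doubled absolute values, so that each sign is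
   treated by the same combinatorics on [nat]. *)
Definition transfer (x y : nat) (c c' : nat -> nat) :=
  (c x = 0%N /\ c y = 0%N /\ c' = c) \/
  ((0 < c x)%N /\ c' = fun u => if u == x then (c x).-1 else if u == y then (c y).+1 else c u).

(** Follows the order and the weight together through successive odd reflections, without reference
    to any module. *)
Inductive moves : seq nat -> (nat -> nat) -> seq nat -> (nat -> nat) -> Prop :=
| moves_refl s c : moves s c s c
| moves_step l1 x y l2 c c' s'' c'' : odd x != odd y -> transfer x y c c' ->
    moves (l1 ++ y :: x :: l2) c' s'' c'' -> moves (l1 ++ x :: y :: l2) c s'' c''.

Lemma moves_trans s c s' c' s'' c'' : moves s c s' c' -> moves s' c' s'' c'' -> moves s c s'' c''.
Proof. by elim=> // {}l1 x y l2 {}c c1 s1 c2 pxy tr _ ih h; apply: moves_step pxy tr (ih h). Qed.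

Lemma eqz_pos (a : int) (y : nat) : 0 < a -> (a == y%:Z) = (`|a|%N == y).
Proof. by move=> a0; apply/eqP/eqP; lia. Qed.

Lemma eqz_npos (a : int) (y : nat) : ~~ (0 < a) -> y%:Z != 0 -> (a == y%:Z) = false.
Proof. by move=> a0 y0; apply/eqP; lia. Qed.

Lemma eqz_neg (a : int) (y : nat) : a < 0 -> (a == - y%:Z) = (`|a|%N == y).
Proof. by move=> a0; apply/eqP/eqP; lia. Qed.

Lemma eqz_nneg (a : int) (y : nat) : ~~ (a < 0) -> - y%:Z != 0 -> (a == - y%:Z) = false.
Proof. by move=> a0 y0; apply/eqP; lia. Qed.

Section Chains.
Variables (R : realType) (l : nat).
Local Notation C := R[i].
Variables (M : 'I_l -> gmod C setIt).
Hypothesis hM : forall i, inOtilde (M i).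
Variables (U : set (points R l)) (kappa : C) (A : seq int).
Hypotheses (uA : uniq A) (A0 : forall a, a \in A -> a != 0).
Variable d : C.
Local Notation TSol := (TSol (M := M) (U := U) kappa A).

Definition pos_ (s : seq nat) : seq int := map Posz s.
(** Reversed, so that on either side of 0 a list of absolute values is read outwards. *)
Definition neg_ (s : seq nat) : seq int := rev [seq - (u%:Z) | u <- s].

Lemma perm_swap (l1 l2 : seq int) x y : perm_eq (l1 ++ x :: y :: l2) (l1 ++ y :: x :: l2).
Proof. by rewrite perm_cat2l -[x :: y :: l2]/([:: x] ++ [:: y] ++ l2) perm_catCA. Qed.

Lemma good_swap (l1 l2 : seq int) x y :
  uniq (l1 ++ x :: y :: l2) /\ {subset l1 ++ x :: y :: l2 <= A} ->
  uniq (l1 ++ y :: x :: l2) /\ {subset l1 ++ y :: x :: l2 <= A}.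
Proof.
move=> [us sA]; split; first by rewrite -(perm_uniq (perm_swap l1 l2 x y)).
by move=> a; rewrite -(perm_mem (perm_swap l1 l2 x y)); exact: sA.
Qed.

Lemma chain_pos nl cm s c s' c' : moves s c s' c' ->
  uniq (nl ++ pos_ s) /\ {subset nl ++ pos_ s <= A} ->
  biiso (TSol (nl ++ pos_ s) (mkweight c cm d)) (TSol (nl ++ pos_ s') (mkweight c' cm d)).
Proof.
elim=> [{}s {}c _|l1 x y l2 {}c c1 s1 c2 pxy tr _ ih].
  by exists (fun=> idfun), (fun=> idfun); split.
rewrite /pos_ !map_cat /= !catA => gd; have gd' := good_swap gd.
have [us sA] := gd; have x0 := A0 (xA sA); have y0 := A0 (yA sA).
have xy : x != y by apply: contraNneq pxy => ->.
have pI : par x%:Z != par y%:Z by exact: pxy.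
apply: biiso_trans (ih _); last by rewrite /pos_ !map_cat /= !catA.
rewrite /pos_ !map_cat /= !catA.
have sxy : (x%:Z < 0) = (y%:Z < 0) by rewrite !ltz_nat.
have gx (cc : nat -> nat) u : u%:Z != 0 -> (mkweight cc cm d).2 u%:Z = (cc u)%:R.
  by move=> u0; rewrite /= ifT //; lia.
case: tr => [[cx [cy ->]]|[cx ->]].
  by apply: (swap_trivial hM _ _ A0 sA pI sxy); rewrite gx // ?cx ?cy.
have -> : mkweight (fun u => if u == x then (c x).-1 else if u == y then (c y).+1 else c u) cm d =
    mkweight c cm d + eps C y - eps C x.
  congr pair; first by rewrite /= addr0 subr0.
  apply/funext => a; rewrite -[RHS]/((mkweight c cm d).2 a + (a == y%:Z)%:R - (a == x%:Z)%:R) /=.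
  case: ifPn => a0; last by rewrite (eqz_npos a0 x0) (eqz_npos a0 y0) !mulr0n addr0 subr0.
  rewrite !(eqz_pos _ a0).
  case: eqVneq => [->|nx]; first by rewrite (negPf xy) mulr0n addr0 -(natrB _ cx) subn1.
  case: eqVneq => [->|ny]; first by rewrite mulr0n subr0 natr1.
  by rewrite !mulr0n subr0 addr0.
apply: (swap_odd _ _ _ uA A0 us sA pI sxy).
by rewrite !gx // -natrD pnatr_eq0 addn_eq0 negb_and -lt0n cx.
Qed.

(** Here [- y] precedes [- x], and the reflection adds 1 at [- x] and subtracts 1 at [- y]; with
    nonpositive coefficients this again moves one unit of absolute value from [x] to [y]. *)
Lemma chain_neg pl cp s c s' c' : moves s c s' c' ->
  uniq (neg_ s ++ pl) /\ {subset neg_ s ++ pl <= A} ->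
  biiso (TSol (neg_ s ++ pl) (mkweight cp c d)) (TSol (neg_ s' ++ pl) (mkweight cp c' d)).
Proof.
elim=> [{}s {}c _|l1 x y l2 {}c c1 s1 c2 pxy tr _ ih].
  by exists (fun=> idfun), (fun=> idfun); split.
have negE a b : neg_ (l1 ++ a :: b :: l2) ++ pl =
    neg_ l2 ++ (- (b%:Z)) :: (- (a%:Z)) :: (neg_ l1 ++ pl).
  by rewrite /neg_ map_cat rev_cat /= !rev_cons -!cats1 -!catA.
rewrite !negE in ih *; move=> gd; have gd' := good_swap gd.
have [us sA] := gd; have x0 := A0 (yA sA); have y0 := A0 (xA sA).
have xy : x != y by apply: contraNneq pxy => ->.
have pI : par (- (y%:Z)) != par (- (x%:Z)) by rewrite /par !abszN !absz_nat eq_sym.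
apply: biiso_trans (ih gd').
have sxy : (- (y%:Z) < 0) = (- (x%:Z) < 0) by lia.
have gx (cc : nat -> nat) u : - (u%:Z) != 0 -> (mkweight cp cc d).2 (- (u%:Z)) = - (cc u)%:R.
  move=> u0; rewrite /= (_ : (0 < - u%:Z)%R = false); last by lia.
  by rewrite ifT ?abszN ?absz_nat //; lia.
case: tr => [[cx [cy ->]]|[cx ->]].
  by apply: (swap_trivial hM _ _ A0 sA pI sxy); rewrite gx // ?cx ?cy oppr0.
have -> : mkweight cp (fun u => if u == x then (c x).-1 else if u == y then (c y).+1 else c u) d =
    mkweight cp c d + eps C (- (x%:Z)) - eps C (- (y%:Z)).
  congr pair; first by rewrite /= addr0 subr0.
  apply/funext => a; rewrite -[RHS]/((mkweight cp c d).2 a + (a == - x%:Z)%:R - (a == - y%:Z)%:R) /=.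
  case: ifPn => a0.
    have a1 : ~~ (a < 0) by rewrite -leNgt ltW.
    by rewrite (eqz_nneg a1 x0) (eqz_nneg a1 y0) !mulr0n addr0 subr0.
  case: ifPn => a1; last by rewrite (eqz_nneg a1 x0) (eqz_nneg a1 y0) !mulr0n addr0 subr0.
  rewrite !(eqz_neg _ a1).
  case: eqVneq => [->|nx].
    by rewrite (negPf xy) mulr0n subr0 -{2}(prednK cx) -natr1 opprD subrK.
  case: eqVneq => [->|ny]; first by rewrite mulr0n addr0 -natr1 opprD.
  by rewrite !mulr0n subr0 addr0.
apply: (swap_odd _ _ _ uA A0 us sA pI sxy).
by rewrite !gx // -opprD oppr_eq0 -natrD pnatr_eq0 addn_eq0 negb_and -!lt0n cx orbT.
Qed.

End Chains.

(** * From the standard to the barred weight, one cell at a time *)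

Section NatChain.
Variables (nu : intpart) (q r p : nat).
Hypotheses (qr : (q <= r)%N) (nr : (part nu 1 <= r)%N).

(** The weight once the first [i] integers have passed all half-odd indices from column [q + 1] to
    [r], and integer [i + 1] those of columns [j + 1] to [r]. Each column gives one unit per integer
    that passes it, as long as it has any. *)
Definition cst_ (i j u : nat) : nat :=
  let k := uphalf u in
  if odd u then (if k <= q then conjpart nu k else conjpart nu k - (i + (j < k)))%N
  else if (0 < k)%N && (k <= i)%N then (part nu k - q)%N
  else if k == i.+1 then (part nu k - j)%N else 0%N.

Definition hf a b : seq nat := [seq k.*2.+1 | k <- iota a (b - a)].
Definition ev a b : seq nat := [seq k.*2.+2 | k <- iota a (b - a)].

Definition lst i j : seq nat := hf 0 q ++ ev 0 i ++ hf q j ++ i.*2.+2 :: hf j r ++ ev i.+1 p.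

Lemma hf_split a b : (a <= b)%N -> hf a b.+1 = rcons (hf a b) b.*2.+1.
Proof.
by move=> ab; rewrite /hf subSn // -addn1 iotaD map_cat /= subnKC // cats1.
Qed.

Lemma hf_cons a b : (a < b)%N -> hf a b = a.*2.+1 :: hf a.+1 b.
Proof. by move=> ab; rewrite /hf -(subnSK ab). Qed.

Lemma ev_split a b : (a <= b)%N -> ev a b.+1 = rcons (ev a b) b.*2.+2.
Proof.
by move=> ab; rewrite /ev subSn // -addn1 iotaD map_cat /= subnKC // cats1.
Qed.

Lemma ev_cons a b : (a < b)%N -> ev a b = a.*2.+2 :: ev a.+1 b.
Proof. by move=> ab; rewrite /ev -(subnSK ab). Qed.

Lemma hf_nil a : hf a a = [::]. Proof. by rewrite /hf subnn. Qed.
Lemma ev_nil a : ev a a = [::]. Proof. by rewrite /ev subnn. Qed.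

Lemma uphalf_odd k : uphalf k.*2.+1 = k.+1.
Proof. by rewrite /= doubleK. Qed.
Lemma uphalf_even k : uphalf k.*2.+2 = k.+1.
Proof. by rewrite -doubleS uphalf_double. Qed.

(** Column [j + 1] has a unit left exactly if cell (i + 1, j + 1) is in the diagram. If it is not,
    row [i + 1] ends at or before column [j], both coefficients are 0 and [transfer] holds by its
    first case. *)
Lemma move_one i j : (q <= j)%N -> (j < r)%N -> (i < p)%N ->
  moves (lst i j.+1) (cst_ i j.+1) (lst i j) (cst_ i j).
Proof.
move=> qj jr ip; rewrite /lst hf_split // cat_rcons (hf_cons jr).
pose l1 := hf 0 q ++ ev 0 i ++ hf q j; pose l2 := hf j.+1 r ++ ev i.+1 p.
have e1 : l1 ++ j.*2.+1 :: i.*2.+2 :: l2 =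
  hf 0 q ++ ev 0 i ++ hf q j ++ j.*2.+1 :: i.*2.+2 :: hf j.+1 r ++ ev i.+1 p by rewrite /l1 -!catA.
have e2 : l1 ++ i.*2.+2 :: j.*2.+1 :: l2 =
  hf 0 q ++ ev 0 i ++ hf q j ++ i.*2.+2 :: (j.*2.+1 :: hf j.+1 r) ++ ev i.+1 p by rewrite /l1 -!catA.
rewrite -e1 -e2.
apply: moves_step (moves_refl _ _); first by rewrite /= !odd_double.
have cx : cst_ i j.+1 j.*2.+1 = (conjpart nu j.+1 - i)%N.
  by rewrite /cst_ uphalf_odd /= odd_double /= ltnNge qj /= ltnn addn0.
have cy : cst_ i j.+1 i.*2.+2 = (part nu i.+1 - j.+1)%N.
  by rewrite /cst_ uphalf_even /= odd_double /= ltnn eqxx.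
have other u : u != j.*2.+1 -> u != i.*2.+2 -> cst_ i j u = cst_ i j.+1 u.
  move=> ux uy; rewrite /cst_; case: ifPn => ou.
    case: ifP => // _; congr (_ - (_ + _))%N; congr nat_of_bool.
    by apply/idP/idP; lia.
  case: ifP => // _; case: eqP => // e; exfalso; lia.
have nx : cst_ i j j.*2.+1 = (conjpart nu j.+1 - i.+1)%N.
  by rewrite /cst_ uphalf_odd /= odd_double /= ltnNge qj /= ltnSn addn1.
have ny : cst_ i j i.*2.+2 = (part nu i.+1 - j)%N.
  by rewrite /cst_ uphalf_even /= odd_double /= ltnn eqxx.
have eqv : (i < conjpart nu j.+1)%N = (j < part nu i.+1)%N by rewrite conj_part.
have [h|h] := ltnP i (conjpart nu j.+1).
  right; split; first by rewrite cx subn_gt0.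
  apply/funext => u; case: eqP => [->|/eqP ux]; first by rewrite nx cx; lia.
  case: eqP => [->|/eqP uy]; last exact: other.
  by rewrite ny cy; rewrite h in eqv; lia.
left; have h' : (part nu i.+1 <= j)%N by rewrite leqNgt -eqv -leqNgt.
split; first by rewrite cx; lia.
split; first by rewrite cy; lia.
apply/funext => u; have [->|ux] := eqVneq u j.*2.+1; first by rewrite nx cx; lia.
have [->|uy] := eqVneq u i.*2.+2; first by rewrite ny cy; lia.
exact: other.
Qed.

Lemma move_int i : (i < p)%N -> moves (lst i r) (cst_ i r) (lst i q) (cst_ i q).
Proof.
move=> ip; suff h j : (j <= r - q)%N -> moves (lst i r) (cst_ i r) (lst i (r - j)) (cst_ i (r - j)).
  by have := h _ (leqnn _); rewrite subKn.
elim: j => [|j ih] jr; first by rewrite subn0; exact: moves_refl.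
apply: moves_trans (ih (ltnW jr)) _.
have -> : (r - j = (r - j.+1).+1)%N by lia.
by apply: move_one => //; lia.
Qed.

Lemma conj_large k : (r < k)%N -> conjpart nu k = 0%N.
Proof.
move=> rk; apply/eqP; rewrite -leqn0 leqNgt conj_part //; last by case: (k) rk.
by rewrite -ltnNge; exact: leq_ltn_trans rk.
Qed.

Lemma part_large k : (0 < k)%N -> (part nu k <= r)%N.
Proof. by move=> k0; apply: leq_trans nr; exact: part_le. Qed.

(** The weight between two integers' moves. [cst_] meets it at [j = r], where the next integer still
    has coefficient 0 because rows have length at most [r], and at [j = q], where that integer has
    finished. *)
Definition wend (i u : nat) : nat :=
  let k := uphalf u in
  if odd u then (if k <= q then conjpart nu k else conjpart nu k - i)%N
  else if (0 < k)%N && (k <= i)%N then (part nu k - q)%N else 0%N.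

Lemma cst_start i : cst_ i r = wend i.
Proof.
apply/funext => u; rewrite /cst_ /wend; case: ifPn => ou.
  case: ifP => // _; case: ltnP => rk; last by rewrite addn0.
  by rewrite conj_large.
case: ifP => // h; case: eqP => // e; apply/eqP; rewrite subn_eq0.
by apply: part_large; rewrite e.
Qed.

Lemma cst_end i : cst_ i q = wend i.+1.
Proof.
apply/funext => u; rewrite /cst_ /wend; case: ifPn => ou.
  by case: leqP => // qk; rewrite addn1.
have [->|ne] := eqVneq (uphalf u) i.+1; first by rewrite /= ltnn leqnn.
by have -> : (uphalf u <= i)%N = (uphalf u <= i.+1)%N by lia.
Qed.

Definition stl i : seq nat := hf 0 q ++ ev 0 i ++ hf q r ++ ev i p.

Lemma move_all i : (i <= p)%N -> moves (stl 0) (wend 0) (stl i) (wend i).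
Proof.
elim: i => [|i ih] ip; first exact: moves_refl.
apply: moves_trans (ih (ltnW ip)) _.
have -> : stl i = lst i r by rewrite /stl /lst hf_nil (ev_cons ip).
have -> : stl i.+1 = lst i q by rewrite /stl /lst hf_nil ev_split // cat_rcons.
by rewrite -cst_start -cst_end; exact: move_int.
Qed.

Lemma nat_chain : moves (hf 0 q ++ hf q r ++ ev 0 p) (wend 0)
  (hf 0 q ++ ev 0 p ++ hf q r) (wend p).
Proof.
by have := move_all (leqnn p); rewrite /stl !ev_nil cats0.
Qed.

End NatChain.

(** * Index lists *)

Section Orders.
Variable f : int -> nat.

Definition ltf : rel int := fun a b => (f a < f b)%N || ((f a == f b) && (a < b)).

Lemma ltf_asym a b : ltf a b -> ~~ ltf b a.
Proof. by rewrite /ltf; case: ltngtP => //= _; case: ltgtP. Qed.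

Lemma ltf_irr a : ~~ ltf a a.
Proof. by rewrite /ltf ltnn eqxx ltxx. Qed.

Lemma pairwise_ltf (r : rel int) s : pairwise ltf s ->
  pairwise r s <-> (forall a b, a \in s -> b \in s -> ltf a b -> r a b).
Proof.
move=> ps; split=> [pr a b /(nthP 0)[i si <-] /(nthP 0)[j sj <-] ab|h].
  have [ij|ji|e] := ltngtP i j.
  - by move/(pairwiseP 0): pr; apply.
  - by move/(pairwiseP 0): ps => /(_ j i sj si ji) /ltf_asym; rewrite ab.
  - by move: ab; rewrite e (negPf (ltf_irr _)).
have al : all (fun a => a \in s) s by apply/allP.
suff sub : {in (fun a => a \in s) &, subrel ltf r} by exact: (sub_in_pairwise sub al ps).
by move=> a b; rewrite /in_mem /= => sa sb; exact: h.
Qed.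

Lemma pairwise_ltf_const k s : pairwise <%R s -> (forall a, a \in s -> f a = k) ->
  pairwise ltf s /\ forall a, a \in s -> (k <= f a)%N.
Proof.
move=> ps h; split; last by move=> a /h ->.
have al : all (fun a => a \in s) s by apply/allP.
suff sub : {in (fun a => a \in s) &, subrel <%R ltf} by exact: (sub_in_pairwise sub al ps).
by move=> a b; rewrite /in_mem /= => sa sb ab; rewrite /ltf !h // eqxx ab orbT.
Qed.

Lemma pairwise_ltf_cat k s t : pairwise <%R s -> (forall a, a \in s -> f a = k) ->
  pairwise ltf t /\ (forall a, a \in t -> (k < f a)%N) ->
  pairwise ltf (s ++ t) /\ forall a, a \in s ++ t -> (k <= f a)%N.
Proof.
move=> ps hs [pt ht]; have [ps' _] := pairwise_ltf_const ps hs; split.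
  rewrite pairwise_cat ps' pt !andbT; apply/allrelP => a b sa tb.
  by rewrite /ltf hs // ht.
by move=> a; rewrite mem_cat => /orP[/hs ->//|/ht/ltnW].
Qed.

Lemma pairwise_ltf_uniq s : pairwise ltf s -> uniq s.
Proof.
move=> ps; rewrite uniq_pairwise; apply: sub_pairwise ps => a b h /=.
by apply/eqP => e; move: h; rewrite e (negPf (ltf_irr _)).
Qed.

End Orders.

Lemma mem_hf a b u : (u \in hf a b) = odd u && (a.*2 < u < b.*2)%N.
Proof.
apply/mapP/andP => [[k]|[ou h]].
  by rewrite mem_iota => h ->; rewrite /= odd_double; split=> //; lia.
by exists u./2; rewrite ?mem_iota; lia.
Qed.

Lemma mem_ev a b u : (u \in ev a b) = ~~ odd u && (a.*2 < u <= b.*2)%N.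
Proof.
apply/mapP/andP => [[k]|[ou h]].
  by rewrite mem_iota => h ->; rewrite /= odd_double; split=> //; lia.
by exists (u./2.-1); rewrite ?mem_iota; lia.
Qed.

Lemma mem_pos a s : (a \in pos_ s) = (0 <= a) && (`|a|%N \in s).
Proof.
apply/mapP/andP => [[u us ->]|[a0 h]]; first by [].
by exists `|a|%N => //; lia.
Qed.

Lemma mem_neg a s : (a \in neg_ s) = (a <= 0) && (`|a|%N \in s).
Proof.
rewrite mem_rev; apply/mapP/andP => [[u us ->]|[a0 h]].
  by rewrite abszN absz_nat; split=> //; lia.
by exists `|a|%N => //; lia.
Qed.

Lemma mem_pos_hf a x y : (a \in pos_ (hf x y)) = [&& par a, (x.*2)%:Z < a & a < (y.*2)%:Z].
Proof. by rewrite mem_pos mem_hf /par; case: (odd `|a|) => /=; lia. Qed.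

Lemma mem_pos_ev a x y : (a \in pos_ (ev x y)) = [&& ~~ par a, (x.*2)%:Z < a & a <= (y.*2)%:Z].
Proof. by rewrite mem_pos mem_ev /par; case: (odd `|a|) => /=; lia. Qed.

Lemma mem_neg_hf a x y :
  (a \in neg_ (hf x y)) = [&& par a, - (y.*2)%:Z < a & a < - (x.*2)%:Z].
Proof. by rewrite mem_neg mem_hf /par; case: (odd `|a|) => /=; lia. Qed.

Lemma mem_neg_ev a x y :
  (a \in neg_ (ev x y)) = [&& ~~ par a, - (y.*2)%:Z <= a & a < - (x.*2)%:Z].
Proof. by rewrite mem_neg mem_ev /par; case: (odd `|a|) => /=; lia. Qed.

Lemma pos_cat s t : pos_ (s ++ t) = pos_ s ++ pos_ t.
Proof. exact: map_cat. Qed.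

Lemma neg_cat s t : neg_ (s ++ t) = neg_ t ++ neg_ s.
Proof. by rewrite /neg_ map_cat rev_cat. Qed.

Lemma sorted_hf a b : pairwise ltn (hf a b).
Proof.
rewrite pairwise_map; apply: sub_pairwise (_ : pairwise ltn _); last first.
  by rewrite -sorted_pairwise ?iota_ltn_sorted //; exact: ltn_trans.
by move=> x y /=; lia.
Qed.

Lemma sorted_ev a b : pairwise ltn (ev a b).
Proof.
rewrite pairwise_map; apply: sub_pairwise (_ : pairwise ltn _); last first.
  by rewrite -sorted_pairwise ?iota_ltn_sorted //; exact: ltn_trans.
by move=> x y /=; lia.
Qed.

Lemma sorted_pos s : pairwise ltn s -> pairwise <%R (pos_ s).
Proof. by rewrite pairwise_map; apply: sub_pairwise => x y /=; rewrite ltz_nat. Qed.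

Lemma sorted_neg s : pairwise ltn s -> pairwise <%R (neg_ s).
Proof.
elim: s => [//|u s ih] /= /andP[us ps].
rewrite /neg_ /= rev_cons -cats1 pairwise_cat ih //= !andbT.
rewrite allrel1r; apply/allP => a; rewrite -/(neg_ s) mem_neg => /andP[a0 /(allP us)].
by move=> /= h; lia.
Qed.

Lemma hf_cat a b c : (a <= b)%N -> (b <= c)%N -> hf a b ++ hf b c = hf a c.
Proof.
move=> ab bc; rewrite /hf -map_cat -{2}(subnKC ab) -iotaD; congr (map _ (iota _ _)); lia.
Qed.

Lemma moves_perm s c s' c' : moves s c s' c' -> perm_eq s s'.
Proof.
elim=> // l1 x y l2 {}c c1 s1 c2 _ _ _ h; apply: perm_trans h.
by rewrite perm_cat2l -[x :: y :: l2]/([:: x] ++ [:: y] ++ l2) perm_catCA.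
Qed.

Lemma mkweight_eq (F : fieldType) (cp cp' cm cm' : nat -> nat) (d : F) :
  (forall u, (0 < u)%N -> cp u = cp' u) -> (forall u, (0 < u)%N -> cm u = cm' u) ->
  mkweight cp cm d = mkweight cp' cm' d.
Proof.
move=> hp hm; congr pair; apply/funext => a; case: ifPn => [a0|_].
  by rewrite hp // absz_gt0 gt_eqF.
by case: ifPn => // a0; rewrite hm // absz_gt0 lt_eqF.
Qed.

Section IndexLists.
Variables (q m p n r k : nat).

(** The empty [hf 0 0] keeps the shape of [nat_chain], applied with [q = 0] on the positive side. *)
Definition list_std := neg_ (hf 0 q ++ hf q r ++ ev 0 p) ++ pos_ (hf 0 0 ++ hf 0 k ++ ev 0 m).
Definition list_bar := neg_ (hf 0 q ++ ev 0 p ++ hf q r) ++ pos_ (hf 0 0 ++ ev 0 m ++ hf 0 k).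
Definition seqI := neg_ (hf 0 r) ++ pos_ (hf 0 k).
Definition seqIbar := neg_ (hf 0 q ++ ev 0 p) ++ pos_ (ev 0 m ++ hf 0 n).

Definition mem_lists :=
  (pos_cat, neg_cat, mem_cat, mem_neg_hf, mem_neg_ev, mem_pos_hf, mem_pos_ev).

(* [list_std] and [list_bar] are increasing for the orders [ltf f_std] and
   [ltf f_bar], which agree with [lt_std] and [lt_bar] on the truncated index sets
   and put the remaining indices where the weight vanishes. *)
Definition f_std (a : int) : nat :=
  if a < 0 then par a : nat else if par a then 2%N else 3%N.
Definition far (a : int) := par a && (a <= - (q.*2)%:Z).
Definition f_bar (a : int) : nat := if far a then 0%N else (block a).+1.

Lemma par0 a : par a -> a != 0.
Proof. by apply: contraTneq => ->. Qed.

Lemma par_neq a x : par a -> a != - (x.*2)%:Z.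
Proof. by apply: contraTneq => ->; rewrite /par abszN absz_nat odd_double. Qed.

Lemma block_neg a : a < 0 -> block a = par a.
Proof. by rewrite /block; case: ltgtP. Qed.

Lemma block_pos a : 0 < a -> block a = (2 + par a)%N.
Proof. by rewrite /block => ->. Qed.

Lemma list_std_pairwise : (q <= r)%N -> pairwise (ltf f_std) list_std.
Proof.
move=> qr; rewrite /list_std hf_nil /= catA hf_cat // neg_cat pos_cat -catA.
apply: (proj1 (pairwise_ltf_cat (k := 0%N) _ _ (pairwise_ltf_cat _ _ (pairwise_ltf_cat _ _
  (pairwise_ltf_const _ _))))).
- exact/sorted_neg/sorted_ev.
- by move=> a; rewrite mem_neg_ev /f_std => /and3P[/negPf -> _ h]; case: ifP; lia.
- exact/sorted_neg/sorted_hf.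
- by move=> a; rewrite mem_neg_hf /f_std => /and3P[-> _ h]; case: ifP; lia.
- exact/sorted_pos/sorted_hf.
- by move=> a; rewrite mem_pos_hf /f_std => /and3P[-> h _]; case: ifP; lia.
- exact/sorted_pos/sorted_ev.
- by move=> a; rewrite mem_pos_ev /f_std => /and3P[/negPf -> h _]; case: ifP; lia.
Qed.

Lemma list_bar_pairwise : pairwise (ltf f_bar) list_bar.
Proof.
rewrite /list_bar hf_nil /= !neg_cat pos_cat -!catA.
apply: (proj1 (pairwise_ltf_cat (k := 0%N) _ _ (pairwise_ltf_cat _ _ (pairwise_ltf_cat _ _
  (pairwise_ltf_cat _ _ (pairwise_ltf_const _ _)))))).
- exact/sorted_neg/sorted_hf.
- by move=> a; rewrite mem_neg_hf /f_bar /far => /and3P[-> _ /ltW ->].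
- exact/sorted_neg/sorted_ev.
- move=> a; rewrite mem_neg_ev /f_bar /far => /and3P[/negPf pa _ h].
  by rewrite pa block_neg ?pa.
- exact/sorted_neg/sorted_hf.
- move=> a; rewrite mem_neg_hf /f_bar /far => /and3P[pa h1 h2].
  by rewrite pa block_neg ?pa //= leNgt h1.
- exact/sorted_pos/sorted_ev.
- move=> a; rewrite mem_pos_ev /f_bar /far => /and3P[/negPf pa h _].
  by rewrite pa block_pos ?pa.
- exact/sorted_pos/sorted_hf.
- move=> a; rewrite mem_pos_hf /f_bar /far => /and3P[pa h _].
  by rewrite pa block_pos ?pa // ifF //=; lia.
Qed.

Lemma setI_seq : setI_ (Some r) (Some k) = [set` seqI].
Proof.
apply/seteqP; split=> a; rewrite /seqI /setI_ /= !mem_lists.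
  by move=> [pa h1 h2]; have := par0 pa; rewrite pa; lia.
by case/orP=> /and3P[-> h1 h2]; split; lia.
Qed.

Lemma setIbar_seq : setIbar q m (Some p) (Some n) = [set` seqIbar].
Proof.
apply/seteqP; split=> a; rewrite /seqIbar /setIbar /= !mem_lists.
  by case: ifP => pa /=; [move=> [h1 h2]; have := par0 pa; lia|move=> [h1 h2 h3]; lia].
by case: ifP => pa /= h; split; lia.
Qed.

Lemma seqI_uniq : uniq seqI.
Proof.
apply: (pairwise_ltf_uniq (f := fun a : int => (0 < a)%R : nat)).
apply: (proj1 (pairwise_ltf_cat (k := 0%N) _ _ (pairwise_ltf_const _ _))).
- exact/sorted_neg/sorted_hf.
- by move=> a; rewrite mem_neg_hf => /and3P[_ _ h]; lia.
- exact/sorted_pos/sorted_hf.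
- by move=> a; rewrite mem_pos_hf => /and3P[_ h _]; lia.
Qed.

Lemma seqIbar_uniq : uniq seqIbar.
Proof.
apply: (pairwise_ltf_uniq (f := block)).
rewrite /seqIbar neg_cat pos_cat -!catA.
apply: (proj1 (pairwise_ltf_cat (k := 0%N) _ _ (pairwise_ltf_cat _ _ (pairwise_ltf_cat _ _
  (pairwise_ltf_const _ _))))).
- exact/sorted_neg/sorted_ev.
- by move=> a; rewrite mem_neg_ev => /and3P[/negPf pa _ h]; rewrite block_neg ?pa.
- exact/sorted_neg/sorted_hf.
- by move=> a; rewrite mem_neg_hf => /and3P[pa _ h]; rewrite block_neg ?pa.
- exact/sorted_pos/sorted_ev.
- by move=> a; rewrite mem_pos_ev => /and3P[/negPf pa h _]; rewrite block_pos ?pa.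
- exact/sorted_pos/sorted_hf.
- by move=> a; rewrite mem_pos_hf => /and3P[pa h _]; rewrite block_pos ?pa.
Qed.

Lemma list_std_neq0 a : a \in list_std -> a != 0.
Proof. by rewrite /list_std !mem_lists; case: (par a) => /=; lia. Qed.

Lemma list_bar_neq0 a : a \in list_bar -> a != 0.
Proof. by rewrite /list_bar !mem_lists; case: (par a) => /=; lia. Qed.

Lemma seqI_sub : (q <= r)%N -> {subset seqI <= list_std}.
Proof.
move=> qr a; rewrite /seqI /list_std !mem_lists.
by case: (boolP (par a)) => //= /(par_neq q) aq; case/orP => /andP[h1 h2]; lia.
Qed.

Lemma seqIbar_sub : (n <= k)%N -> {subset seqIbar <= list_std}.
Proof. by move=> nk a; rewrite /seqIbar /list_std !mem_lists; case: (par a) => /=; lia. Qed.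

Lemma list_std_odd a : (q <= r)%N -> a \in list_std -> par a -> a \in seqI.
Proof. by move=> qr; rewrite /list_std /seqI !mem_lists; case: (par a) => //=; lia. Qed.

(** The integers stand at the two ends of the list, so a pair containing one has a negative integer
    on the left or a positive one on the right; [T_E0] covers both. *)
Lemma lt_std_bridge a b : (q <= r)%N -> a \in list_std -> b \in list_std -> ltf f_std a b ->
  [\/ (a < 0) && ~~ par a, (0 < b) && ~~ par b | [&& a \in seqI, b \in seqI & a < b]].
Proof.
move=> qr ha hb; have [pa|pa] := boolP (par a); have [pb|pb] := boolP (par b).
- rewrite !list_std_odd // /ltf /f_std pa pb /= => h; constructor 3.
  by move: h; case: ifP; case: ifP; lia.
- have b0 := list_std_neq0 hb; rewrite /ltf /f_std pa (negPf pb) => h.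
  by constructor 2; move: h; case: ifP; case: ifP => //=; lia.
- have a0 := list_std_neq0 ha; rewrite /ltf /f_std pb (negPf pa) => h.
  by constructor 1; move: h; case: ifP; case: ifP => //=; lia.
- have [a0|a0] := ltP a 0; first by constructor 1.
  move=> h; constructor 2; have b0 := list_std_neq0 hb; move: a0 h; rewrite leNgt => /negPf a0.
  by rewrite /ltf /f_std a0 (negPf pa) (negPf pb); case: ifP => //=; lia.
Qed.

Lemma lt_std_seqI a b : a \in seqI -> b \in seqI -> a < b -> ltf f_std a b.
Proof.
have odd_ c : c \in seqI -> par c by rewrite /seqI !mem_lists => /orP[]/and3P[].
move=> /odd_ pa /odd_ pb ab; rewrite /ltf /f_std pa pb.
by case: ifP; case: ifP; lia.
Qed.

Lemma list_bar_cases a : a \in list_bar ->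
  [\/ far a, [&& 0 < a, par a & (n.*2)%:Z <= a] | a \in seqIbar].
Proof.
rewrite /list_bar /seqIbar /far !mem_lists; have [pa|pa] := boolP (par a) => /= h.
  have [h1|h1] := leP a (- (q.*2)%:Z); first by constructor 1.
  have [h2|h2] := leP (n.*2)%:Z a; last by constructor 3; lia.
  by constructor 2; move: h; lia.
by constructor 3; move: h; lia.
Qed.

Lemma lt_bar_bridge a b : a \in list_bar -> b \in list_bar -> ltf f_bar a b ->
  [\/ far a, [&& 0 < b, par b & (n.*2)%:Z <= b] | [&& a \in seqIbar, b \in seqIbar & lt_bar a b]].
Proof.
move=> /list_bar_cases ha /list_bar_cases hb h.
have [fa|fa] := boolP (far a); first by constructor 1.
have fb : ~~ far b by apply: contraTN h => fb; rewrite /ltf /f_bar fb (negPf fa).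
move: h; rewrite /ltf /f_bar (negPf fa) (negPf fb) ltnS eqSS -/(lt_bar a b) => ab.
case: hb => [fb'|hb|hb]; [by rewrite fb' in fb|by constructor 2|].
case: ha => [fa'|/and3P[a0 pa na]|ha]; [by rewrite fa' in fa| |by constructor 3; rewrite ha hb].
(* Large positive half-odd indices come last, so whatever follows one is again of this kind. *)
constructor 2; move: ab; rewrite /lt_bar (block_pos a0) pa /block.
by case: (0 < b); case: (par b) => //= /(le_lt_trans na)/ltW.
Qed.

Lemma lt_bar_seqIbar a b : (n <= k)%N -> a \in seqIbar -> b \in seqIbar -> lt_bar a b ->
  [/\ a \in list_bar, b \in list_bar & ltf f_bar a b].
Proof.
move=> nk; have near_ c : c \in seqIbar -> c \in list_bar /\ ~~ far c.
  by rewrite /list_bar /seqIbar /far !mem_lists; case: (par c) => /= h; split; lia.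
move=> /near_[la /negPf fa] /near_[lb /negPf fb] ab; split=> //.
by rewrite /ltf /f_bar fa fb ltnS eqSS.
Qed.

End IndexLists.

(** * Supports of the two weights *)

Section WeightSupport.
Variables (F : numFieldType) (q m p n : nat) (mup mum : intpart) (d : F).

Lemma wstd_wend : wstd mup mum d = mkweight (wend mup 0 0) (wend mum q 0) d.
Proof.
apply: mkweight_eq => u u0; rewrite /wend; case: ifP => // ou.
- by rewrite subn0 if_same.
- by rewrite ltnNge andNb.
- by rewrite subn0 if_same.
- by rewrite ltnNge andNb.
Qed.

(** The hypothesis says that columns beyond [q] have height at most [p] and rows beyond [p] length
    at most [q], so nothing remains at half-odd indices beyond [q] nor at integers beyond [p]. *)
Lemma wbar_wend : (part mum p.+1 <= q)%N ->
  wbar q m mup mum d = mkweight (wend mup 0 m) (wend mum q p) d.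
Proof.
move=> hq; apply: mkweight_eq => u u0; rewrite /wend.
  case: ifP => ou; first by rewrite leqNgt; case: u u0 ou.
  by rewrite subn0; case: u u0 ou => [//|[|u]].
case: ifP => ou.
  case: (leqP (uphalf u) q) => // qk; apply/esym/eqP; rewrite subn_eq0.
  apply: leq_trans (conj_le mum qk) _.
  by rewrite leqNgt conj_part // -leqNgt.
case: (leqP (uphalf u) p) => pk; first by case: u u0 ou pk => [//|[|u]].
rewrite andbF; apply/eqP; rewrite subn_eq0; apply: leq_trans hq; exact: part_le.
Qed.

Lemma wstd_even a : ~~ par a -> (wstd mup mum d).2 a = 0.
Proof. by rewrite /par /= => /negPf ->; case: ifP => // _; case: ifP; rewrite // oppr0. Qed.

Lemma wstd_off r k a : (part mum 1 <= r)%N -> (part mup 1 <= k)%N ->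
  a != 0 -> a \notin seqI r k -> (wstd mup mum d).2 a = 0.
Proof.
move=> hr hk a0; have [pa|/wstd_even //] := boolP (par a).
move: (pa); rewrite /par => oa; rewrite /seqI !mem_lists /= oa => h.
case: ifPn => ap; first by rewrite (conj_large hk) //; lia.
by case: ifPn => an; rewrite // (conj_large hr) ?oppr0 //; lia.
Qed.

Lemma wbar_far a : far q a -> (wbar q m mup mum d).2 a = 0.
Proof.
rewrite /far => /andP[pa h]; rewrite /= -/(par a) pa.
case: ifPn => ap; first by lia.
by case: ifPn => // an; rewrite ifF ?oppr0 //; move: pa; rewrite /par; lia.
Qed.

Lemma wbar_large a : (conjpart mup n.+1 <= m)%N -> 0 < a -> par a -> (n.*2)%:Z <= a ->
  (wbar q m mup mum d).2 a = 0.
Proof.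
move=> hn a0 pa h; rewrite /= a0 -/(par a) pa.
have le : (n < uphalf `|a|)%N by move: pa; rewrite /par; lia.
by have := leq_trans (conj_le mup le) hn; rewrite -subn_eq0 => /eqP ->.
Qed.

Lemma wbar_off a : (conjpart mup n.+1 <= m)%N -> (part mum p.+1 <= q)%N ->
  a != 0 -> a \notin seqIbar q m p n -> (wbar q m mup mum d).2 a = 0.
Proof.
move=> hn hp a0; have [pa|pa] := boolP (par a).
  have [|fa] := boolP (far q a); first by move=> /wbar_far.
  have [/and3P[h1 h2 h3] _|l1] := boolP [&& 0 < a, par a & (n.*2)%:Z <= a].
    exact: wbar_large.
  by move: pa fa l1; rewrite /seqIbar !mem_lists /far /par; lia.
rewrite /seqIbar !mem_lists /= -/(par a) (negPf pa) => h; move: (pa); rewrite /par => pa'.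
case: ifPn => ap; first by rewrite ifF //; lia.
case: ifPn => // an; have le : (p < uphalf `|a|)%N by lia.
by have := leq_trans (part_le mum (ltn0Sn p) le) hp; rewrite -subn_eq0 => /eqP ->; rewrite oppr0.
Qed.

(** Membership yields the bounds for some partitions with the same barred weight. They pass to [mup]
    and [mum] because each bound is the vanishing of one coefficient, at n + 1/2 and at -(p + 1). *)
Lemma Pbar_bounds : Pbar q m (Some p) (Some n) (wbar q m mup mum d) ->
  (conjpart mup n.+1 <= m)%N /\ (part mum p.+1 <= q)%N.
Proof.
move=> [lp [lm [d' [e hn hp]]]]; split.
  have := congr1 (fun g : weight F => g.2 (n.*2.+1)%:Z) e.
  rewrite /= odd_double /= doubleK => /eqP; rewrite eqr_nat => /eqP e'.
  by rewrite -subn_eq0 e' subn_eq0.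
have := congr1 (fun g : weight F => g.2 (- (p.*2.+2)%:Z)) e.
rewrite /= odd_double /=.
rewrite uphalf_double => /eqP; rewrite eqr_opp eqr_nat => /eqP e'.
by rewrite -subn_eq0 e' subn_eq0.
Qed.

End WeightSupport.

Section SortedLists.
Variables (R : realType) (l : nat).
Local Notation C := R[i].
Variables (M : 'I_l -> gmod C setIt).
Hypothesis hM : forall i, inOtilde (M i).

Lemma sing_sorted f (s : seq int) (S : set int) (lt : rel int) (w : int -> C) (t : tensM M) :
  pairwise (ltf f) s -> (forall a, a \in s -> a != 0) ->
  wt (fun a b => Et M a b) w t ->
  (forall a b, a \in s -> b \in s -> ltf f a b ->
     [\/ (0 < b) && (w b == 0), (a < 0) && (w a == 0) | [/\ S a, S b & lt a b]]) ->
  (forall a b, S a -> S b -> lt a b -> [/\ a \in s, b \in s & ltf f a b]) ->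
  (forall a b, S a -> S b -> lt a b -> Et M a b t = 0) <-> Sing s t.
Proof.
move=> ps s0 wt_ hs hS; apply: iff_trans (iff_sym (pairwise_ltf _ ps)); split=> h a b ha hb ab.
  apply/asboolP; have ne : a != b by apply: contraTneq ab => ->; exact: ltf_irr.
  case: (hs a b ha hb ab) => [z|z|[Sa Sb lab]]; last exact: h.
    by apply: (T_E0 hM wt_ _ _ ne); rewrite ?s0 ?z.
  by apply: (T_E0 hM wt_ _ _ ne); rewrite ?s0 ?z ?orbT.
by have [sa sb fab] := hS a b ha hb ab; exact/asboolP/h.
Qed.

Variables (q m p n r k : nat) (mup mum : intpart) (d : C).
Hypotheses (qr : (q <= r)%N) (nk : (n <= k)%N).
Hypotheses (hn : (conjpart mup n.+1 <= m)%N) (hp : (part mum p.+1 <= q)%N).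

Lemma sing_std (t : tensM M) : Twt M (wstd mup mum d) t ->
  (forall a b, setI_ (Some r) (Some k) a -> setI_ (Some r) (Some k) b -> lt_std a b ->
    Et M a b t = 0) <-> Sing (list_std q m p r k) t.
Proof.
move=> /Twt_wt wt_; have ps := list_std_pairwise m p k qr.
apply: (sing_sorted ps _ wt_); first exact: list_std_neq0.
  move=> a b sa sb ab; case: (lt_std_bridge qr sa sb ab) => [/andP[a0 pa]|/andP[b0 pb]|/and3P[ha hb lab]].
  - by constructor 2; rewrite a0 wstd_even ?eqxx.
  - by constructor 1; rewrite b0 wstd_even ?eqxx.
  - by constructor 3; rewrite setI_seq.
rewrite setI_seq => a b ha hb lab; split; [exact: seqI_sub ha|exact: seqI_sub hb|].
exact: (lt_std_seqI ha hb lab).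
Qed.

Lemma sing_bar (t : tensM M) : Twt M (wbar q m mup mum d) t ->
  (forall a b, setIbar q m (Some p) (Some n) a -> setIbar q m (Some p) (Some n) b -> lt_bar a b ->
    Et M a b t = 0) <-> Sing (list_bar q m p r k) t.
Proof.
move=> /Twt_wt wt_; have ps := list_bar_pairwise q m p r k.
have SE := setIbar_seq q m p n.
apply: (sing_sorted ps _ wt_); first exact: list_bar_neq0.
  move=> a b sa sb ab; case: (lt_bar_bridge n sa sb ab) => [fa|/and3P[b0 pb nb]|/and3P[ha hb lab]].
  - have a0 : a < 0.
      have := list_bar_neq0 sa; move: fa; rewrite /far => /andP[_ h]; lia.
    by constructor 2; rewrite a0 wbar_far ?eqxx.
  - by constructor 1; rewrite b0 (wbar_large _ _ _ hn) ?eqxx.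
  - by constructor 3; rewrite SE.
by rewrite SE => a b ha hb lab; exact: (lt_bar_seqIbar _ _ ha hb lab).
Qed.

Variables (U : set (points R l)) (kappa : C).
Local Notation TSol := (TSol (M := M) (U := U) kappa (list_std q m p r k)).

Lemma list_chain : (part mum 1 <= r)%N -> (part mup 1 <= k)%N ->
  biiso (TSol (list_std q m p r k) (wstd mup mum d)) (TSol (list_bar q m p r k) (wbar q m mup mum d)).
Proof.
move=> hr hk; rewrite (wstd_wend q) (wbar_wend _ _ _ hp).
have A0 := @list_std_neq0 q m p r k.
have uA : uniq (list_std q m p r k) by exact: pairwise_ltf_uniq (list_std_pairwise m p k qr).
have mn := nat_chain p qr hr; have mp := nat_chain (nu := mup) m (leq0n k) hk.
(* The negative indices are rearranged with the positive coefficients still standard, the positive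
   ones with the negative coefficients already barred. *)
apply: (biiso_trans (chain_neg hM U kappa uA A0 d (wend mup 0 0) mn _)); first by split.
apply: (chain_pos hM U kappa uA A0 d (wend mum q p) mp).
have pm : perm_eq (neg_ (hf 0 q ++ ev 0 p ++ hf q r) ++ pos_ (hf 0 0 ++ hf 0 k ++ ev 0 m))
    (list_std q m p r k).
  rewrite /list_std perm_cat2r /neg_ perm_rev perm_sym perm_rev perm_map //.
  exact: moves_perm mn.
by split; [rewrite (perm_uniq pm)|move=> a; rewrite (perm_mem pm)].
Qed.

End SortedLists.

Theorem theorem1p3 (R : realType) (q m l : nat) (hl : (2 <= l)%N)
    (p n : nat) (hn : (0 < n)%N) (kappa : R[i]) (hkappa : kappa != 0)
    (U : set (points R l)) (hU0 : U !=set0) (hUo : open U)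
    (hU : U `<=` configuration R l)
    (L : 'I_l -> 'I_l -> points R l -> R[i]^o) (hL : log_branch U L)
    (M : 'I_l -> gmod R[i] setIt) (hM : forall i, inOtilde (M i))
    (mup mum : intpart) (d : R[i])
    (hmu : Pbar q m (Some p) (Some n) (wbar q m mup mum d)) :
  exists r0 k0 : nat, forall r k : nat, (r0 <= r)%N -> (k0 <= k)%N ->
    linear_iso
      (singular_solutions (M := fun i => trbar p n (functorTbar q m (M i)))
         (U := U) kappa lt_bar (wbar q m mup mum d))
      (singular_solutions (M := fun i => tr r k (functorT (M i)))
         (U := U) kappa lt_std (wstd mup mum d)).
Proof.
have [hm hq] := Pbar_bounds hmu.
(* [q <= r] and [n <= k] put both index sets inside [list_std]; the bounds by the first rows put the
   support of the standard weight inside the truncated index set. *)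
exists (maxn q (part mum 1)), (maxn n (part mup 1)) => r k.
rewrite !geq_max => /andP[qr hr] /andP[nk hk].
have uA : uniq (list_std q m p r k) by exact: pairwise_ltf_uniq (list_std_pairwise m p k qr).
apply: biiso_linear_iso.
have ch := list_chain hM m d qr hq U kappa hr hk.
apply: (biiso_trans _ (biiso_trans (biiso_sym ch) (biiso_sym _))).
  apply: (side_iso hM hkappa hUo hL (sS := seqIbar q m p n)) => //.
  - exact: setIbar_sub_It.
  - exact: setIbar_seq.
  - exact: seqIbar_uniq.
  - exact: list_std_neq0.
  - exact: seqIbar_sub nk.
  - by move=> i; exact: trunc_embedding.
  - by move=> a a0; exact: wbar_off.
  - by move=> a b; apply: contraTneq => ->; rewrite /lt_bar ltnn ltxx andbF.
  - exact: list_bar_neq0.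
  - by move=> t; exact: sing_bar.
apply: (side_iso hM hkappa hUo hL (sS := seqI r k)) => //.
- exact: setI_sub_It.
- exact: setI_seq.
- exact: seqI_uniq.
- exact: list_std_neq0.
- exact: seqI_sub.
- by move=> i; exact: trunc_embedding.
- by move=> a a0; exact: wstd_off.
- by move=> a b; apply: contraTneq => ->; rewrite /lt_std ltxx.
- exact: list_std_neq0.
- by move=> t; exact: sing_std.
Qed.
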